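(* Suppose that $F = F_1 \#_C F_2$, where $C$ separates $F$ into subsurfaces of genera $g_1$ and $g_2$. Then there always exists a root of the Dehn twist $t_C$ about $C$ of degree $\operatorname{lcm}(4g_1, 4g_2 + 2)$.
   Context: $F$ is a closed oriented surface of genus $g\ge2$ and $C$ is a simple closed curve separating $F$ into two subsurfaces of genera $g_1\ge g_2\ge1$, so $g=g_1+g_2$; $F_i$ is the closed surface of genus $g_i$ obtained by capping the boundary circle of the $i$-th subsurface with a disk, and one writes $F=F_1\#_CF_2$. $\operatorname{Mod}(F)$ is the group of isotopy classes of orientation-preserving homeomorphisms of $F$, and $t_C\in\operatorname{Mod}(F)$ is the left-handed Dehn twist about $C$. A root of $t_C$ of degree $n$ is an $h\in\operatorname{Mod}(F)$ with $h^n=t_C$. *)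

(* Defs.v *)
From HB Require Import structures.
From mathcomp Require Import all_boot all_order all_algebra.
From mathcomp Require Import all_classical all_reals all_analysis.
From Stdlib Require Import Relation_Operators.
Set Implicit Arguments.
Unset Strict Implicit.
Unset Printing Implicit Defensive.
Import Order.TTheory GRing.Theory Num.Theory.
Import numFieldNormedType.Exports.
Local Open Scope classical_set_scope.
Local Open Scope ring_scope.

Notation plane R := (R * R)%type.

Definition open_embedding (T U : topologicalType) (e : T -> U) : Prop :=
  [/\ injective e, continuous e & forall A : set T, open A -> open (e @` A)].

(** A continuous injection [j] of the plane into itself preserves orientation
    when its local degree is 1: seen from [j 0], the image under [j] of the
    unit circle, parametrised counterclockwise, winds once counterclockwise. *)
Definition orientation_preserving (R : realType) (j : plane R -> plane R) :
    Prop :=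
  exists th : R -> R,
    [/\ continuous th, th (2 * pi) = th 0 + 2 * pi
      & forall s : R, exists2 r : R, 0 < r
          & j (cos s, sin s) =
            ((j (0, 0)).1 + r * cos (th s), (j (0, 0)).2 + r * sin (th s))].

Definition reflection (R : realType) (p : plane R) : plane R := (p.1, - p.2).

(** An orientation is a maximal oriented atlas: a set of parametrisations, by
    the whole plane, of open subsets of the surface.  Of two opposite
    parametrisations one belongs to it, and parametrisations in it which are
    nested, [e' = e \o j], differ by an orientation-preserving [j].  Nested
    ones suffice, since two overlapping parametrisations both contain a common
    third one (or its opposite) around any point of the overlap. *)
Record closed_oriented_surface (R : realType) := ClosedOrientedSurface {
  carrier :> topologicalType;
  orientation : set (plane R -> carrier);
  surface_hausdorff : hausdorff_space carrier;
  surface_compact : compact [set: carrier];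
  surface_connected : connected [set: carrier];
  surface_locally_plane : forall x : carrier,
    exists2 e : plane R -> carrier, open_embedding e & range e x;
  orientation_sub : forall e, orientation e -> open_embedding e;
  orientation_total : forall e, open_embedding e ->
    orientation e \/ orientation (e \o @reflection R);
  orientation_coherent : forall e e' (j : plane R -> plane R),
    orientation e -> orientation e' -> continuous j -> e' = e \o j ->
    orientation_preserving j }.

Section MappingClassGroup.
Context {R : realType} (F : closed_oriented_surface R).

Record homeo := Homeo {
  homeo_fun :> F -> F;
  homeo_inv : F -> F;
  homeo_continuous : continuous homeo_fun;
  homeo_inv_continuous : continuous homeo_inv;
  homeo_funK : cancel homeo_fun homeo_inv;
  homeo_invK : cancel homeo_inv homeo_fun;
  homeo_orientation : forall e : plane R -> F,
    orientation (homeo_fun \o e) <-> orientation e }.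

HB.instance Definition _ := gen_eqMixin homeo.
HB.instance Definition _ := gen_choiceMixin homeo.

Lemma homeo_ext (f g : homeo) : homeo_fun f = homeo_fun g -> f = g.
Proof.
case: f => f f' cf cf' fK f'K fo; case: g => g g' cg cg' gK g'K go /= fg.
subst g.
have E : f' = g' by apply/funext => x; rewrite -{1}(g'K x) fK.
subst g'.
by congr Homeo; exact: Prop_irrelevance.
Qed.

Definition homeo1 : homeo.
Proof. by exists idfun idfun => //; move=> x; exact: cvg_id. Defined.

Definition homeoM (f g : homeo) : homeo.
Proof.
exists (f \o g) (homeo_inv g \o homeo_inv f).
- move=> x; apply: continuous_comp; exact: homeo_continuous.
- move=> x; apply: continuous_comp; exact: homeo_inv_continuous.
- by move=> x /=; rewrite !homeo_funK.
- by move=> x /=; rewrite !homeo_invK.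
- by move=> e; rewrite -compA !homeo_orientation.
Defined.

Definition homeoV (f : homeo) : homeo.
Proof.
exists (homeo_inv f) f.
- exact: homeo_inv_continuous.
- exact: homeo_continuous.
- exact: homeo_invK.
- exact: homeo_funK.
- move=> e; rewrite -(homeo_orientation f) compA.
  suff -> : f \o homeo_inv f = idfun by [].
  by apply/funext => x /=; rewrite homeo_invK.
Defined.

Lemma homeoMA : associative homeoM.
Proof. by move=> f g h; apply: homeo_ext. Qed.

Lemma homeo1M : left_id homeo1 homeoM.
Proof. by move=> f; apply: homeo_ext. Qed.

Lemma homeoM1 : right_id homeo1 homeoM.
Proof. by move=> f; apply: homeo_ext. Qed.

Lemma homeoVM : left_inverse homeo1 homeoV homeoM.
Proof. by move=> f; apply/homeo_ext/funext => x /=; exact: homeo_funK. Qed.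

Lemma homeoMV : right_inverse homeo1 homeoV homeoM.
Proof. by move=> f; apply/homeo_ext/funext => x /=; exact: homeo_invK. Qed.

HB.instance Definition _ :=
  isGroup.Build homeo homeoMA homeo1M homeoM1 homeoVM homeoMV.

Definition cylinder : set (R * F) := [set p | 0 <= p.1 <= 1].

Definition isotopic (f g : homeo) : Prop :=
  exists H : R -> homeo,
    [/\ {within cylinder, continuous (fun p : R * F => H p.1 p.2)},
        H 0 = f & H 1 = g].

Lemma withinP (T U : topologicalType) (A : set T) (u : T -> U) :
  {within A, continuous u} <->
  forall p, A p -> u @ within A (nbhs p) --> u p.
Proof.
rewrite continuous_subspace_in; split=> cu p Ap.
  by rewrite (nbhs_subspace_in Ap); exact: cu (mem_set Ap).
have := cu p (set_mem Ap).
by rewrite (nbhs_subspace_in (set_mem Ap)).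
Qed.

Lemma within_comp (T T' U : topologicalType) (A : set T) (A' : set T')
    (v : T -> T') (u : T' -> U) :
  {within A', continuous u} -> {within A, continuous v} ->
  (forall p, A p -> A' (v p)) -> {within A, continuous (u \o v)}.
Proof.
move=> /withinP cu /withinP cv AA'; apply/withinP => p Ap B /= Bp.
have vB : nbhs p [set x | A x -> A' (v x) -> B (u (v x))].
  exact: (cv p Ap _ (cu _ (AA' p Ap) B Bp)).
change (nbhs p [set x | A x -> B (u (v x))]).
by apply: filterS vB => x /= h Ax; apply: h => //; exact: AA'.
Qed.

Lemma isotopic_refl f : isotopic f f.
Proof.
exists (fun=> f); split=> //; apply: continuous_subspaceT => p.
apply: (@continuous_comp _ _ _ snd f); first exact: cvg_snd.
exact: homeo_continuous.
Qed.

Lemma isotopic_sym f g : isotopic f g -> isotopic g f.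
Proof.
move=> [H [cH H0 H1]]; exists (fun t => H (1 - t)).
split; rewrite ?subr0 ?subrr //.
pose v (p : R * F) : R * F := (1 - p.1, p.2).
apply: (within_comp (v := v) cH).
  apply: continuous_subspaceT => -[t x].
  apply: (@cvg_pair _ _ _ _ (nbhs (1 - t)) (nbhs x)) => /=; last exact: cvg_snd.
  by apply: cvgB; [exact: cvg_cst|exact: cvg_fst].
by move=> [t x] /=; rewrite /cylinder /= subr_ge0 lerBlDr lerDl andbC.
Qed.

Lemma isotopicM f f' g g' :
  isotopic f f' -> isotopic g g' -> isotopic (f * g)%g (f' * g')%g.
Proof.
move=> [H [cH <- <-]] [K [cK <- <-]]; exists (fun t => H t * K t)%g; split=> //.
pose v (p : R * F) : R * F := (p.1, K p.1 p.2).
apply: (within_comp (v := v) cH) => //.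
apply/withinP => -[t x] Ap.
apply: (@cvg_pair _ _ _ _ (nbhs t) (nbhs (K t x))) => /=.
  by apply: cvg_within_filter; exact: cvg_fst.
by move/withinP: cK => /(_ _ Ap).
Qed.

Lemma isotopic_trans f g h : isotopic f g -> isotopic g h -> isotopic f h.
Proof.
move=> fg gh; have := isotopicM (isotopicM fg (isotopic_refl g^-1%g)) gh.
by rewrite mulgVK mulgV mul1g.
Qed.

Lemma isotopicV f g : isotopic f g -> isotopic f^-1%g g^-1%g.
Proof.
move=> /isotopic_sym gf.
have := isotopicM (isotopicM (isotopic_refl f^-1%g) gf) (isotopic_refl g^-1%g).
by rewrite mulVg mul1g mulgK.
Qed.

Definition isotopicb (f g : homeo) : bool := `[< isotopic f g >].

Let isotopicb_refl : reflexive isotopicb.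
Proof. by move=> f; apply/asboolP; exact: isotopic_refl. Qed.

Let isotopicb_sym : symmetric isotopicb.
Proof.
by move=> f g; apply/idP/idP => /asboolP ?; apply/asboolP/isotopic_sym.
Qed.

Let isotopicb_trans : transitive isotopicb.
Proof.
by move=> g f h /asboolP fg /asboolP gh; apply/asboolP/(isotopic_trans fg gh).
Qed.

Canonical isotopicb_equiv :=
  EquivRel isotopicb isotopicb_refl isotopicb_sym isotopicb_trans.

Local Open Scope quotient_scope.

Definition Mod : Type := {eq_quot isotopicb}.
HB.instance Definition _ := Choice.on Mod.
HB.instance Definition _ := EqQuotient.on Mod.

Definition class_of_homeo (f : homeo) : Mod := \pi_Mod f.

Lemma class_of_homeoP (f g : homeo) :
  class_of_homeo f = class_of_homeo g <-> isotopic f g.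
Proof. by split=> [/eqmodP/asboolP|fg]; [|apply/eqmodP/asboolP]. Qed.

Lemma isotopic_repr (f : homeo) : isotopic (repr (class_of_homeo f)) f.
Proof. by apply/class_of_homeoP; rewrite /class_of_homeo reprK. Qed.

Definition mapping_class1 : Mod := class_of_homeo 1%g.
Definition mapping_classM (a b : Mod) : Mod :=
  class_of_homeo (repr a * repr b)%g.
Definition mapping_classV (a : Mod) : Mod :=
  class_of_homeo (repr a)^-1%g.

Lemma mapping_classME f g :
  mapping_classM (class_of_homeo f) (class_of_homeo g) =
  class_of_homeo (f * g)%g.
Proof. by apply/class_of_homeoP/isotopicM; exact: isotopic_repr. Qed.

Lemma mapping_classVE f :
  mapping_classV (class_of_homeo f) = class_of_homeo f^-1%g.
Proof. by apply/class_of_homeoP/isotopicV; exact: isotopic_repr. Qed.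

Lemma mapping_class_ind (P : Mod -> Prop) :
  (forall f, P (class_of_homeo f)) -> forall a, P a.
Proof. by move=> Pf a; rewrite -[a]reprK; exact: Pf. Qed.

Lemma mapping_classMA : associative mapping_classM.
Proof.
elim/mapping_class_ind => f; elim/mapping_class_ind => g.
by elim/mapping_class_ind => h; rewrite !mapping_classME mulgA.
Qed.

Lemma mapping_class1M : left_id mapping_class1 mapping_classM.
Proof. by elim/mapping_class_ind => f; rewrite mapping_classME mul1g. Qed.

Lemma mapping_classM1 : right_id mapping_class1 mapping_classM.
Proof. by elim/mapping_class_ind => f; rewrite mapping_classME mulg1. Qed.

Lemma mapping_classVM :
  left_inverse mapping_class1 mapping_classV mapping_classM.
Proof.
by elim/mapping_class_ind => f; rewrite mapping_classVE mapping_classME mulVg.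
Qed.

Lemma mapping_classMV :
  right_inverse mapping_class1 mapping_classV mapping_classM.
Proof.
by elim/mapping_class_ind => f; rewrite mapping_classVE mapping_classME mulgV.
Qed.

HB.instance Definition _ := isGroup.Build Mod
  mapping_classMA mapping_class1M mapping_classM1 mapping_classVM
  mapping_classMV.

Lemma class_of_homeoM f g :
  (class_of_homeo f * class_of_homeo g)%g = class_of_homeo (f * g)%g.
Proof. exact: mapping_classME. Qed.

Lemma class_of_homeoX f n :
  (class_of_homeo f ^+ n)%g = class_of_homeo (f ^+ n)%g.
Proof.
elim: n => [|n IHn]; first by rewrite !expg0.
by rewrite !expgS IHn class_of_homeoM.
Qed.

End MappingClassGroup.

Section Genus.
Context {R : realType}.

(** For [u] in [[0, 4g]], [boundary_point g u] runs along the boundary of the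
    unit disk, seen as a polygon with [4g] sides: the [k]-th side is given by
    [u] in [[k, k+1]]. *)
Definition boundary_point (g : nat) (u : R) : plane R :=
  (cos (2 * pi * u / (4 * g)%:R), sin (2 * pi * u / (4 * g)%:R)).

(** The sides are paired according to the boundary word
    [a_0 b_0 a_0^-1 b_0^-1 a_1 b_1 a_1^-1 b_1^-1 ...]. *)
Definition side_pairing (g : nat) (x y : plane R) : Prop :=
  exists (i : nat) (s : R), [/\ (i < g)%N, 0 <= s <= 1 &
    (x = boundary_point g ((4 * i)%:R + s) /\
     y = boundary_point g ((4 * i)%:R + 3 - s)) \/
    (x = boundary_point g ((4 * i)%:R + 1 + s) /\
     y = boundary_point g ((4 * i)%:R + 4 - s))].

Definition annulus (rho : R) : set (plane R) :=
  [set p | rho ^+ 2 <= p.1 ^+ 2 + p.2 ^+ 2 <= 1].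

Definition circle (rho : R) : set (plane R) :=
  [set p | p.1 ^+ 2 + p.2 ^+ 2 = rho ^+ 2].

(** In a Hausdorff space, this makes [S] homeomorphic to the quotient of
    [annulus rho] by the pairing of the sides of the polygon. *)
Definition polygon_quotient (F : topologicalType) (g : nat) (rho : R)
    (S : set F) (q : plane R -> F) : Prop :=
  [/\ {within annulus rho, continuous q}, q @` annulus rho = S &
    forall x y, annulus rho x -> annulus rho y ->
      (q x = q y <-> clos_refl_sym_trans _ (side_pairing g) x y)].

(** The closed surface of genus [g > 0] is the connected sum of [g] tori, that
    is the [4g]-gon with its sides paired as above; the sphere, [g = 0], is not
    covered. *)
Definition closed_surface_of_genus (F : closed_oriented_surface R) (g : nat) :
    Prop :=
  (0 < g)%N /\ exists q, polygon_quotient g 0 [set: F] q.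

(** [S] is bounded by the single circle [C], and capping it with a disk yields
    the closed surface of genus [g > 0]: it is the latter minus an open disk. *)
Definition subsurface_of_genus (F : closed_oriented_surface R) (g : nat)
    (S C : set F) : Prop :=
  (0 < g)%N /\
  exists2 q : plane R -> F,
    polygon_quotient g 2^-1 S q & q @` circle 2^-1 = C.

Definition simple_closed_curve (F : closed_oriented_surface R) (C : set F) :
    Prop :=
  exists c : R -> F, [/\ continuous c, range c = C &
    forall s s', c s = c s' <-> s - s' \is a Num.int].

Definition separates (F : closed_oriented_surface R) (C : set F)
    (g1 g2 : nat) : Prop :=
  simple_closed_curve C /\
  exists S1 S2 : set F, [/\ S1 `|` S2 = setT, S1 `&` S2 = C,
    subsurface_of_genus g1 S1 C & subsurface_of_genus g2 S2 C].

End Genus.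

Section DehnTwist.
Context {R : realType} (F : closed_oriented_surface R).

Definition strip : set (plane R) := [set p | 0 <= p.1 <= 1].

(** With [t] in [[0, 1]] and [s] in [R / Z], [a (t, s)] parametrises a closed
    annulus with core [C]; the coordinates [(t, s)], in this order, are
    positively oriented. *)
Definition annulus_around (C : set F) (a : plane R -> F) : Prop :=
  [/\ {within strip, continuous a},
      forall p p', strip p -> strip p' ->
        (a p = a p' <-> p.1 = p'.1 /\ p.2 - p'.2 \is a Num.int),
      [set a (2^-1, s) | s in [set: R]] = C &
      forall e (j : plane R -> plane R), orientation e -> continuous j ->
        (forall p, 0 < (j p).1 < 1) -> e = a \o j ->
        orientation_preserving j].

(** Along an arc crossing the annulus in the direction of increasing [t], the
    twist turns towards increasing [s], that is to the left. *)
Definition left_twist_about (C : set F) (f : homeo F) : Prop :=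
  exists a, [/\ annulus_around C a,
    forall p, strip p -> f (a p) = a (p.1, p.2 + p.1) &
    forall x, ~ (a @` strip) x -> f x = x].

Definition is_dehn_twist (C : set F) (tC : Mod F) : Prop :=
  exists2 f, left_twist_about C f & tC = class_of_homeo f.

End DehnTwist.

(* Main.v *)
Require Import Defs.
From mathcomp Require Import all_boot all_order all_algebra.
From mathcomp Require Import all_classical all_reals all_analysis.
From mathcomp Require Import ring lra zify.
From Stdlib Require Import Relation_Operators.
Set Implicit Arguments.
Unset Strict Implicit.
Unset Printing Implicit Defensive.
Import Order.TTheory GRing.Theory Num.Theory.
Import numFieldNormedType.Exports.
Local Open Scope classical_set_scope.
Local Open Scope ring_scope.

(**
Let [S] be a subsurface bounded by [C], and [n] be [4 g] or [4 g + 2], where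
[g] is its genus.  Up to a capping disk, [S] is a polygon with [n] sides whose
opposite sides are glued, and the rotation by one side is a symmetry of this
gluing.  Turning the circle of radius [y] by an angle [l y], where the profile
[l] is zero near [C] and [1 / n] on the boundary of the polygon, is therefore a
homeomorphism of [S], supported away from [C].  Such homeomorphisms compose by
adding the profiles, and their isotopy class depends only on the profile at the
ends; letting the profile on [C] vary moves a full turn from one side of [C] to
the other.  Hence the [n]-th power of the homeomorphism above is the Dehn twist
or its inverse; with suitable multiples of [1 / n1] and [1 / n2] on the two
sides of [C], given by a Bezout relation, one gets a root of degree
[lcm n1 n2].

The gluing [a b a^-1 b^-1 c d c^-1 d^-1 ...] is turned into that of opposite
sides by the move [u V Z u^-1 W -> u Z V u^-1 W]: gluing the two sides [u] makes
[V Z] a circle, which can be turned.  Once a side has been subdivided, the same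
moves also give the polygon with [4 g + 2] sides.
*)

(** * Continuity *)

(** Three obstacles shape the details. The twist comes with an annulus of its own, unrelated to the
    polygons: they are matched along [C], where the parametrisation given by a polygon is changed
    into that of the core, and then exchanged on one side of [C] at a time, while the profile
    vanishes there and the parametrisation of that side does not matter. Everything is topological,
    so no derivative tells whether a map preserves orientation: this is deduced from connectedness,
    from the fact that squares preserve orientation, and from maps which are the identity on an open
    set. Finally, a gluing is the equivalence relation generated by a pairing of sides; for a word
    [s ++ s] of length [2 m] the rotation by one side respects it because it sends the pair of sides
    [i], [i + m] to [i + 1], [i + 1 + m], modulo [2 m]. As to the Bezout relation, it provides turns
    [k / n1] and [l / n2] whose multiples by the [lcm] are integers differing by 1, which is the
    single full turn made by the twist between the two sides of [C]. *)

Section Continuity.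
Context {R : realType}.

Section RealValued.
Context {T : topologicalType}.
Implicit Types f g : T -> R.

Lemma continuous_addr f g :
  continuous f -> continuous g -> continuous (fun x => f x + g x).
Proof. by move=> cf cg x; exact: (cvgD (cf x) (cg x)). Qed.

Lemma continuous_oppr f : continuous f -> continuous (fun x => - f x).
Proof. by move=> cf x; exact: (cvgN (cf x)). Qed.

Lemma continuous_mulr f g :
  continuous f -> continuous g -> continuous (fun x => f x * g x).
Proof. by move=> cf cg x; exact: (cvgM (cf x) (cg x)). Qed.

Lemma continuous_invr f :
  continuous f -> (forall x, f x != 0) -> continuous (fun x => (f x)^-1).
Proof. by move=> cf f0 x; exact: (cvgV (f0 x) (cf x)). Qed.

Lemma continuous_normr f : continuous f -> continuous (fun x => `|f x|).
Proof. by move=> cf x; exact: (cvg_norm (cf x)). Qed.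

Lemma continuous_maxr f g :
  continuous f -> continuous g -> continuous (fun x => Num.max (f x) (g x)).
Proof. by move=> cf cg x; apply: continuous_max; [exact: cf|exact: cg]. Qed.

Lemma continuous_minr f g :
  continuous f -> continuous g -> continuous (fun x => Num.min (f x) (g x)).
Proof. by move=> cf cg x; apply: continuous_min; [exact: cf|exact: cg]. Qed.

Lemma continuous_if {U : topologicalType} (u : T -> R) (f g : T -> U) :
  continuous u -> continuous f -> continuous g ->
  (forall x, u x = 0 -> f x = g x) ->
  continuous (fun x => if u x <= 0 then f x else g x).
Proof.
move=> cu cf cg fg x B /= nB.
change (nbhs x [set y | B (if u y <= 0 then f y else g y)]).
have [ux|ux|ux] := ltgtP (u x) 0.
- have uN : nbhs x [set y | u y < 0].
    apply: (cu x [set r : R | r < 0]); apply: open_nbhs_nbhs.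
    by split=> //; exact: open_lt.
  rewrite ltW // in nB.
  by apply: filterS (filterI uN (cf x B nB)) => y [/= uy]; rewrite ltW.
- have uP : nbhs x [set y | u y > 0].
    apply: (cu x [set r : R | r > 0]); apply: open_nbhs_nbhs.
    by split=> //; exact: open_gt.
  rewrite leNgt ux /= in nB.
  by apply: filterS (filterI uP (cg x B nB)) => y [/= uy]; rewrite leNgt uy.
- rewrite ux lexx in nB.
  have nB' : nbhs (g x) B by rewrite -fg.
  have fB : nbhs x (f @^-1` B) := cf x B nB.
  have gB : nbhs x (g @^-1` B) := cg x B nB'.
  by apply: filterS (filterI fB gB) => y [/= fy gy]; case: ifP.
Qed.

End RealValued.

Lemma continuous_comp1 {S T U : topologicalType} (g : T -> U) (f : S -> T) :
  continuous f -> continuous g -> continuous (fun x => g (f x)).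
Proof. by move=> cf cg x; exact: continuous_comp (cf x) (cg (f x)). Qed.

Lemma continuous_pair {T U V : topologicalType} (f : T -> U) (g : T -> V) :
  continuous f -> continuous g -> continuous (fun x => (f x, g x)).
Proof. by move=> cf cg x; exact: (cvg_pair (cf x) (cg x)). Qed.

Lemma continuous_fst {T U V : topologicalType} (f : T -> U * V) :
  continuous f -> continuous (fun x => (f x).1).
Proof. by move=> cf x; apply: cvg_comp (cf x) _; exact: cvg_fst. Qed.

Lemma continuous_snd {T U V : topologicalType} (f : T -> U * V) :
  continuous f -> continuous (fun x => (f x).2).
Proof. by move=> cf x; apply: cvg_comp (cf x) _; exact: cvg_snd. Qed.

Lemma continuous_cst {T U : topologicalType} (c : U) :
  continuous (fun _ : T => c).
Proof. by move=> x; exact: cvg_cst. Qed.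

Lemma continuous_idf {T : topologicalType} : continuous (fun x : T => x).
Proof. by move=> x; exact: cvg_id. Qed.

(** A continuous map from a compact set to a Hausdorff space is closed, so [k] is a quotient map
    onto its image and the continuity of [f] can be tested on [K]. *)
Lemma continuous_quotient {X Y Z : topologicalType} (K : set X) (k : X -> Y)
    (g : X -> Z) (f : Y -> Z) :
  hausdorff_space Y -> compact K ->
  {within K, continuous k} -> {within K, continuous g} ->
  (forall x, K x -> f (k x) = g x) -> {within k @` K, continuous f}.
Proof.
move=> hY cK ck cg fk; apply/continuous_closedP => B cB.
apply/closed_subspaceP; exists (k @` (K `&` g @^-1` B)).
  apply: (compact_closed hY); apply: continuous_compact.
    by apply: continuous_subspaceW ck => x [].
  have /continuous_closedP/(_ _ cB)/closed_subspaceP[V cV VE] := cg.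
  by rewrite setIC -VE setIC; exact: compact_closedI.
rewrite eqEsubset; split=> y /= [].
  move=> [x [Kx Bx] <-] _; split; last by exists x.
  by change (B (f (k x))); rewrite fk.
move=> By [x Kx xy]; split; last by exists x.
by exists x => //; split=> //; change (B (g x)); rewrite -fk // xy.
Qed.

Lemma continuous_within_comp {S T U : topologicalType} (A : set T)
    (u : T -> U) (v : S -> T) :
  {within A, continuous u} -> continuous v -> (forall x, A (v x)) ->
  continuous (fun x => u (v x)).
Proof.
move=> /withinP cu cv Av x B nB.
have h : nbhs x [set z | A (v z) ->
  B (u (v z))] := cv x _ (cu (v x) (Av x) B nB).
change (nbhs x [set z | B (u (v z))]).
by apply: filterS h => z /=; apply; exact: Av.
Qed.

End Continuity.

Ltac continuity := repeat first
  [ assumption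
  | lazymatch goal with
    | |- continuous (fun _ => ?c) => exact: continuous_cst
    | |- continuous (fun x => x) => exact: continuous_idf
    | |- continuous -%R => exact: (continuous_oppr continuous_idf)
    | |- continuous (@fst _ _) => exact: (continuous_fst continuous_idf)
    | |- continuous (@snd _ _) => exact: (continuous_snd continuous_idf)
    | |- continuous (fun x => (@?f x, @?g x)) =>
      apply: (continuous_pair (f := f) (g := g))
    | |- continuous (fun x => fst (@?f x)) =>
        apply: (continuous_fst (f := f))
    | |- continuous (fun x => snd (@?f x)) =>
        apply: (continuous_snd (f := f))
    | |- continuous (fun x => @?f x + @?g x) =>
        apply: (continuous_addr (f := f) (g := g))
    | |- continuous (fun x => - @?f x) =>
        apply: (continuous_oppr (f := f))
    | |- continuous (fun x => @?f x * @?g x) =>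
        apply: (continuous_mulr (f := f) (g := g))
    | |- continuous (fun x => `|@?f x|) =>
        apply: (continuous_normr (f := f))
    | |- continuous (fun x => Num.max (@?f x) (@?g x)) =>
        apply: (continuous_maxr (f := f) (g := g))
    | |- continuous (fun x => Num.min (@?f x) (@?g x)) =>
        apply: (continuous_minr (f := f) (g := g))
    | |- continuous (fun x => cos (@?f x)) =>
        apply: (continuous_comp1 (f := f)); [|exact: continuous_cos]
    | |- continuous (fun x => sin (@?f x)) =>
        apply: (continuous_comp1 (f := f)); [|exact: continuous_sin]
    | H : continuous ?h |- continuous (fun x => ?h (@?f x)) =>
        apply: (continuous_comp1 (g := h) (f := f)); [|exact: H]
    end ].

(** * Orientation *)

Section Winding.
Context {R : realType}.

Lemma cos_lt1 (d : R) : d != 0 -> `|d| <= 1 -> cos d < 1.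
Proof.
move=> d0 d1; rewrite -cos_norm -[ltRHS]cos0.
have dpi : `|d| <= pi by rewrite (le_trans d1) // (le_trans _ (pi_ge2 R)) //
  ler1n.
rewrite ltr_cos ?normr_gt0 //.
  by rewrite in_itv /= lexx pi_ge0.
by rewrite in_itv /= normr_ge0.
Qed.

(** A continuous function with values in the multiples of [2 * pi] is constant: otherwise the
    intermediate value theorem yields a value at nonzero distance at most 1 from [u a], where the
    cosine is less than 1. *)
Lemma cos_eq1_const (u : R -> R) :
  continuous u -> (forall s, cos (u s) = 1) -> forall a b, u a = u b.
Proof.
move=> cu u1; suff le a b : a <= b -> u a = u b.
  by move=> a b; have [/le//|/ltW/le] := leP a b.
move=> ab; apply/eqP; apply: contraT => uab.
have [d [d0 d1 dab]] : exists d, [/\ d != 0, `|d| <= 1 &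
    Num.min (u a) (u b) <= u a + d <= Num.max (u a) (u b)].
  case: (ltgtP (u a) (u b)) uab => // lt_u _.
    exists (Num.min 1 (u b - u a)).
    by split; case: (leP 1 (u b - u a)) => h; rewrite ?ler_norml; lra.
  exists (- Num.min 1 (u a - u b)).
  by split; case: (leP 1 (u a - u b)) => h; rewrite ?ler_norml; lra.
have [c _ uc] : exists2 c, c \in `[a, b] & u c = u a + d.
  by apply: IVT => //; exact: continuous_subspaceT.
have := u1 c; rewrite uc cosD u1 cos1sin0 ?u1 ?normr1 // mul0r subr0 mul1r.
by move=> cd; have := cos_lt1 d0 d1; rewrite cd ltxx.
Qed.

(** Equality of angles modulo a full turn is recorded as a cosine equal to 1, the form which
    [cos_eq1_const] takes. *)
Lemma polar_cos (r r' a b : R) : 0 < r -> 0 < r' ->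
  r * cos a = r' * cos b -> r * sin a = r' * sin b -> cos (a - b) = 1.
Proof.
move=> r0 r'0 hc hs.
have rr : r = r'.
  apply/eqP; rewrite -(@eqrXn2 _ 2) ?ltW //; apply/eqP.
  rewrite -[LHS]mulr1 -[RHS]mulr1 -{1}(cos2Dsin2 a) -(cos2Dsin2 b) !mulrDr.
  by rewrite -!exprMn hc hs.
subst r'; rewrite cosB.
have n0 : r != 0 by rewrite gt_eqF.
by rewrite (mulfI n0 hc) (mulfI n0 hs) -!expr2 cos2Dsin2.
Qed.

(** Reflecting the target changes the angle into its opposite: [th + th'] would be constant, while
    it gains [4 * pi] in one turn. *)
Lemma orientation_preserving_reflection_l (j : plane R -> plane R) :
  orientation_preserving j -> ~ orientation_preserving (@reflection R \o j).
Proof.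
move=> [th [cth th2 thE]] [th' [cth' th'2 th'E]].
have E s : cos (th s - (- th' s)) = 1.
  have [r r0 jE] := thE s; have [r' r'0 j'E] := th'E s.
  move: j'E; rewrite /reflection /= jE /= => -[h1 h2].
  by apply: (polar_cos r0 r'0); rewrite ?cosN ?sinN; lra.
have cu : continuous (fun s => th s - (- th' s)) by continuity.
have := cos_eq1_const cu E (2 * pi) 0; have := pi_gt0 R; lra.
Qed.

(** Reflecting the source reverses the direction of travel: [th' s] would be [th (- s)] up to a
    constant, which loses a turn where [th'] gains one. *)
Lemma orientation_preserving_reflection_r (j : plane R -> plane R) :
  orientation_preserving j -> ~ orientation_preserving (j \o @reflection R).
Proof.
move=> [th [cth th2 thE]] [th' [cth' th'2 th'E]].
have E s : cos (th' s - th (- s)) = 1.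
  have [r r0 jE] := thE (- s); have [r' r'0 j'E] := th'E s.
  move: j'E; rewrite /reflection /= oppr0 -sinN -(cosN s) jE => -[h1 h2].
  by apply: (polar_cos r'0 r0); lra.
have cu : continuous (fun s => th' s - th (- s)).
  by continuity.
have h1 := cos_eq1_const cu E (2 * pi) 0; rewrite oppr0 in h1.
(* The gain of [th] is given over [[0, 2 * pi]] but needed over [[- 2 * pi, 0]]: the gain over one
   period is continuous and a multiple of [2 * pi], hence constant. *)
have E2 s : cos (th (s + 2 * pi) - th s) = 1.
  have [r r0 jE] := thE s; have [r' r'0 j'E] := thE (s + 2 * pi).
  have e : 2 * pi = pi *+ 2 :> R by rewrite mulr2n; ring.
  move: j'E; rewrite {1 2}e sinD2pi cosD2pi jE => -[h2 h3].
  by apply: (polar_cos r'0 r0); lra.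
have cv : continuous (fun s => th (s + 2 * pi) - th s).
  by continuity.
have := cos_eq1_const cv E2 (- (2 * pi)) 0.
rewrite addNr add0r; have := pi_gt0 R; lra.
Qed.

End Winding.

Section Orientation.
Context {R : realType} (F : closed_oriented_surface R).
Implicit Types e : plane R -> F.

Lemma reflectionK : involutive (@reflection R).
Proof. by move=> [x y]; rewrite /reflection /= opprK. Qed.

Lemma reflection_continuous : continuous (@reflection R).
Proof. by rewrite /reflection; continuity. Qed.

Lemma reflection_open_embedding : open_embedding (@reflection R).
Proof.
split; [exact: (can_inj reflectionK)|exact: reflection_continuous|].
move=> A oA; have -> : @reflection R @` A = @reflection R @^-1` A.
  rewrite eqEsubset; split=> p /=; first by move=> [q Aq <-];
    rewrite reflectionK.
  by move=> Ap; exists (reflection p) => //; rewrite reflectionK.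
by apply: open_comp => // p _; exact: reflection_continuous.
Qed.

Lemma open_embedding_comp (T U V : topologicalType) (f : U -> V) (g : T -> U) :
  open_embedding f -> open_embedding g -> open_embedding (f \o g).
Proof.
move=> [fi fc fo] [gi gc go]; split.
- exact: inj_comp.
- by move=> x; apply: continuous_comp; [exact: gc|exact: fc].
- by move=> A oA; rewrite -image_comp; apply/fo/go.
Qed.

(* The whole plane is shrunk onto an open square by [u |-> d u / (1 + |u|)] in
   each coordinate. *)
Definition shrink (d : R) (p q : plane R) : plane R :=
  (p.1 + d * (q.1 / (1 + `|q.1|)), p.2 + d * (q.2 / (1 + `|q.2|))).

Definition unshrink (d : R) (p q : plane R) : plane R :=
  ((q.1 - p.1) / (d - `|q.1 - p.1|), (q.2 - p.2) / (d - `|q.2 - p.2|)).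

Lemma shrink1_lt (d u : R) : 0 < d -> `|d * (u / (1 + `|u|))| < d.
Proof.
move=> d0; have u0 : 0 < 1 + `|u| by rewrite ltr_pwDl.
rewrite normrM (gtr0_norm d0) normf_div (gtr0_norm u0) gtr_pMr //.
by rewrite ltr_pdivrMr // mul1r ltrDr.
Qed.

Lemma unshrink1K (d u : R) : 0 < d ->
  (d * (u / (1 + `|u|))) / (d - `|d * (u / (1 + `|u|))|) = u.
Proof.
move=> d0; have u0 : 0 < 1 + `|u| by rewrite ltr_pwDl.
rewrite normrM (gtr0_norm d0) normf_div (gtr0_norm u0).
by field; rewrite mulrDr mulr1 addrK !gt_eqF.
Qed.

Lemma shrink1K (d v : R) : `|v| < d ->
  d * ((v / (d - `|v|)) / (1 + `|v / (d - `|v|)|)) = v.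
Proof.
move=> vd; have dv : 0 < d - `|v| by rewrite subr_gt0.
have d0 : 0 < d by rewrite (le_lt_trans _ vd).
rewrite normf_div (gtr0_norm dv).
by field; rewrite subrK !gt_eqF.
Qed.

Lemma shrink_open_embedding (d : R) (p : plane R) :
  0 < d -> open_embedding (shrink d p).
Proof.
move=> d0.
have addrKC_ (x y : R) : x + y - x = y by ring.
have K q : unshrink d p (shrink d p q) = q.
  case: q => x y; rewrite /unshrink /shrink /= !addrKC_.
  by rewrite !unshrink1K.
have n0 (u : R) : 1 + `|u| != 0 by rewrite gt_eqF // ltr_pwDl.
split; first exact: can_inj K.
  by rewrite /shrink; continuity; apply: continuous_invr; try continuity;
    move=> q; exact: n0.
move=> A oA.
pose Sq : set (plane R) := [set q | `|q.1 - p.1| < d /\ `|q.2 - p.2| < d].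
have oS : open Sq.
  have o1 (u : plane R -> R) : continuous u -> open [set q | u q < d].
    by move=> cu; apply: (@open_comp _ _ u [set r | r < d]) => // q _;
      exact: cu.
  by apply: (@openI _ [set q | `|q.1 - p.1| < d] [set q | `|q.2 - p.2| < d]);
    apply: o1; continuity.
have -> : shrink d p @` A = [set q | Sq q /\ A (unshrink d p q)].
  rewrite eqEsubset; split=> q /=.
    move=> [q' Aq' <-]; rewrite K; split=> //.
    by split; rewrite /= addrKC_ shrink1_lt.
  move=> [[h1 h2] Aq]; exists (unshrink d p q) => //.
  by case: q h1 h2 {Aq} => x y h1 h2;
    rewrite /unshrink /shrink /= !shrink1K // !subrKC.
rewrite openE => q [Sqq Aq].
have cU : {for q, continuous (unshrink d p)}.
  case: Sqq => h1 h2.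
  have c1 : continuous (fun q : plane R => q.1 - p.1) by continuity.
  have c2 : continuous (fun q : plane R => q.2 - p.2) by continuity.
  apply: (@cvg_pair _ _ _ _ (nbhs (unshrink d p q).1) (nbhs (unshrink d p
    q).2)); (apply: cvgM; [exact: c1 || exact: c2|]); apply: cvgV;
    rewrite ?gt_eqF ?subr_gt0 //; (apply: cvgB; first exact: cvg_cst);
    apply: cvg_norm; exact: c1 || exact: c2.
change (nbhs q (Sq `&` (unshrink d p @^-1` A))).
apply: filterI; first exact: open_nbhs_nbhs.
by apply: cU; exact: open_nbhs_nbhs.
Qed.

End Orientation.

(** * Homeomorphisms of a connected surface either keep or reverse the orientation *)

Section OrientationDichotomy.
Context {R : realType} (F : closed_oriented_surface R).
Implicit Types (e : plane R -> F) (g : F -> F).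

Lemma subchart e (U : set F) (x : F) :
  orientation e -> open U -> range e x -> U x ->
  exists j, [/\ open_embedding j, orientation (e \o j), range (e \o j) x
    & range (e \o j) `<=` U].
Proof.
move=> eo oU [p _ <-] Uep; have [ei ec eop] := orientation_sub eo.
have oeU : open (e @^-1` U) by apply: open_comp => // q _; exact: ec.
have /nbhs_ballP[d /= d0 dU] : nbhs p (e @^-1` U) by exact: open_nbhs_nbhs.
pose j0 := shrink d p.
have j0e : open_embedding j0 by exact: shrink_open_embedding.
have j0U q : U (e (j0 q)).
  suff Bq : ball p d (j0 q) by exact: (dU _ Bq).
  have E (a b : R) : `|a - (a + b)| = `|b| by rewrite opprD addNKr normrN.
  by split; rewrite /ball /= /j0 /shrink /= E shrink1_lt.
have j00 : j0 (0, 0) = p.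
  by rewrite /j0 /shrink /= !mul0r !mulr0 !addr0 -surjective_pairing.
have [ej|ej] := orientation_total (open_embedding_comp (orientation_sub eo)
  j0e).
  exists j0; split=> //; last by move=> _ [q _ <-]; exact: j0U.
  by exists (0, 0) => //=; rewrite j00.
exists (j0 \o @reflection R); split=> //.
- by apply: open_embedding_comp => //; exact: reflection_open_embedding.
- by exists (0, 0) => //=; rewrite /reflection /= oppr0 j00.
- by move=> _ [q _ <-]; exact: j0U.
Qed.

(** The map [j'] is the inverse of [e'] composed with [e \o j]; it is continuous because [e'] is
    open. *)
Lemma common_subchart e e' (x : F) :
  orientation e -> orientation e' -> range e x -> range e' x ->
  exists e'' j j', [/\ orientation e'', continuous j, continuous j',
    e'' = e \o j & e'' = e' \o j'].
Proof.
move=> eo eo' ex ex'; have [ei' ec' eop'] := orientation_sub eo'.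
have oe' : open (range e') by apply: eop'; exact: openT.
have [j [je ejo _ jsub]] := subchart eo oe' ex ex'.
have jP q : {q' | e (j q) = e' q'}.
  by apply: cid; have [|q' _ <-] := jsub (e (j q)); [exists q|exists q'].
pose j' q := sval (jP q); have j'E q : e (j q) = e' (j' q)
  by exact: svalP (jP q).
have [_ ejc _] := orientation_sub ejo; have [_ jc _] := je.
exists (e \o j), j, j'; split=> //; last by apply/funext => q; exact: j'E.
apply/continuousP => A oA.
rewrite (_ : j' @^-1` A = (e \o j) @^-1` (e' @` A)).
  by apply: open_comp => [q _|]; [exact: ejc|exact: eop'].
rewrite eqEsubset; split=> q; rewrite /preimage /=.
  by move=> Aq; exists (j' q).
by move=> [a Aa]; rewrite j'E => /ei' <-.
Qed.

Section Homeo.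
Variables (g g' : F -> F).
Hypotheses (gc : continuous g) (g'c : continuous g').
Hypotheses (gK : cancel g g') (g'K : cancel g' g).

Lemma homeo_open_embedding : open_embedding g.
Proof.
split=> //; first exact: can_inj gK.
move=> A oA; have -> : g @` A = g' @^-1` A.
  rewrite eqEsubset; split=> x /=; first by move=> [y Ay <-];
    rewrite /preimage /= gK.
  by move=> Ax; exists (g' x).
by apply: open_comp => // x _; exact: g'c.
Qed.

(** The points around which [g] keeps the orientation of some chart, and those around which it
    reverses it, form two open disjoint sets [P] and [N] covering the surface; by connectedness one
    of them is empty. *)
Lemma homeo_orientation_dichotomy :
  (forall e, orientation e -> orientation (g \o e)) \/
  (forall e, orientation e -> orientation (g \o e \o @reflection R)).
Proof.
pose P := [set x | exists e, [/\ orientation e, range e x & orientation (g \o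
  e)]].
pose N := [set x | exists e, [/\ orientation e, range e x
  & orientation (g \o e \o @reflection R)]].
have tot e : orientation e ->
    orientation (g \o e) \/ orientation (g \o e \o @reflection R).
  move=> /orientation_sub eo; apply: orientation_total.
  by apply: open_embedding_comp => //; exact: homeo_open_embedding.
have orange e : orientation e -> open (range e).
  by move=> /orientation_sub[_ _]; apply; exact: openT.
have oP : open P.
  rewrite openE => x [e [eo ex ge]].
  apply: (@filterS _ (nbhs x) _ (range e)); first by move=> y ey; exists e.
  by apply: open_nbhs_nbhs; split=> //; exact: orange.
have oN : open N.
  rewrite openE => x [e [eo ex ge]].
  apply: (@filterS _ (nbhs x) _ (range e)); first by move=> y ey; exists e.
  by apply: open_nbhs_nbhs; split=> //; exact: orange.
(* Whatever [g] does to the orientation of a chart [e''] contained in both [e] and [e'], it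
   contradicts what it does to one of the two. *)
have PN x : P x -> N x -> False.
  move=> [e [eo ex ge]] [e' [eo' ex' ge']].
  have [e'' [j [j' [eo'' jc jc' eE eE']]]] := common_subchart eo eo' ex ex'.
  have jo := orientation_coherent eo eo'' jc eE.
  have jo' := orientation_coherent eo' eo'' jc' eE'.
  have [ge''|ge''] := tot _ eo''.
    apply: (orientation_preserving_reflection_l jo').
    apply: (orientation_coherent ge' ge'').
      move=> q; apply: continuous_comp; first exact: jc'.
      exact: reflection_continuous.
    by rewrite eE'; apply/funext => q /=; rewrite reflectionK.
  apply: (orientation_preserving_reflection_r jo).
  apply: (orientation_coherent ge ge'').
    move=> q; apply: continuous_comp; [exact: reflection_continuous|exact: jc].
  by rewrite eE; apply/funext.
have PUN x : P x \/ N x.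
  have [e ee ex] := surface_locally_plane x.
  have [e1 e1o e1x] : exists2 e1, orientation e1 & range e1 x.
    have [eo|eo] := orientation_total ee; first by exists e.
    exists (e \o @reflection R) => //; have [q _ <-] := ex.
    by exists (reflection q) => //=; rewrite reflectionK.
  by have [h|h] := tot _ e1o; [left|right]; exists e1.
have [N0|/set0P[x Nx]] := eqVneq N set0.
  left=> e eo; have [//|ge] := tot _ eo.
  suff : N (e (0, 0)) by rewrite N0.
  by exists e; split=> //; exists (0, 0).
right=> e eo; have [ge|//] := tot _ eo.
have NT : N = setT.
  apply: (@surface_connected _ F); first by exists x.
    by exists N => //; rewrite setTI.
  exists (~` P); first exact: open_closedC.
  rewrite setTI eqEsubset; split=> y /=; first by move=> Ny Py; exact: PN Py Ny.
  by have [|//] := PUN y.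
exfalso; apply: (@PN (e (0, 0))); last by rewrite NT.
by exists e; split=> //; exists (0, 0).
Qed.

Lemma homeo_orientation_sqr e : orientation e -> orientation (g \o g \o e).
Proof.
have [gP|gN] := homeo_orientation_dichotomy.
  by move=> eo; apply: (gP (g \o e)); exact: gP.
move=> /gN/gN; congr (orientation _).
by apply/funext => q /=; rewrite reflectionK.
Qed.

(** If [g] reversed orientation, a chart inside [U], which [g] fixes, would be oriented together
    with its reflection. *)
Lemma homeo_orientation_local (U : set F) :
  open U -> U !=set0 -> (forall x, U x -> g x = x) ->
  forall e, orientation e -> orientation (g \o e).
Proof.
move=> oU [x Ux] gU; have [//|gN] := homeo_orientation_dichotomy; exfalso.
have [e0 ee0 e0x] := surface_locally_plane x.
have [e [eo ex]] : exists e, orientation e /\ range e x.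
  have [eo|eo] := orientation_total ee0; first by exists e0.
  exists (e0 \o @reflection R); split=> //; have [q _ <-] := e0x.
  by exists (reflection q) => //=; rewrite reflectionK.
have [j [je ejo _ jU]] := subchart eo oU ex Ux.
have := gN _ ejo.
have -> : g \o (e \o j) = e \o j.
  by apply/funext => q /=; apply/gU/jU; exists q.
move=> ejro; have [_ jc _] := je.
have h1 := orientation_coherent eo ejo jc erefl.
apply: (orientation_preserving_reflection_r h1).
apply: (orientation_coherent eo ejro) => // q.
by apply: continuous_comp; [exact: reflection_continuous|exact: jc].
Qed.

End Homeo.
End OrientationDichotomy.

(** * Turning the circles of an annulus *)

Lemma hausdorff_pair (S T : topologicalType) :
  hausdorff_space S -> hausdorff_space T -> hausdorff_space (S * T)%type.
Proof.
move=> hS hT p q cl; rewrite (surjective_pairing p) (surjective_pairing q).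
have f1 (u : S * T) (A : set S) : nbhs u.1 A -> nbhs u (fst @^-1` A).
  by move=> nA; exact: (continuous_fst (@continuous_idf (S * T)%type) nA).
have f2 (u : S * T) (A : set T) : nbhs u.2 A -> nbhs u (snd @^-1` A).
  by move=> nA; exact: (continuous_snd (@continuous_idf (S * T)%type) nA).
congr pair; [apply: hS|apply: hT] => A B nA nB.
  by have [u [Au Bu]] := cl _ _ (f1 _ _ nA) (f1 _ _ nB); exists u.1.
by have [u [Au Bu]] := cl _ _ (f2 _ _ nA) (f2 _ _ nB); exists u.2.
Qed.

Lemma closed_setX (S T : topologicalType) (A : set S) (B : set T) :
  closed A -> closed B -> closed (A `*` B).
Proof.
move=> cA cB; apply: (@closedI _ (fst @^-1` A) (snd @^-1` B)).
  by apply: closed_comp => // p _; exact: cvg_fst.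
by apply: closed_comp => // p _; exact: cvg_snd.
Qed.

Section Spinning.
Context {R : realType} (F : closed_oriented_surface R).

Definition band : set (plane R) := [set p | 0 <= p.2 <= 1].

(** [Q] parametrises part of [S] by an annulus, with coordinates [s] in [R / Z]
    and [y] in [[0, 1]], the circle [y = 0] being possibly glued to itself in a
    way which is invariant under the rotation of angle [1 / n].  The part of
    [S] which is not covered can only touch [y = 0], at points which that
    rotation fixes. *)
Record spinnable (S : set F) (n : nat) (Q : plane R -> F) : Prop := Spinnable {
  spin_gt0 : (0 < n)%N;
  spin_closed : closed S;
  spin_continuous : continuous Q;
  spin_period : forall s y, Q (s + 1, y) = Q (s, y);
  spin_sub : forall s y, 0 <= y <= 1 -> S (Q (s, y));
  spin_inj : forall s s' y y', 0 <= y <= 1 -> 0 <= y' <= 1 ->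
    Q (s, y) = Q (s', y') -> y = y' /\ (0 < y -> s - s' \is a Num.int);
  spin_rot : forall s s' (k : int), Q (s, 0) = Q (s', 0) ->
    Q (s + k%:~R / n%:R, 0) = Q (s' + k%:~R / n%:R, 0);
  spin_adh : forall s y (k : int), 0 <= y <= 1 ->
    closure (S `\` Q @` band) (Q (s, y)) ->
    y = 0 /\ Q (s + k%:~R / n%:R, 0) = Q (s, 0) }.

(** The preimage [p] of [x] is an arbitrary choice. By [spinE], the result does not depend on it as
    soon as [l 0] is a multiple of [1 / n]: two preimages differ by an integer when [y > 0], and for
    [y = 0] the gluing is invariant under the rotation. *)
Definition spin (Q : plane R -> F) (l : R -> R) (x : F) : F :=
  if pselect (exists p, band p /\ Q p = x) is left h
  then let p := projT1 (cid h) in Q (p.1 + l p.2, p.2) else x.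

Section OnePiece.
Variables (S : set F) (n : nat) (Q : plane R -> F).
Hypothesis SQ : spinnable S n Q.

Lemma spin_period_int (c : int) s y : Q (s + c%:~R, y) = Q (s, y).
Proof.
have P (k : nat) t : Q (t + k%:R, y) = Q (t, y).
  elim: k t => [|k IHk] t; first by rewrite addr0.
  by rewrite -natr1 addrA (spin_period SQ).
case: c => k; first exact: P.
by rewrite NegzE mulrNz -(P k.+1) subrK.
Qed.

Lemma spinE (l : R -> R) (k : int) s y : l 0 = k%:~R / n%:R -> 0 <= y <= 1 ->
  spin Q l (Q (s, y)) = Q (s + l y, y).
Proof.
move=> l0 y01; rewrite /spin; case: pselect => [h|]; last first.
  by case; exists (s, y).
case: cid => -[s' y'] /= [+ E]; rewrite /band /= => y'01.
have [yy ss] := spin_inj SQ y'01 y01 E.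
rewrite yy in E ss *; have [y0|yn0] := eqVneq y 0.
  by rewrite y0 in E *; rewrite l0; exact: (spin_rot SQ).
have /intrP[c cE] : s' - s \is a Num.int.
  by apply: ss; rewrite lt_neqAle eq_sym yn0; case/andP: y01.
have -> : s' + l y = (s + l y) + c%:~R by rewrite -cE; ring.
exact: spin_period_int.
Qed.

Lemma spin_out (l : R -> R) x : ~ (Q @` band) x -> spin Q l x = x.
Proof.
move=> nx; rewrite /spin; case: pselect => // -[p [bp px]].
by case: nx; exists p.
Qed.

Lemma spin_stable (l : R -> R) (k : int) x :
  l 0 = k%:~R / n%:R -> S x -> S (spin Q l x).
Proof.
move=> l0 Sx; have [[[s y] y01 <-]|nx] := pselect ((Q @` band) x).
  by rewrite (spinE _ l0) //; exact: (spin_sub SQ).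
by rewrite spin_out.
Qed.

Lemma spinD (l m : R -> R) (k k' : int) x :
  l 0 = k%:~R / n%:R -> m 0 = k'%:~R / n%:R ->
  spin Q l (spin Q m x) = spin Q (fun y => m y + l y) x.
Proof.
move=> l0 m0; have [[[s y] y01 <-]|nx] := pselect ((Q @` band) x).
  have E : m 0 + l 0 = (k' + k)%:~R / n%:R by rewrite l0 m0 intrD mulrDl.
  by rewrite (spinE _ m0) // (spinE _ l0) // (spinE _ E) // addrA.
by rewrite !spin_out.
Qed.

(** Full turns act trivially on every circle, the innermost included, so that a profile matters only
    up to an integer constant. *)
Lemma spin_shift (l m : R -> R) (k c : int) x : l 0 = k%:~R / n%:R ->
  (forall y, m y = l y + c%:~R) -> spin Q m x = spin Q l x.
Proof.
move=> l0 ml; have [[[s y] y01 <-]|nx] := pselect ((Q @` band) x); last first.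
  by rewrite !spin_out.
have m0 : m 0 = (k + c * n)%:~R / n%:R.
  by rewrite ml l0 intrD intrM mulrDl mulfK // pnatr_eq0 -lt0n (spin_gt0 SQ).
by rewrite (spinE _ l0) // (spinE _ m0) // ml addrA spin_period_int.
Qed.

Lemma spin_cst0 x : spin Q (fun=> 0) x = x.
Proof.
have [[[s y] y01 <-]|nx] := pselect ((Q @` band) x); last by rewrite spin_out.
by rewrite (@spinE _ 0) ?mul0r // addr0.
Qed.

(** Where the part covered by [Q] meets the closure of the rest, the rotation fixes the points;
    hence the map pastes with the identity. *)
Lemma spin_adherent (l : R -> R) (k : int) x : l 0 = k%:~R / n%:R ->
  closure (S `\` Q @` band) x -> spin Q l x = x.
Proof.
move=> l0 clx; have [[[s y] y01 xE]|nx] := pselect ((Q @` band) x).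
  rewrite /band /= in y01; rewrite -xE in clx *;
    have [y0 E] := spin_adh SQ k y01 clx.
  by rewrite y0 (spinE _ l0) ?lexx ?ler01 // l0.
by rewrite spin_out.
Qed.

Definition square : set (plane R) := [set p | 0 <= p.1 <= 1 /\ 0 <= p.2 <= 1].

Lemma band_square : Q @` band = Q @` square.
Proof.
rewrite eqEsubset; split=> _ [[s y] /= y01 <-]; last first.
  by exists (s, y) => //; case: y01.
exists (s - (Num.floor s)%:~R, y).
  have := floor_itv s; rewrite /square /= intrD /= => fs.
  by split=> //; lra.
by rewrite -mulrNz spin_period_int.
Qed.

Lemma compact_square : compact square.
Proof.
rewrite (_ : square = `[0, 1]%classic `*` `[0, 1]%classic).
  by apply: compact_setX; exact: segment_compact.
by rewrite eqEsubset; split=> -[x y]; rewrite /square /= !in_itv /=.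
Qed.

Lemma closed_band_image (b c : R) : closed (Q @` [set p | b <= p.2 <= c]).
Proof.
have -> : Q @` [set p | b <= p.2 <= c] = Q @` (`[0, 1]%classic `*` `[b,
  c]%classic).
  rewrite eqEsubset; split=> _ [[s y] /= h <-]; last first.
    by exists (s, y) => //; case: h => _; rewrite /= in_itv.
  exists (s - (Num.floor s)%:~R, y); last by rewrite -mulrNz spin_period_int.
  have := floor_itv s; rewrite /= !in_itv /= intrD /= => fs.
  by split=> //; lra.
apply: (compact_closed (surface_hausdorff (c:=F))).
apply: continuous_compact;
  first exact/continuous_subspaceT/(spin_continuous SQ).
by apply: compact_setX; exact: segment_compact.
Qed.

(** The set [S] is a union of two closed sets. On the one covered by [Q], continuity descends from a
    compact set of parameters; on the closure of the rest, the map is the identity. The parameter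
    [t] is there for isotopies. *)
Lemma spin_family_continuous (L : R -> R -> R) (k : int) :
  continuous (fun p : R * R => L p.1 p.2) ->
  (forall t, L t 0 = k%:~R / n%:R) ->
  {within [set p : R * F | 0 <= p.1 <= 1 /\ S p.2],
    continuous (fun p : R * F => spin Q (L p.1) p.2)}.
Proof.
move=> cL L0; pose I : set R := `[0, 1]%classic.
have IE t : I t = (0 <= t <= 1) by rewrite /I /= in_itv.
have cI : closed I by exact: interval_closed.
have -> : [set p : R * F | 0 <= p.1 <= 1 /\ S p.2] =
    I `*` (Q @` band) `|` I `*` closure (S `\` Q @` band).
  rewrite eqEsubset; split=> -[t x] /=.
    move=> [t01 Sx]; have [Dx|nDx] := pselect ((Q @` band) x).
      by left; rewrite /setX /= IE.
    by right; split=> /=; [rewrite IE|apply: subset_closure].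
  rewrite !IE => -[[t01 [[s y] y01 <-]]|[t01 clx]]; split=> //.
    exact: (spin_sub SQ).
  apply: (spin_closed SQ); apply: closure_subset clx.
  by move=> z [].
apply: withinU_continuous.
- exact/(closed_setX cI)/closed_band_image.
- by apply: closed_setX => //; exact: closed_closure.
- pose k' (u : R * (R * R)) : R * F := (u.1, Q u.2).
  have kI : k' @` (I `*` square) = I `*` (Q @` band).
    rewrite band_square eqEsubset; split=> -[t x] /=.
      by move=> [[t' p] /= [It' sp] [<- <-]]; split=> //=; exists p.
    by move=> [/= It [p sp <-]]; exists (t, p).
  rewrite -kI; have cQ := spin_continuous SQ.
  apply: (@continuous_quotient _ _ _ _ k'
      (fun u => Q (u.2.1 + L u.1 u.2.2, u.2.2))).
  + apply: hausdorff_pair; last exact: surface_hausdorff.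
    exact: Rhausdorff.
  + by apply: compact_setX; [exact: segment_compact|exact: compact_square].
  + by apply: continuous_subspaceT; rewrite /k'; continuity.
  + apply: continuous_subspaceT; continuity.
    apply: (@continuous_comp1 _ _ _ (fun p : R * R => L p.1 p.2)
      (fun u : R * (R * R) => (u.1, u.2.2))) => //.
    by continuity.
  + move=> [t [s y]] /= [_ [_ y01]]; exact: (spinE _ (L0 t)).
- apply: (@subspace_eq_continuous _ _ _ snd).
    move=> [t x] /set_mem [_ /= clx].
    by apply/esym; exact: (spin_adherent (L0 t) clx).
  by apply: continuous_subspaceT => p; exact: cvg_snd.
Qed.

End OnePiece.
End Spinning.

(** * Two pieces with a common seam, turned together *)

Section DoubleSpin.
Context {R : realType} (F : closed_oriented_surface R).

Record spinnable_pair (SL : set F) (nL : nat) (QL : plane R -> F)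
    (SR : set F) (nR : nat) (QR : plane R -> F) : Prop := SpinnablePair {
  spin_left : spinnable SL nL QL;
  spin_right : spinnable SR nR QR;
  spin_cover : forall x, SL x \/ SR x;
  spin_seam : forall x, SL x -> SR x -> exists s, x = QL (s, 1);
  spin_match : forall s, QL (s, 1) = QR (s, 1) }.

Variables (SL : set F) (nL : nat) (QL : plane R -> F).
Variables (SR : set F) (nR : nat) (QR : plane R -> F).
Hypothesis P : spinnable_pair SL nL QL SR nR QR.

Definition double_spin (l : (R -> R) * (R -> R)) (x : F) : F :=
  if `[< SL x >] then spin QL l.1 x else spin QR l.2 x.

(** The integers [kL] and [kR] count the elementary rotations at the two ends [y = 0]; being
    discrete, they stay fixed along an isotopy. The common value on the seam [y = 1] is free. *)
Definition profile (kL kR : int) (l : (R -> R) * (R -> R)) :=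
  [/\ continuous l.1, continuous l.2, l.1 0 = kL%:~R / nL%:R,
      l.2 0 = kR%:~R / nR%:R & l.1 1 = l.2 1].

Local Notation PL := (spin_left P).
Local Notation PR := (spin_right P).

Let I01 (y : R) : y = 0 \/ y = 1 -> 0 <= y <= 1.
Proof. by case=> ->; rewrite ?lexx ler01. Qed.

Lemma double_spinL l x : SL x -> double_spin l x = spin QL l.1 x.
Proof. by rewrite /double_spin => Sx; case: asboolP. Qed.

Lemma double_spinR kL kR l x :
  profile kL kR l -> SR x -> double_spin l x = spin QR l.2 x.
Proof.
move=> [_ _ lL lR ll] Sx; rewrite /double_spin; case: asboolP => // SLx.
have [s ->] := spin_seam P SLx Sx.
by rewrite (spinE PL _ lL) ?(spin_match P) ?(spinE PR _ lR) ?ll // I01 //;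
  right.
Qed.

Lemma profileD kL kR kL' kR' l m : profile kL kR l -> profile kL' kR' m ->
  profile (kL + kL') (kR + kR')
    (fun y => l.1 y + m.1 y, fun y => l.2 y + m.2 y).
Proof.
move=> [c1 c2 l1 l2 l12] [c1' c2' m1 m2 m12].
by split=> /=; rewrite ?l1 ?l2 ?m1 ?m2 ?l12 ?m12 ?intrD ?mulrDl //; continuity.
Qed.

Lemma profileZ kL kR l (c : int) : profile kL kR l ->
  profile (c * kL) (c * kR) (fun y => c%:~R * l.1 y, fun y => c%:~R * l.2 y).
Proof.
move=> [c1 c2 l1 l2 l12].
by split=> /=; rewrite ?l1 ?l2 ?l12 ?intrM ?mulrA //; continuity.
Qed.

Lemma double_spinD kL kR kL' kR' l m x :
  profile kL kR l -> profile kL' kR' m ->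
  double_spin l (double_spin m x) =
  double_spin (fun y => l.1 y + m.1 y, fun y => l.2 y + m.2 y) x.
Proof.
move=> pl pm; have plm := profileD pl pm.
have [_ _ l1 l2 _] := pl; have [_ _ m1 m2 _] := pm.
have E (n : R -> R) (n' : R -> R) : (fun y => n y + n' y) = (fun y =>
  n' y + n y).
  by apply/funext => y; rewrite addrC.
have [Sx|Sx] := spin_cover P x.
  have S' : SL (spin QL m.1 x) by exact: (spin_stable PL m1).
  by rewrite !double_spinL // (spinD PL x l1 m1) /= E.
have S' : SR (spin QR m.2 x) by exact: (spin_stable PR m2).
by rewrite (double_spinR pm Sx) (double_spinR pl S') (double_spinR plm Sx)
  (spinD PR x l2 m2) /= E.
Qed.

Lemma double_spin_cst0 x : double_spin (fun=> 0, fun=> 0) x = x.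
Proof.
by rewrite /double_spin; case: asboolP => _ /=;
  rewrite ?(spin_cst0 PL) ?(spin_cst0 PR).
Qed.

Lemma double_spin_family_continuous kL kR (L : R -> (R -> R) * (R -> R)) :
  (forall t, profile kL kR (L t)) ->
  continuous (fun p : R * R => (L p.1).1 p.2) ->
  continuous (fun p : R * R => (L p.1).2 p.2) ->
  {within @cylinder R F, continuous (fun p : R * F => double_spin (L p.1) p.2)}.
Proof.
move=> pL c1 c2.
have closedS (S : set F) : closed S ->
    closed [set p : R * F | 0 <= p.1 <= 1 /\ S p.2].
  move=> cS; rewrite (_ : [set p | _] = `[0, 1]%classic `*` S).
    by apply: closed_setX => //; exact: interval_closed.
  by rewrite eqEsubset; split=> -[t x]; rewrite /setX /= in_itv /=.
have -> : @cylinder R F = [set p | 0 <= p.1 <= 1 /\ SL p.2] `|`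
                          [set p | 0 <= p.1 <= 1 /\ SR p.2].
  rewrite eqEsubset; split=> -[t x]; rewrite /cylinder /=; last by case=> -[].
  by move=> t01; have [Sx|Sx] := spin_cover P x; [left|right].
apply: withinU_continuous.
- exact/closedS/(spin_closed PL).
- exact/closedS/(spin_closed PR).
- apply: (@subspace_eq_continuous _ _ _ (fun p : R * F =>
  spin QL (L p.1).1 p.2)).
    by move=> [t x] /set_mem [_ Sx]; apply/esym; exact: double_spinL.
  apply: (@spin_family_continuous _ _ _ _ _ PL (fun t => (L t).1) kL) => // t.
  by have [] := pL t.
- apply: (@subspace_eq_continuous _ _ _ (fun p : R * F =>
  spin QR (L p.1).2 p.2)).
    by move=> [t x] /set_mem [_ Sx]; apply/esym; exact: (double_spinR (pL t)).
  apply: (@spin_family_continuous _ _ _ _ _ PR (fun t => (L t).2) kR) => // t.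
  by have [] := pL t.
Qed.

Lemma double_spin_continuous kL kR l :
  profile kL kR l -> continuous (double_spin l).
Proof.
move=> pl; have [c1 c2 _ _ _] := pl.
apply: (@continuous_within_comp _ _ _ (@cylinder R F)
  (fun p : R * F => double_spin l p.2) (fun x => (0, x))).
- by apply: (@double_spin_family_continuous kL kR (fun=> l)) => //; continuity.
- by continuity.
- by move=> x; rewrite /cylinder /= lexx ler01.
Qed.

Lemma double_spinK kL kR l : profile kL kR l ->
  cancel (double_spin (fun y => -1%:~R * l.1 y, fun y => -1%:~R * l.2 y))
    (double_spin l).
Proof.
move=> pl x; have pl' := profileZ (-1) pl.
rewrite (double_spinD x pl pl') -[RHS]double_spin_cst0; congr double_spin.
by congr pair; apply/funext => y /=; rewrite mulN1r subrr.
Qed.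

Lemma double_spinNK kL kR l : profile kL kR l ->
  cancel (double_spin l)
    (double_spin (fun y => -1%:~R * l.1 y, fun y => -1%:~R * l.2 y)).
Proof.
move=> pl x; have pl' := profileZ (-1) pl.
rewrite (double_spinD x pl' pl) -[RHS]double_spin_cst0; congr double_spin.
by congr pair; apply/funext => y /=; rewrite mulN1r addNr.
Qed.

(* Up to a profile which vanishes near the seam, for which the homeomorphism is
   the identity on an open set, the profile can be halved, so that the
   homeomorphism is a square. *)
Lemma double_spin_orientation kL kR l (e : plane R -> F) :
  profile kL kR l -> orientation e -> orientation (double_spin l \o e).
Proof.
move=> pl eo; have [c1 c2 l1 l2 l12] := pl.
pose b (y : R) := Num.max 0 (1 - 2 * y).
have cb : continuous b by rewrite /b; continuity.
have b0 : b 0 = 1 by rewrite /b mulr0 subr0 max_r // ler01.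
have b1 y : 1 / 2 <= y -> b y = 0.
  by rewrite /b => y2; case: (leP 0 (1 - 2 * y)) => //; lra.
pose m : (R -> R) * (R -> R) := (fun y => l.1 0 * b y, fun y => l.2 0 * b y).
(* The profile [l] itself cannot be halved, since half of [kL] need not be an integer. The profile
   [m] has the same values as [l] at both ends [y = 0], so the difference vanishes there and its
   half is a profile. *)
pose h : (R -> R) * (R -> R) :=
  (fun y => (l.1 y - m.1 y) / 2, fun y => (l.2 y - m.2 y) / 2).
have pm : profile kL kR m.
  by split=> /=; rewrite ?b0 ?mulr1 ?(b1 1) ?mulr0 //; [continuity..|lra].
have ph : profile 0 0 h.
  split=> /=; rewrite ?mul0r ?b0 ?mulr1 ?subrr ?mul0r //; try by continuity.
  by rewrite (b1 1) ?mulr0 ?l12 //; lra.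
have -> : double_spin l \o e = double_spin m \o (double_spin h \o double_spin
  h \o e).
  apply/funext => q /=; rewrite (double_spinD _ ph ph).
  rewrite (double_spinD _ pm (profileD ph ph)) /=.
  congr double_spin; rewrite {1}(surjective_pairing l).
  by congr pair; apply/funext => y; rewrite /h /m /=; field.
have c l' kL' kR' (pl' : profile kL' kR' l') := double_spin_continuous pl'.
have {}eo : orientation (double_spin h \o double_spin h \o e).
  exact: (homeo_orientation_sqr (c _ _ _ ph) (c _ _ _ (profileZ (-1) ph))
    (double_spinNK ph) (double_spinK ph) eo).
(* The set [U] lies in the union of the circles [1 / 2 < y < 1] of the left piece, on which [m] is
   zero; the point [QL (0, 3 / 4)] shows that it is not empty. *)
pose U : set F := ~` (SR `|` closure (SL `\` QL @` band) `|`
  QL @` [set p | 0 <= p.2 <= 1 / 2]).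
apply: (homeo_orientation_local (c _ _ _ pm) (c _ _ _ (profileZ (-1) pm))
  (double_spinNK pm) (double_spinK pm) (U := U)) eo.
- apply: closed_openC; apply: closedU; last exact: (closed_band_image PL).
  by apply: closedU; [exact: (spin_closed PR)|exact: closed_closure].
- have y01 : 0 <= (3 / 4 : R) <= 1 by apply/andP; split; lra.
  have n0 : (3 / 4 : R) <> 0 by lra.
  have n1 : (3 / 4 : R) <> 1 by lra.
  have n2 (y : R) : 0 <= y <= 1 / 2 -> 0 <= y <= 1 /\ y <> 3 / 4.
    by move=> ?; split; lra.
  exists (QL (0, 3 / 4)) => -[[Sx|clx]|[[s y] /= /n2[y1 yn]]].
  + have [s E] := spin_seam P (spin_sub PL 0 y01) Sx.
    by have [/n1] := spin_inj PL y01 (I01 (or_intror erefl)) E.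
  + by have [/n0] := spin_adh PL 0 y01 clx.
  + by move=> E; have [/yn] := spin_inj PL y1 y01 E.
- move=> x Ux; have Sx : SL x.
    by have [//|Sx] := spin_cover P x; case: Ux; left; left.
  rewrite double_spinL //.
  have [[[s y] /= y01 xE]|nD] := pselect ((QL @` band) x); last first.
    by case: Ux; left; right; apply: subset_closure.
  rewrite -xE (spinE PL _ (_ : m.1 0 = kL%:~R / nL%:R)) //; last by case: pm.
  have [y2|y2] := leP y (1 / 2).
    by case: Ux; right; exists (s, y) => //=; rewrite y2 andbT; case/andP: y01.
  by rewrite /= b1 ?ltW // mulr0 addr0.
Qed.

Lemma double_spin_orientationE kL kR l (e : plane R -> F) :
  profile kL kR l -> orientation (double_spin l \o e) <-> orientation e.
Proof.
move=> pl; split; last exact: double_spin_orientation pl.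
move=> /(double_spin_orientation (profileZ (-1) pl)); congr orientation.
by apply/funext => q /=; rewrite (double_spinNK pl).
Qed.

Definition spin_homeo kL kR l (pl : profile kL kR l) : homeo F :=
  Homeo (double_spin_continuous pl) (double_spin_continuous (profileZ (-1) pl))
    (double_spinNK pl) (double_spinK pl)
    (fun e => double_spin_orientationE e pl).

Lemma spin_homeo_expg kL kR l (pl : profile kL kR l) (n : nat) x :
  ((spin_homeo pl) ^+ n)%g x =
  double_spin (fun y => n%:R * l.1 y, fun y => n%:R * l.2 y) x.
Proof.
elim: n => [|n IHn].
  rewrite expg0 -[LHS]double_spin_cst0; congr double_spin.
  by congr pair; apply/funext => y; rewrite mul0r.
rewrite expgS (_ : (spin_homeo pl * _)%g x =
  double_spin l ((spin_homeo pl ^+ n)%g x)) //.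
rewrite IHn (double_spinD _ pl (profileZ n pl)).
by congr double_spin; congr pair; apply/funext => y /=; rewrite -natr1; ring.
Qed.

(** Linear interpolation stays among the profiles with ends [kL], [kR]: the values at [y = 0] do not
    move, and the values on the seam move together on both sides. *)
Lemma spin_homeo_isotopic kL kR l m
    (pl : profile kL kR l) (pm : profile kL kR m) :
  isotopic (spin_homeo pl) (spin_homeo pm).
Proof.
pose L (t : R) : (R -> R) * (R -> R) :=
  (fun y => l.1 y + t * (m.1 y - l.1 y), fun y => l.2 y + t * (m.2 y - l.2 y)).
have [c1 c2 l1 l2 l12] := pl; have [c1' c2' m1 m2 m12] := pm.
have pL t : profile kL kR (L t).
  split=> /=; rewrite ?l1 ?l2 ?m1 ?m2 ?l12 ?m12 ?subrr ?mulr0 ?addr0 //;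
    continuity.
exists (fun t => spin_homeo (pL t)); split.
- by apply: (double_spin_family_continuous pL); rewrite /L /=; continuity.
- apply/homeo_ext/funext => x /=; congr double_spin.
  rewrite [RHS]surjective_pairing.
  by congr pair; apply/funext => y /=; ring.
- apply/homeo_ext/funext => x /=; congr double_spin.
  rewrite [RHS]surjective_pairing.
  by congr pair; apply/funext => y /=; ring.
Qed.

Lemma spin_homeo_shift kL kR kL' kR' l m (c : int)
    (pl : profile kL kR l) (pm : profile kL' kR' m) :
  (forall y, m.1 y = l.1 y + c%:~R) -> (forall y, m.2 y = l.2 y + c%:~R) ->
  spin_homeo pm = spin_homeo pl.
Proof.
move=> E1 E2; have [_ _ l1 l2 _] := pl.
apply/homeo_ext/funext => x /=; rewrite /double_spin; case: asboolP => Sx.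
  exact: (spin_shift PL x l1 E1).
exact: (spin_shift PR x l2 E2).
Qed.

End DoubleSpin.

(** * Parametrisations of a circle *)

Section Circle.
Context {R : realType}.

(** The retraction of the line onto [[0, 1]], by which maps given on a segment or a strip are
    extended continuously to the line or the plane. *)
Definition clamp (s : R) : R := Num.max 0 (Num.min 1 s).

Lemma clamp_continuous : continuous clamp.
Proof. by rewrite /clamp; continuity. Qed.

Lemma clamp_ge0 s : 0 <= clamp s.
Proof. by rewrite /clamp le_max lexx. Qed.

Lemma clamp_le1 s : clamp s <= 1.
Proof. by rewrite /clamp ge_max ler01 ge_min lexx. Qed.

Lemma clamp_id s : 0 <= s <= 1 -> clamp s = s.
Proof. by move=> /andP[s0 s1]; rewrite /clamp min_r // max_r. Qed.

Definition frac (s : R) : R := s - (Num.floor s)%:~R.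

Lemma frac_ge0 s : 0 <= frac s.
Proof. by have /andP[h _] := floor_itv s; rewrite subr_ge0. Qed.

Lemma frac_lt1 s : frac s < 1.
Proof. by have /andP[_ h] := floor_itv s; rewrite ltrBlDl -intrD1. Qed.

Lemma frac_in01 s : frac s <> 0 -> 0 < frac s < 1.
Proof.
by move=> /eqP s0; rewrite frac_lt1 andbT lt_neqAle eq_sym s0 frac_ge0.
Qed.

Lemma frac_unique s t (m : int) : 0 <= t < 1 -> s = t + m%:~R -> frac s = t.
Proof.
move=> t01 ->; rewrite /frac (@floor_def _ _ m) ?addrK // intrD.
by rewrite lerDr addrC ltrD2l.
Qed.

Lemma fracDz s (m : int) : frac (s + m%:~R) = frac s.
Proof.
apply: (@frac_unique _ _ (Num.floor s + m)).
  by rewrite frac_ge0 frac_lt1.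
by rewrite intrD addrA subrK.
Qed.

Lemma frac_id s : 0 <= s < 1 -> frac s = s.
Proof.
by move=> s01; apply: (@frac_unique _ _ 0); rewrite ?addr0.
Qed.

(** Let [m] be the integer nearest to [s0]. At distance less than 1 from [m], the function is [g]
    translated by [m - 1] on the left of [m] and by [m] on the right, and the hypothesis makes these
    agree at [m]. *)
Lemma periodic_continuous (U : topologicalType) (g : R * R -> U) :
  continuous g -> (forall y, g (0, y) = g (1, y)) ->
  continuous (fun p : R * R => g (frac p.1, p.2)).
Proof.
move=> cg g01 [s0 y0] B nB; pose m := Num.floor (s0 + 1 / 2).
have /andP[m1 m2] := floor_itv (s0 + 1 / 2); rewrite -/m intrD in m1 m2.
pose w (p : R * R) := if p.1 - m%:~R <= 0 then g (p.1 - m%:~R + 1, p.2)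
  else g (p.1 - m%:~R, p.2).
have cw : continuous w.
  by apply: continuous_if; [continuity..|move=> p ->; rewrite add0r].
have gw (p : R * R) : -1 < p.1 - m%:~R < 1 -> g (frac p.1, p.2) = w p.
  case: p => s y /= /andP[h1 h2]; rewrite /w /=; case: leP => h.
    have -> : frac s = frac (s - m%:~R) by rewrite -mulrNz fracDz.
    have [->|hn] := eqVneq (s - m%:~R) 0.
      by rewrite frac_id ?lexx ?ltr01 // g01 add0r.
    have lt0 : s - m%:~R < 0 by rewrite lt_neqAle hn.
    by rewrite -(fracDz _ 1) frac_id //; lra.
  by rewrite -(frac_id (s := s - m%:~R)) -?mulrNz ?fracDz // ?mulrNz; lra.
have near_m : nbhs (s0, y0) [set p : R * R | -1 < p.1 - m%:~R < 1].
  have ca : continuous (fun p : R * R => `|p.1 - m%:~R|) by continuity.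
  have -> : [set p : R * R | -1 < p.1 - m%:~R < 1] =
      (fun p : R * R => `|p.1 - m%:~R|) @^-1` [set r | r < 1].
    by rewrite eqEsubset; split=> p; rewrite /preimage /= ltr_norml.
  apply: ca; apply: open_nbhs_nbhs; split; first exact: open_lt.
  by rewrite /= ltr_norml; lra.
rewrite gw in nB; last exact: nbhs_singleton near_m.
have cB : nbhs (s0, y0) (w @^-1` B) := cw (s0, y0) B nB.
change (nbhs (s0, y0) [set p : R * R | B (g (frac p.1, p.2))]).
by apply: filterS (filterI near_m cB) => p [/= /gw ->].
Qed.

Lemma periodic_continuous1 (U : topologicalType) (g : R -> U) :
  continuous g -> g 0 = g 1 -> continuous (fun s => g (frac s)).
Proof.
move=> cg g01.
have cp := @periodic_continuous _ (fun p : R * R => g p.1) _ (fun=> g01).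
apply: (@continuous_comp1 _ _ _ (fun p : R * R => g (frac p.1)) (fun s =>
  (s, 0))).
  by continuity.
by apply: cp; continuity.
Qed.

Definition circle_path (T : topologicalType) (c : R -> T) : Prop :=
  continuous c /\ forall s s', c s = c s' <-> s - s' \is a Num.int.

Lemma circle_path_frac (T : topologicalType) (c : R -> T) s :
  circle_path c -> c (frac s) = c s.
Proof. by move=> [_ ci]; apply/ci;
  rewrite /frac addrAC subrr add0r rpredN intr_int. Qed.

Lemma int_lt1 (r : R) : r \is a Num.int -> -1 < r < 1 -> r = 0.
Proof.
move=> /intrP[m ->] m1; have : -1 < m < 1 by rewrite -!(ltr_int R) mulrN1z.
by case: m m1 => [[]|[]] // n _ /andP[]; lia.
Qed.

Lemma circle_path_affine (T : topologicalType) (c : R ->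
  T) (s0 : R) (eps : bool) :
  circle_path c -> circle_path (fun t => c (s0 + (-1) ^+ eps * t)).
Proof.
move=> [cc ci]; split; first by continuity.
move=> s s'; rewrite ci opprD addrACA subrr add0r -mulrBr.
by rewrite rpredMsign.
Qed.

Section Lift.
Variables (T : topologicalType) (c d : R -> T).
Hypotheses (hT : hausdorff_space T) (cP : circle_path c) (dP : circle_path d).
Hypotheses (cd0 : c 0 = d 0) (dc : forall s, exists t, d t = c s)
  (cd : forall t, exists s, c s = d t).

Let lift01 (s : R) : 0 < s < 1 -> exists t, 0 < t < 1 /\ d t = c s.
Proof.
move=> s01; have [t dt] := dc s; exists (frac t).
rewrite (circle_path_frac _ dP); split=> //; apply: frac_in01 => t0.
have : c s = c 0 by rewrite cd0 -t0 (circle_path_frac _ dP).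
by move=> /cP.2/int_lt1; lra.
Qed.

(** The change of parameter from [c] to [d] on []0, 1[]; elsewhere the default value [clamp s] gives
    0 and 1 at the ends. *)
Let p (s : R) : R :=
  if pselect (0 < s < 1) is left h then projT1 (cid (lift01 h)) else clamp s.

Let p_in s : 0 < s < 1 -> 0 < p s < 1 /\ d (p s) = c s.
Proof. by move=> s01; rewrite /p; case: pselect => // h; case: cid. Qed.

Let p_out s : ~ (0 < s < 1) -> p s = clamp s.
Proof. by rewrite /p; case: pselect. Qed.

Let p0 : p 0 = 0.
Proof. by rewrite p_out ?clamp_id ?ltxx // lexx ler01. Qed.

Let p1 : p 1 = 1.
Proof. by rewrite p_out ?clamp_id ?ltxx ?andbF // lexx ler01. Qed.

Let p_inj : {in `]0, 1[ &, injective p}.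
Proof.
move=> s s'; rewrite !in_itv /= => s01 s'01 pp.
have [_ E] := p_in s01; have [_ E'] := p_in s'01.
have /cP.2/int_lt1 H : c s = c s' by rewrite -E -E' pp.
by apply/eqP; rewrite -subr_eq0; apply/eqP/H; lra.
Qed.

Let p_surj t : 0 < t < 1 -> exists2 s, 0 < s < 1 & p s = t.
Proof.
move=> t01; have [s cs] := cd t.
have s01 : 0 < frac s < 1.
  apply: frac_in01 => s0.
  have : d t = d 0 by rewrite -cs -cd0 -s0 (circle_path_frac _ cP).
  by move=> /dP.2/int_lt1; lra.
exists (frac s) => //; have [ps01 E] := p_in s01.
have /dP.2/int_lt1 H : d (p (frac s)) = d t
  by rewrite E (circle_path_frac _ cP).
by apply/eqP; rewrite -subr_eq0; apply/eqP/H; lra.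
Qed.

(** The parameters at distance at least [e] from [p s] form a compact set [K], whose image under [d]
    is closed and misses [c s]. For [t] close to [s], the point [c t] avoids that image, so [p t] is
    not in [K]. *)
Let p_continuous : {within `]0, 1[%classic, continuous p}.
Proof.
apply: continuous_in_subspaceT => s /set_mem /=; rewrite in_itv /= => s01.
have [ps01 E] := p_in s01.
apply/cvgrPdist_lt => /= eps eps0.
pose e := Num.min eps (Num.min (p s) (1 - p s)).
have [e0 ee] : 0 < e /\ e <= eps.
  by rewrite /e !lt_min ge_min lexx eps0 /=; split=> //; lra.
pose K : set R := `[0, 1]%classic `&` [set t | e <= `|p s - t|].
have cK : compact K.
  apply: compact_closedI; first exact: segment_compact.
  apply: (@closed_comp _ _ (fun t => `|p s - t|) [set r | e <= r]).
    by move=> t _; move: t; continuity.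
  exact: closed_ge.
have cdK : closed (d @` K).
  apply: (compact_closed hT); apply: continuous_compact => //.
  exact/continuous_subspaceT/(dP.1).
have near1 : nbhs s (c @^-1` (~` (d @` K))).
  apply: cP.1; apply: open_nbhs_nbhs; split; first exact: closed_openC.
  move=> [t [t01 te] dt]; rewrite /= in_itv /= in t01.
  have /dP.2/int_lt1 H : d t = d (p s) by rewrite dt E.
  have tE : t = p s by apply/eqP; rewrite -subr_eq0; apply/eqP/H; lra.
  by move: te; rewrite tE /= subrr normr0 leNgt e0.
have near2 : nbhs s [set t | 0 < t < 1].
  by apply: open_nbhs_nbhs; split=> //; rewrite -set_itvoo;
    exact: interval_open.
apply: filterS (filterI near1 near2) => t [/= h t01].
have [pt01 Et] := p_in t01; rewrite (lt_le_trans _ ee) // ltNge;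
  apply/negP => h'.
by apply: h; exists (p t) => //; split=> //=; rewrite in_itv /=; lra.
Qed.

(** When [p] decreases, [q] is its increasing mirror image. Extended to [r] by the values 0 and 1 at
    the ends, it is an increasing surjection of [[0, 1]], hence continuous up to the ends; [psi]
    repeats it over each unit interval. *)
Let p_mono_lift (eps : bool) (q := fun s => if eps then 1 - p s else p s) :
  {in `]0, 1[ &, {homo q : s t / s < t}} ->
  exists psi : R -> R, [/\ continuous psi, {mono psi : s t / s < t},
    forall s, psi (s + 1) = psi s + 1 & forall s, d ((-1) ^+ eps * psi s) = c
      s].
Proof.
move=> qlt; pose r s := if pselect (0 < s < 1) is left _ then q s else clamp s.
have r_in s : 0 < s < 1 -> 0 < r s < 1.
  move=> s01; rewrite /r; case: pselect => // h.
  have [p01 _] := p_in h; rewrite /q; case: (eps) => //.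
  by apply/andP; split; lra.
have r_out s : ~ (0 < s < 1) -> r s = clamp s by rewrite /r; case: pselect.
have r0 : r 0 = 0 by rewrite r_out ?clamp_id ?ltxx // lexx ler01.
have r1 : r 1 = 1 by rewrite r_out ?clamp_id ?ltxx ?andbF // lexx ler01.
have rlt : {in `[0, 1] &, {homo r : s t / s < t}}.
  move=> s t; rewrite !in_itv /= => s01 t01 st.
  have [s0|s0] := eqVneq s 0.
    rewrite s0 r0; have [->|t1] := eqVneq t 1; first by rewrite r1 ltr01.
    by have /andP[] : 0 < r t < 1 by apply: r_in; rewrite !lt_neqAle t1 -s0;
      lra.
  have s01' : 0 < s < 1 by rewrite [0 < s]lt_neqAle eq_sym s0 /=; lra.
  have [->|t1] := eqVneq t 1; first by rewrite r1; case/andP: (r_in s s01').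
  have t01' : 0 < t < 1 by rewrite [t < 1]lt_neqAle t1 /=; lra.
  by rewrite /r; do 2!case: pselect => // ?; apply: qlt; rewrite ?in_itv.
have rle : {in `[0, 1] &, {mono r : s t / s <= t}} by exact: le_mono_in.
have rsurj : set_surj `[0, 1] `[r 0, r 1] r.
  move=> t; rewrite r0 r1 /= in_itv /= => t01.
  have [->|t0] := eqVneq t 0; first by exists 0;
    rewrite //= in_itv /= lexx ler01.
  have [->|t1] := eqVneq t 1; first by exists 1;
    rewrite //= in_itv /= lexx ler01.
  have t01' : 0 < t < 1 by rewrite !lt_neqAle t1 eq_sym t0 /=; lra.
  pose t' := if eps then 1 - t else t.
  have [|s s01 st] := @p_surj t'; first by rewrite /t'; case: (eps) => //; lra.
  exists s; first by rewrite /= in_itv /=; lra.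
  rewrite /r; case: pselect => // h; rewrite /q /t' in st *.
  by case: (eps) st => // ->; ring.
have rc := segment_inc_surj_continuous rle rsurj.
(* The difference [psi s - s] is periodic, equal to [g (frac s)], so [g 0 = g 1] gives the
   continuity of [psi]. *)
pose g s := r (clamp s) - s.
have cg : continuous g.
  apply: continuous_addr; last by continuity.
  apply: (continuous_within_comp rc clamp_continuous) => s.
  by rewrite /= in_itv /= clamp_ge0 clamp_le1.
have g01 : g 0 = g 1.
  by rewrite /g !clamp_id ?lexx ?ler01 // r0 r1 !subrr.
have frac01 s : 0 <= frac s <= 1 by rewrite frac_ge0 ltW ?frac_lt1.
pose psi s := r (frac s) + (Num.floor s)%:~R.
have psiE s : psi s = g (frac s) + s.
  by rewrite /g clamp_id // /psi {3}/frac; ring.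
have frac_in s : frac s \in `[0, 1] by rewrite in_itv /= frac01.
have in0 : 0 \in `[0, 1 : R] by rewrite in_itv /= lexx ler01.
have in1 : 1 \in `[0, 1 : R] by rewrite in_itv /= lexx ler01.
have rlt1 s : r (frac s) < 1 by rewrite -[ltRHS]r1; exact/rlt/frac_lt1.
have rge0 s : 0 <= r (frac s) by rewrite -[leLHS]r0 rle // frac_ge0.
have psilt : {homo psi : s t / s < t}.
  move=> s t st; have [ft|ft|ft] := ltgtP (Num.floor s) (Num.floor t).
  - have : (Num.floor s)%:~R + 1 <= (Num.floor t)%:~R :> R.
      by rewrite -intrD1 ler_int lezD1.
    by rewrite /psi; have := rlt1 s; have := rge0 t; lra.
  - by have := le_floor (ltW st); rewrite leNgt ft.
  - by rewrite /psi ft ltrD2r; apply: rlt => //; rewrite /frac ft ltrD2r.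
exists psi; split.
- have -> : psi = (fun s => g (frac s) + s) by apply/funext => s; exact: psiE.
  by apply: continuous_addr; [exact: periodic_continuous1|continuity].
- exact/leW_mono/le_mono.
- by move=> s; rewrite !psiE (fracDz s 1); ring.
- move=> s; rewrite -(circle_path_frac s cP) /psi.
  have E : d ((-1) ^+ eps * (r (frac s) + (Num.floor s)%:~R)) =
           d ((-1) ^+ eps * r (frac s)).
    apply/dP.2; rewrite -mulrBr rpredMsign addrAC subrr add0r.
    exact: intr_int.
  rewrite E; have [->|/eqP/frac_in01 s01] := eqVneq (frac s) 0.
    by rewrite r0 mulr0 cd0.
  rewrite /r; case: pselect => // h; have [_ <-] := p_in h.
  rewrite /q; case: (eps); rewrite ?mul1r // expr1 mulN1r opprB.
  by apply/dP.2; rewrite addrAC subrr add0r rpredN; exact: (intr_int _ 1).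
Qed.

(** A continuous injection of an interval is monotone, so two parametrisations of a circle with the
    same origin differ by an increasing lift, up to the sign [eps]. *)
Lemma circle_path_lift : exists (eps : bool) (psi : R -> R),
  [/\ continuous psi, {mono psi : s t / s < t},
    forall s, psi (s + 1) = psi s + 1 & forall s, d ((-1) ^+ eps * psi s) = c
      s].
Proof.
have [pinc|pdec] := itv_continuous_inj_mono p_continuous p_inj.
  by exists false; exact: (@p_mono_lift false).
exists true; apply: (@p_mono_lift true) => s t s01 t01 st.
by rewrite ltrD2l ltrN2; exact: pdec.
Qed.

End Lift.
End Circle.

Section Reparametrisation.
Context {R : realType} (F : closed_oriented_surface R).
Variables (S : set F) (n : nat) (Q : plane R -> F).
Hypothesis SQ : spinnable S n Q.

Lemma spin_circle_path (y : R) :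
  0 < y <= 1 -> circle_path (fun s => Q (s, y)).
Proof.
move=> /andP[y0 y1]; have y01 : 0 <= y <= 1 by rewrite ltW.
split=> [|s s'].
  by apply: continuous_comp1 (spin_continuous SQ); continuity.
split; first by move=> /(spin_inj SQ y01 y01)[_]; apply.
by move=> /intrP[m sm]; rewrite -(subrK s' s) sm addrC (spin_period_int SQ).
Qed.

(** The circle [y] is reparametrised by [chi y], which goes from the identity at [y = 0] to the lift
    [psi] at [y = 1]. At [y = 0] only a translation and possibly a reflection remain, so the
    invariance under rotation survives, while [y = 1] follows [c]. *)
Lemma spinnable_reparam (c : R -> F) : circle_path c ->
  (forall s, exists t, Q (t, 1) = c s) ->
    (forall t, exists s, c s = Q (t, 1)) ->
  exists2 Q', spinnable S n Q' & forall s, Q' (s, 1) = c s.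
Proof.
move=> cP Qc cQ; have [t0 t0E] := Qc 0.
have Q1 : circle_path (fun s => Q (s, 1)) by apply: spin_circle_path;
  rewrite ltr01 lexx.
have dP := circle_path_affine t0 false Q1; rewrite /= expr0 in dP.
have [|s|t|eps [psi [cpsi psim psi1 psiE]]] :=
  @circle_path_lift _ _ c _ (surface_hausdorff (c := F)) cP dP.
- by rewrite mulr0 addr0.
- by have [t tE] := Qc s; exists (t - t0); rewrite mul1r subrKC.
- exact: cQ.
pose sg : R := (-1) ^+ eps; pose chi (y s : R) := (1 - y) * s + y * psi s.
have psiz s (m : int) : psi (s + m%:~R) = psi s + m%:~R.
  have N (k : nat) t : psi (t + k%:R) = psi t + k%:R.
    by elim: k t => [|k IHk] t; rewrite ?addr0 // -natr1 !addrA psi1 IHk.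
  case: m => k; first exact: N.
  by rewrite NegzE mulrNz; apply/eqP; rewrite -subr_eq opprK -N subrK.
have chiz y s (m : int) : chi y (s + m%:~R) = chi y s + m%:~R.
  by rewrite /chi psiz; ring.
have chim y s t : 0 <= y <= 1 -> s < t -> chi y s < chi y t.
  move=> /andP[y0 y1] st; rewrite /chi.
  have pst : psi s < psi t by rewrite psim.
  have [->|yn0] := eqVneq y 0; first by lra.
  apply: ler_ltD; first by rewrite ler_wpM2l ?subr_ge0 // ltW.
  by rewrite ltr_pM2l // lt_neqAle eq_sym yn0.
have chii y s t : 0 <= y <= 1 -> chi y s = chi y t -> s = t.
  by move=> y01 E; have [/(chim y)|/(chim y)|//] := ltgtP s t;
    rewrite E ltxx => /(_ y01).
have chi0 s : chi 0 s = s by rewrite /chi subr0 mul1r mul0r addr0.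
have chi1 s : chi 1 s = psi s by rewrite /chi subrr mul1r mul0r add0r.
have sgz (m : int) : sg * m%:~R = ((-1) ^+ eps * m)%:~R.
  by rewrite intrM rmorphXn /= mulrN1z.
pose Q' (p : plane R) := Q (t0 + sg * chi p.2 p.1, p.2).
(* If the direction is reversed, so is the rotation: [k] becomes [- k], which is harmless since the
   conditions hold for all integers. *)
have Q'rot s (k : int) : Q' (s + k%:~R / n%:R, 0) =
    Q (t0 + sg * s + ((-1) ^+ eps * k)%:~R / n%:R, 0).
  by rewrite /Q' /= chi0 mulrDr addrA mulrA sgz.
(* For fixed [y], [chi y] runs through a whole period between 0 and 1, so [Q'] reaches everything
   that [Q] covers and leaves no more of [S] uncovered. *)
have Qband : Q @` band `<=` Q' @` band.
  move=> _ [[t y] /= y01 <-]; pose u := sg * (t - t0).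
  have le01 : chi y 0 <= chi y 1 by rewrite ltW // chim // ltr01.
  have cchi : continuous (chi y) by rewrite /chi; continuity.
  have chi01 : chi y 1 = chi y 0 + 1 by rewrite -(chiz _ _ 1) add0r.
  have [||s _ sE] := @IVT _ (chi y) 0 1 (chi y 0 + frac (u - chi y 0)) ler01.
  - exact: continuous_subspaceT.
  - rewrite min_l // max_r // chi01 lerDl frac_ge0 lerD2l.
    exact: ltW (frac_lt1 _).
  exists (s, y) => //; rewrite /Q' /= sE /frac.
  have -> : t0 + sg * (chi y 0 + (u - chi y 0 - (Num.floor (u - chi y
    0))%:~R)) =
      t0 + sg * u + ((-1) ^+ eps * - Num.floor (u - chi y 0))%:~R.
    by rewrite -sgz mulrNz; ring.
  rewrite (spin_period_int SQ) /u mulrA -expr2 /sg sqrr_sign.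
  by rewrite mul1r subrKC.
exists Q'; last by move=> s; rewrite /Q' /= chi1 -psiE mul1r.
split.
- exact: (spin_gt0 SQ).
- exact: (spin_closed SQ).
- apply: continuous_comp1 (spin_continuous SQ); rewrite /chi; continuity.
- move=> s y; rewrite /Q' /= (chiz _ _ 1) mulrDr addrA sgz.
  exact: (spin_period_int SQ).
- by move=> s y y01; exact: (spin_sub SQ).
- move=> s s' y y' y01 y'01 /(spin_inj SQ y01 y'01) /= [yy Qs].
  split=> // y0; have := Qs y0; rewrite -yy.
  rewrite opprD addrACA subrr add0r -mulrBr rpredMsign => /intrP[m mE].
  rewrite (chii y s (s' + m%:~R) y01); last by rewrite chiz -mE subrKC.
  by rewrite addrAC subrr add0r intr_int.
- move=> s s' k E; rewrite !Q'rot; apply: (spin_rot SQ).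
  by move: E; rewrite /Q' /= !chi0.
- move=> s y k y01 clx; have [|y0 E] := spin_adh SQ ((-1) ^+ eps * k) y01
    (s := t0 + sg * chi y s).
    by apply: closure_subset clx => x [Sx nQ]; split=> // /Qband.
  split=> //; rewrite Q'rot; move: E; rewrite y0 chi0 => ->.
  by rewrite /Q' /= chi0.
Qed.

End Reparametrisation.

(** * Roots of a twist *)

(** The turns [k / m] and [l / n], repeated [lcmn m n] times, become [k'] and [l'] full turns. With
    [u m + v n = gcd], dividing by the gcd gives [v A + u B = 1], that is [l' - k' = 1]. *)
Lemma lcm_bezout (m n : nat) : (0 < m)%N -> (0 < n)%N ->
  exists k l k' l' : int, [/\ (lcmn m n)%:Z * k = k' * m%:Z,
    (lcmn m n)%:Z * l = l' * n%:Z & k' = l' - 1].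
Proof.
move=> m0 n0; have [u [v uv]] := Bezoutz m%:Z n%:Z.
have /dvdnP[A AE] := dvdn_lcml m n; have /dvdnP[B BE] := dvdn_lcmr m n.
have g0 : (0 < gcdn m n)%N by rewrite gcdn_gt0 m0.
have Ag : (A * gcdn m n)%N = n.
  by apply/eqP; rewrite -(eqn_pmul2l m0) mulnA (mulnC m) -AE muln_lcm_gcd.
have Bg : (B * gcdn m n)%N = m.
  by apply/eqP; rewrite -(eqn_pmul2l n0) mulnA (mulnC n) -BE muln_lcm_gcd mulnC.
exists (- v), u, (- v * A%:Z), (u * B%:Z); split.
- by rewrite AE PoszM; ring.
- by rewrite BE PoszM; ring.
have gn0 : (gcdn m n)%:Z != 0 by rewrite eqz_nat -lt0n.
have : u * B%:Z + v * A%:Z = 1; last by move=> E; lia.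
apply: (mulIf gn0); rewrite mul1r mulrDl -!mulrA -!PoszM Ag Bg uv.
by rewrite /gcdz !absz_nat.
Qed.

Section TwistRoot.
Context {R : realType} (F : closed_oriented_surface R).

Lemma fixed_closure (f : F -> F) (B : set F) x :
  continuous f -> (forall y, B y -> f y = y) -> closure B x -> f x = x.
Proof.
move=> cf fB clx; apply: (surface_hausdorff (c := F)) => U V nU nV.
have nfU : nbhs x (f @^-1` U) := cf x U nU.
have [b [Bb [Ub Vb]]] := clx _ (filterI nfU nV).
by exists b; split=> //; rewrite -(fB b Bb).
Qed.

Variables (C : set F) (f : homeo F) (a : plane R -> F).
Hypothesis aP : annulus_around C a.
Hypothesis fE : forall p, strip p -> f (a p) = a (p.1, p.2 + p.1).
Hypothesis f_out : forall x, ~ (a @` @strip R) x -> f x = x.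

Let a_cont : {within @strip R, continuous a}. Proof. by case: aP. Qed.

Let a_inj p p' : strip p -> strip p' ->
  (a p = a p' <-> p.1 = p'.1 /\ p.2 - p'.2 \is a Num.int).
Proof. by case: aP => _ H _ _; exact: H. Qed.

Let aC s : C (a (2^-1, s)).
Proof. by case: aP => _ _ <- _; exists s. Qed.

Let aCE x s : 0 <= x <= 1 -> C (a (x, s)) -> x = 2^-1.
Proof.
move=> x01; case: aP => _ _ <- _ [s' _].
by rewrite a_inj /strip //=; [case=> -[] | lra].
Qed.

Let core_circle : circle_path (fun s => a (2^-1, s)).
Proof.
split.
  apply: (@continuous_within_comp R (plane R) F (@strip R) a (fun s =>
    (2^-1, s))) => //.
    by continuity.
  by move=> s; rewrite /strip /=; lra.
move=> s s'; rewrite a_inj /strip /=; [|lra|lra].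
by split=> [[] //|h]; split.
Qed.

Let twist_moves x s : 0 < x < 1 -> f (a (x, s)) <> a (x, s).
Proof.
move=> x01; rewrite fE /strip /=; last by lra.
rewrite a_inj /strip /=; [|lra|lra].
by rewrite addrAC subrr add0r => -[_] /int_lt1; lra.
Qed.

(** Both halves are read from the boundary of the annulus, at [y = 0], to its core, at [y = 1],
    which becomes the seam. *)
Definition half_annulus (b : bool) (p : plane R) : plane R :=
  (if b then 1 - clamp p.2 / 2 else clamp p.2 / 2, p.1).

Lemma half_annulus_strip b p : strip (half_annulus b p).
Proof.
have := clamp_ge0 p.2; have := clamp_le1 p.2.
by rewrite /strip /half_annulus /=; case: b; lra.
Qed.

Lemma half_annulus_continuous b : continuous (half_annulus b).
Proof.
have cc : continuous (fun p : plane R => clamp p.2).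
  by apply: continuous_comp1 clamp_continuous; continuity.
by rewrite /half_annulus; case: b; continuity.
Qed.

Lemma half_annulus1 b s : half_annulus b (s, 1) = (2^-1, s).
Proof.
rewrite /half_annulus /= clamp_id ?ler01 ?lexx //.
by case: b; congr pair; field.
Qed.

(* The annulus is a neighbourhood of its interior, for otherwise [f] would fix
   some point of the latter, by continuity: this replaces the invariance of
   domain. *)
Lemma half_spinnable (S : set F) (b : bool) : closed S ->
  (forall p, S (a (half_annulus b p))) ->
  (forall p, strip p -> S (a p) -> exists q, band q /\ p = half_annulus b q) ->
  spinnable S 1 (a \o half_annulus b).
Proof.
move=> cS aS Sa.
have per (s y : R) (k : int) :
    a (half_annulus b (s + k%:~R, y)) = a (half_annulus b (s, y)).
  apply/a_inj; rewrite ?/half_annulus_strip //; try exact: half_annulus_strip.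
  by rewrite /half_annulus /= addrAC subrr add0r intr_int.
have hinj y y' : 0 <= y <= 1 -> 0 <= y' <= 1 ->
    (half_annulus b (0, y)).1 = (half_annulus b (0, y')).1 -> y = y'.
  by move=> y01 y01'; rewrite /half_annulus /= !clamp_id //;
    case: b {Sa aS per}; lra.
split=> //.
- apply: (@continuous_within_comp _ (plane R) F (@strip R) a (half_annulus b))
  => //;
    first exact: half_annulus_continuous.
  exact: half_annulus_strip.
- by move=> s y; exact: (per s y 1).
- by move=> s y _; exact: aS.
- move=> s s' y y' y01 y'01 /a_inj[||h1 h2]; try exact: half_annulus_strip.
  by split; [exact: hinj|].
- by move=> s s' k E /=; rewrite divr1 !per.
- move=> s y k y01 clx; rewrite /= divr1 per; split=> //.
  have : f (a (half_annulus b (s, y))) = a (half_annulus b (s, y)).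
    apply: (fixed_closure (homeo_continuous (h := f)) _ clx) => x [Sx nx].
    apply: f_out => -[p sp px]; apply: nx.
    have [|q [bq pq]] := Sa p sp; first by rewrite px.
    by exists q => //=; rewrite -pq.
  move=> fx; apply/eqP/negPn/negP => yn0.
  apply: (@twist_moves (half_annulus b (s, y)).1 (half_annulus b (s, y)).2) =>
    //.
  have y0 : 0 < y by rewrite lt_neqAle eq_sym yn0; case/andP: y01.
  by rewrite /half_annulus /= clamp_id //; case: b {Sa aS per hinj clx fx}; lra.
Qed.

Section Sides.
Variables (SL SR : set F) (nL nR : nat) (QL QR : plane R -> F).
Hypotheses (PL : spinnable SL nL QL) (PR : spinnable SR nR QR).
Hypotheses (cover : SL `|` SR = setT) (seam : SL `&` SR = C).
Hypothesis sideL : forall p, strip p -> p.1 < 2^-1 -> SL (a p).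
Hypothesis sideR : forall p, strip p -> 2^-1 < p.1 -> SR (a p).
Hypothesis CL : [set QL (s, 1) | s in setT] = C.
Hypothesis CR : [set QR (s, 1) | s in setT] = C.

Let coverP x : SL x \/ SR x.
Proof. by have : setT x by []; rewrite -cover. Qed.

Let seamP x : SL x -> SR x -> exists s, x = a (2^-1, s).
Proof.
move=> Lx Rx; have : C x by rewrite -seam.
by case: aP => _ _ <- _ [s _ <-]; exists s.
Qed.

Let C_both s : SL (a (2^-1, s)) /\ SR (a (2^-1, s)).
Proof. by have := aC s; rewrite -seam. Qed.

Let Q_match (S : set F) (n : nat) (Q : plane R -> F) : spinnable S n Q ->
  [set Q (s, 1) | s in setT] = C ->
  exists2 Q', spinnable S n Q' & forall s, Q' (s, 1) = a (2^-1, s).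
Proof.
move=> SQ QC; apply: (spinnable_reparam SQ core_circle).
  by move=> s; have := aC s; rewrite -QC => -[t _ tE]; exists t.
move=> t; have : C (Q (t, 1)) by rewrite -QC; exists t.
by case: aP => _ _ <- _ [s _ E]; exists s.
Qed.

Let SL_half p : strip p -> SL (a p) -> p.1 <= 2^-1.
Proof.
move=> sp Lp; rewrite leNgt; apply/negP => pR.
have := aCE (x := p.1) (s := p.2); rewrite -surjective_pairing -seam => H.
have E : p.1 = 2^-1 by apply: H => //; split=> //; exact: sideR.
by rewrite E ltxx in pR.
Qed.

Let SR_half p : strip p -> SR (a p) -> 2^-1 <= p.1.
Proof.
move=> sp Rp; rewrite leNgt; apply/negP => pL.
have := aCE (x := p.1) (s := p.2); rewrite -surjective_pairing -seam => H.
have E : p.1 = 2^-1 by apply: H => //; split=> //; exact: sideL.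
by rewrite E ltxx in pL.
Qed.

Let SLa (p : plane R) : strip p -> p.1 <= 2^-1 -> SL (a p).
Proof.
move=> sp; rewrite le_eqVlt => /orP[/eqP E|]; last exact: sideL.
by rewrite [p]surjective_pairing E; case: (C_both p.2).
Qed.

Let SRa (p : plane R) : strip p -> 2^-1 <= p.1 -> SR (a p).
Proof.
move=> sp; rewrite le_eqVlt => /orP[/eqP E|]; last exact: sideR.
by rewrite [p]surjective_pairing -E; case: (C_both p.2).
Qed.

Let half_L p : strip p -> p.1 <= 2^-1 ->
  exists q, band q /\ p = half_annulus false q.
Proof.
case: p => x s; rewrite /strip /= => x01 x2; exists (s, 2 * x).
have y01 : 0 <= 2 * x <= 1 by lra.
by split=> //; rewrite /half_annulus /= clamp_id //; congr pair; field.
Qed.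

Let half_R p : strip p -> 2^-1 <= p.1 ->
  exists q, band q /\ p = half_annulus true q.
Proof.
case: p => x s; rewrite /strip /= => x01 x2; exists (s, 2 * (1 - x)).
have y01 : 0 <= 2 * (1 - x) <= 1 by lra.
by split=> //; rewrite /half_annulus /= clamp_id //; congr pair; field.
Qed.

Let aL := a \o half_annulus false.
Let aR := a \o half_annulus true.

Let aLP : spinnable SL 1 aL.
Proof.
apply: half_spinnable (spin_closed PL) _ _.
  move=> p; apply: SLa; first exact: half_annulus_strip.
  by rewrite /half_annulus /=; have := clamp_le1 p.2; lra.
by move=> p sp /(SL_half sp); exact: half_L.
Qed.

Let aRP : spinnable SR 1 aR.
Proof.
apply: half_spinnable (spin_closed PR) _ _.
  move=> p; apply: SRa; first exact: half_annulus_strip.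
  by rewrite /half_annulus /=; have := clamp_le1 p.2; lra.
by move=> p sp /(SR_half sp); exact: half_R.
Qed.

Let aL1 s : aL (s, 1) = a (2^-1, s). Proof.
  by rewrite /aL /= half_annulus1. Qed.
Let aR1 s : aR (s, 1) = a (2^-1, s). Proof.
  by rewrite /aR /= half_annulus1. Qed.

(** The twist is first a turning of the two half annuli; each half is then replaced by the polygon
    on its side, at a moment when the profile vanishes on that side. Once both sides carry polygons,
    the profile of the twist is compared with a multiple of that of the root. *)
Lemma twist_root : exists h : Mod F, (h ^+ lcmn nL nR)%g = class_of_homeo f.
Proof.
have [QL' PL' QL1] := Q_match PL CL; have [QR' PR' QR1] := Q_match PR CR.
have pair n n' Q Q' : spinnable SL n Q -> spinnable SR n' Q' ->
    (forall s, Q (s, 1) = a (2^-1, s)) -> (forall s, Q' (s, 1) = a (2^-1, s)) ->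
    spinnable_pair SL n Q SR n' Q'.
  move=> h h' E E'; split=> // [x Lx Rx|s]; last by rewrite E E'.
  by have [s ->] := seamP Lx Rx; exists s; rewrite E.
have Paa := pair _ _ _ _ aLP aRP aL1 aR1.
have Pqa := pair _ _ _ _ PL' aRP QL1 aR1.
have Pqq := pair _ _ _ _ PL' PR' QL1 QR1.
have nL0 : nL%:R != 0 :> R by rewrite pnatr_eq0 -lt0n (spin_gt0 PL).
have nR0 : nR%:R != 0 :> R by rewrite pnatr_eq0 -lt0n (spin_gt0 PR).
(* The twist turns by [t], which is [y / 2] on the left half and [1 - y / 2] on the right half. *)
pose l0 : (R -> R) * (R -> R) := (fun y => y / 2, fun y => 1 - y / 2).
(* In [l1] the right side does all the turning. Subtracting a full turn from both sides gives [l2],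
   whose right end is 0, so that an isotopy to [l3] can make the right side zero in its turn. *)
pose l1 : (R -> R) * (R -> R) := (fun=> 0, fun y => 1 - y).
pose l2 : (R -> R) * (R -> R) := (fun=> -1, fun y => - y).
pose l3 : (R -> R) * (R -> R) := (fun y => y - 1, fun=> 0).
have p0 : profile 1 1 0 1 l0 by split=> /=; [continuity..|lra|lra|lra].
have p1 n : profile n 1 0 1 l1.
  by split=> /=; [continuity..|rewrite mul0r|lra|lra].
have p2 : profile nL 1 (- nL%:Z) 0 l2.
  by split=> /=; [continuity..|rewrite mulrNz mulNr divff|lra|lra].
have p3 n : profile nL n (- nL%:Z) 0 l3.
  by split=> /=; [continuity..|rewrite mulrNz mulNr divff ?add0r|rewrite
    mul0r|lra].
have f0 : f = spin_homeo Paa p0.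
  apply/homeo_ext/funext => x /=; have [Lx|Rx] := coverP x.
    rewrite double_spinL //; have [[[s y] y01 xE]|nx] := pselect ((aL @` band)
      x).
      rewrite -xE (spinE aLP (k := 0)) //=; last by rewrite !mul0r.
      rewrite fE ?half_annulus_strip //; last exact: half_annulus_strip.
      by rewrite /aL /half_annulus /= clamp_id.
    rewrite spin_out // f_out // => -[p sp px]; apply: nx.
    have [|q [bq pq]] := half_L sp; first by apply: SL_half => //; rewrite px.
    by exists q => //; rewrite /aL /= -pq.
  rewrite (double_spinR Paa p0) //.
  have [[[s y] y01 xE]|nx] := pselect ((aR @` band) x).
    rewrite -xE (spinE aRP (k := 1)) //=; last by rewrite mul0r subr0 divr1.
    rewrite fE ?half_annulus_strip //; last exact: half_annulus_strip.
    by rewrite /aR /half_annulus /= clamp_id.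
  rewrite spin_out // f_out // => -[p sp px]; apply: nx.
  have [|q [bq pq]] := half_R sp; first by apply: SR_half => //; rewrite px.
  by exists q => //; rewrite /aR /= -pq.
have e01 : isotopic f (spin_homeo Paa (p1 1)) by rewrite f0;
  exact: spin_homeo_isotopic.
(* The left profile is zero, so both maps are the identity on [SL] and the left half annulus may be
   exchanged for the polygon. *)
have e1 : spin_homeo Paa (p1 1) = spin_homeo Pqa (p1 nL).
  apply/homeo_ext/funext => x /=; rewrite /double_spin /=;
    case: asboolP => // Lx.
  by rewrite (spin_cst0 aLP) (spin_cst0 PL').
have e12 : spin_homeo Pqa p2 = spin_homeo Pqa (p1 nL).
  by apply: (@spin_homeo_shift _ _ _ _ _ _ _ _ _ _ _ _ _ _ _ (-1)) => y /=;
    ring.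
have e23 : isotopic (spin_homeo Pqa p2) (spin_homeo Pqa (p3 1)).
  exact: spin_homeo_isotopic.
have e3 : spin_homeo Pqa (p3 1) = spin_homeo Pqq (p3 nR).
  apply/homeo_ext/funext => x /=; rewrite /double_spin /=;
    case: asboolP => // Lx.
  by rewrite (spin_cst0 aRP) (spin_cst0 PR').
have ef : class_of_homeo f = class_of_homeo (spin_homeo Pqq (p3 nR)).
  apply/class_of_homeoP; apply: isotopic_trans e01 _.
  by rewrite e1 -e12 -e3.
have [k [l [k' [l' [kE lE kl]]]]] := lcm_bezout (spin_gt0 PL) (spin_gt0 PR).
set N := lcmn nL nR in kE lE *.
(* The profile of the root: it is zero on the seam and makes [k] and [l] elementary rotations at the
   two ends. *)
pose m : (R -> R) * (R -> R) :=
  (fun y => (1 - y) * (k%:~R / nL%:R), fun y => (1 - y) * (l%:~R / nR%:R)).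
have pm : profile nL nR k l m.
  by split=> /=; [continuity..|lra|lra|rewrite subrr !mul0r].
pose m' : (R -> R) * (R -> R) :=
  (fun y => N%:Z%:~R * m.1 y, fun y => N%:Z%:~R * m.2 y).
have pm' : profile nL nR (N%:Z * k) (N%:Z * l) m' := profileZ N%:Z pm.
(* Shifted by [l'] full turns, [l3] has the ends [l' - 1 = k'] and [l'], exactly those of the
   multiple [m']; hence the two are isotopic. *)
pose l4 : (R -> R) * (R -> R) := (fun y => y - 1 + l'%:~R, fun=> 0 + l'%:~R).
have p4 : profile nL nR (N%:Z * k) (N%:Z * l) l4.
  rewrite kE lE.
  by split=> /=; [continuity..|rewrite intrM mulfK // kl intrB; ring
                 |rewrite intrM mulfK // add0r|ring].
exists (class_of_homeo (spin_homeo Pqq pm)); rewrite class_of_homeoX ef.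
have -> : (spin_homeo Pqq pm ^+ N)%g = spin_homeo Pqq pm'.
  by apply/homeo_ext/funext => x; rewrite spin_homeo_expg.
have <- : spin_homeo Pqq p4 = spin_homeo Pqq (p3 nR).
  exact: (@spin_homeo_shift _ _ _ _ _ _ _ _ _ _ _ _ _ _ _ l').
apply/class_of_homeoP; exact: spin_homeo_isotopic.
Qed.

End Sides.

Let on_side (b : bool) (p : plane R) : Prop :=
  strip p /\ if b then 2^-1 < p.1 else p.1 < 2^-1.

Section Halves.
Variables (S S' : set F).
Hypotheses (cS : closed S) (cS' : closed S').
Hypotheses (cover : S `|` S' = setT) (seam : S `&` S' = C).

Let side_excl (b : bool) p : on_side b p -> ~ (S (a p) /\ S' (a p)).
Proof.
move=> [sp pb] SS; have : C (a p) by rewrite -seam.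
rewrite [p]surjective_pairing => /aCE E; move: pb; rewrite E //.
by case: (b); rewrite ltxx.
Qed.

(** The straight path from [(b, 0)] to [p] avoids the core, so its image misses [C], the
    intersection of the closed sets [S] and [S'], and cannot leave [S]. *)
Lemma half_connected (b : bool) : S (a (b%:R, 0)) -> forall p, on_side b p ->
  S (a p).
Proof.
move=> Sb p pb; pose g (t : R) := a ((1 - clamp t) * b%:R + clamp t * p.1,
  clamp t * p.2).
have g_side t : on_side b ((1 - clamp t) * b%:R + clamp t * p.1, clamp t * p.2).
  have [] := (clamp_ge0 t, clamp_le1 t); case: pb; rewrite /on_side /strip /=.
  by case: (b) => /=; rewrite ?mulr1 ?mulr0 ?add0r => h1 h2 h3 h4; split; nra.
have cg : continuous g.
  apply: (@continuous_within_comp _ (plane R) F (@strip R) a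
    (fun t => ((1 - clamp t) * b%:R + clamp t * p.1, clamp t * p.2))) => //.
    by have := @clamp_continuous R => cc; continuity.
  by move=> t; case: (g_side t).
have g0 : g 0 = a (b%:R, 0).
  by rewrite /g clamp_id ?lexx ?ler01 // subr0 mul1r !mul0r addr0.
have g1 : g 1 = a p.
  by rewrite /g clamp_id ?lexx ?ler01 // subrr !mul1r mul0r add0r
    -surjective_pairing.
have excl t : ~ (S (g t) /\ S' (g t)) by exact: side_excl (g_side t).
have : `[0, 1]%classic `&` g @^-1` S = `[0, 1]%classic.
  apply: segment_connected.
  - by exists 0; split=> /=; rewrite ?in_itv /= ?lexx ?ler01 // /preimage /= g0.
  - exists (g @^-1` ~` S').
      by apply: open_comp; [move=> t _; exact: cg|exact: closed_openC].
    congr (_ `&` _); rewrite eqEsubset; split=> t; rewrite /preimage /=.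
      by move=> St S't; exact: (excl t).
    have : setT (g t) by []; rewrite -cover => -[] //.
  - by exists (g @^-1` S) => //; apply: closed_comp => // t _; exact: cg.
move=> E; have : `[0, 1]%classic (1 : R) by rewrite /= in_itv /= lexx ler01.
by rewrite -E => -[_]; rewrite /preimage /= g1.
Qed.

(** If both halves lay in [S], then [f] would be the identity outside [S]. But the collar of [S']
    given by [Q] approaches every point of [C] from outside [S], so [f] would fix the core, which it
    moves by half a turn. *)
Lemma half_separated (n : nat) (Q : plane R -> F) : spinnable S' n Q ->
  [set Q (s, 1) | s in setT] = C ->
  (forall b p, on_side b p -> S (a p)) -> False.
Proof.
move=> S'Q QC aS; have aSS p : strip p -> S (a p).
  move=> sp; have [lt|gt|E] := ltgtP p.1 2^-1.
  - by apply: (aS false).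
  - by apply: (aS true).
  - by have := aC p.2; rewrite -E -surjective_pairing -seam => -[].
have := aC 0; rewrite -{1}QC => -[s _ sE].
apply: (@twist_moves 2^-1 0); first by lra.
apply: (@fixed_closure f (~` S)); first exact: homeo_continuous.
  by move=> x nSx; apply: f_out => -[p sp px]; apply: nSx; rewrite -px;
    exact: aSS.
have cQ : continuous (fun y => Q (s, y)).
  by apply: (@continuous_comp1 _ _ _ Q (fun y => (s, y)));
    [continuity|exact: (spin_continuous S'Q)].
move=> U; rewrite -sE => nU; have /nbhs_ballP[e /= e0 eU] := cQ 1 _ nU.
(* Within [e] of the seam, but strictly inside the collar, since [1 / 2 <= y < 1]. *)
pose y := 1 - Num.min (e / 2) (1 / 2).
have y01 : 0 <= y < 1 by rewrite /y; case: (leP (e / 2) (1 / 2)) => ?; lra.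
exists (Q (s, y)); split.
  move=> Sy; have : C (Q (s, y)).
    by rewrite -seam; split=> //; apply: (spin_sub S'Q); lra.
  rewrite -QC => -[s' _ /(spin_inj S'Q)[]]; rewrite ?ler01 ?lexx //;
    first by lra.
  by move=> y1; rewrite -y1 in y01; lra.
apply: eU; rewrite /ball /= /y opprB addrC subrK ger0_norm.
  by case: (leP (e / 2) (1 / 2)) => ?; lra.
by case: (leP (e / 2) (1 / 2)) => ?; lra.
Qed.

End Halves.

(** Each open half of the annulus lies in one piece, and the two halves in different ones; the two
    possible arrangements are exchanged by the symmetry of the [lcm]. *)
Lemma left_twist_root (S1 S2 : set F) (n1 n2 : nat) (Q1 Q2 : plane R -> F) :
  spinnable S1 n1 Q1 -> spinnable S2 n2 Q2 ->
  S1 `|` S2 = setT -> S1 `&` S2 = C ->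
  [set Q1 (s, 1) | s in setT] = C -> [set Q2 (s, 1) | s in setT] = C ->
  exists h : Mod F, (h ^+ lcmn n1 n2)%g = class_of_homeo f.
Proof.
move=> P1 P2 cover seam C1 C2.
have cover' : S2 `|` S1 = setT by rewrite setUC.
have seam' : S2 `&` S1 = C by rewrite setIC.
have [c1 c2] := (spin_closed P1, spin_closed P2).
have h1 := half_connected c1 c2 cover seam.
have h2 := half_connected c2 c1 cover' seam'.
have tot x : S1 x \/ S2 x by have : setT x by []; rewrite -cover.
have [] := (tot (a (false%:R, 0)), tot (a (true%:R, 0))).
move=> [/h1 hf|/h2 hf] [/h1 ht|/h2 ht].
- by exfalso; apply: (half_separated seam P2 C2) => -[]; [exact: ht|exact: hf].
- apply: (twist_root P1 P2) => // p sp pl; first by apply: hf; split.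
  by apply: ht; split.
- rewrite lcmnC; apply: (twist_root P2 P1) => // p sp pl; first by apply: hf;
  split.
  by apply: ht; split.
- by exfalso; apply: (half_separated seam' P1 C1) => -[]; [exact: ht|exact: hf].
Qed.

End TwistRoot.

(** * Polygons with glued sides *)

Lemma clos_rst_map {T T' : Type} (G : T -> T -> Prop) (G' : T' -> T' -> Prop)
    (m : T -> T') :
  (forall x y, G x y -> clos_refl_sym_trans _ G' (m x) (m y)) ->
  forall x y, clos_refl_sym_trans _ G x y ->
    clos_refl_sym_trans _ G' (m x) (m y).
Proof.
move=> Gm x y; elim=> [? ? /Gm //|?|? ? _|? ? ? _ + _].
- exact: rst_refl.
- exact: rst_sym.
- exact: rst_trans.
Qed.

Section Transfer.
Context {U T T' : Type}.
Variables (D E : set T) (D' E' : set T') (G : T -> T -> Prop).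
Variables (G' : T' -> T' -> Prop) (q : T -> U) (q' : T' -> U).
Variables (m : T' -> T) (m' : T -> T').

Local Notation "x ~ y" := (clos_refl_sym_trans _ G x y) (at level 70).
Local Notation "x ~' y" := (clos_refl_sym_trans _ G' x y) (at level 70).

Hypotheses (ED : E `<=` D) (ED' : E' `<=` D').
Hypotheses (mD : forall x, D' x -> D (m x)) (m'D : forall x, D x -> D' (m' x)).
Hypotheses (mE : forall x, E' x -> E (m x)) (m'E : forall x, E x -> E' (m' x)).
Hypothesis qG : forall x y, D x -> D y -> (q x = q y <-> x ~ y).
Hypothesis q'm : forall x, D' x -> q' x = q (m x).
Hypothesis Gm : forall x y, G' x y -> m x ~ m y.
Hypothesis Gm' : forall x y, G x y -> clos_refl_sym_trans _ G' (m' x) (m' y).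
Hypothesis m'm : forall x, D' x -> m' (m x) ~' x.
Hypothesis mm' : forall x, D x -> m (m' x) ~ x.

Lemma quotient_transfer : [/\ q' @` D' = q @` D, q' @` E' = q @` E &
  forall x y, D' x -> D' y -> (q' x = q' y <-> x ~' y)].
Proof.
have q'm' x : D x -> q' (m' x) = q x.
  by move=> Dx; rewrite q'm ?qG //; [exact: mm'|exact/mD/m'D|exact: m'D].
split.
- rewrite eqEsubset; split=> _ [x Dx <-].
    by rewrite q'm //; exists (m x) => //; exact: mD.
  by exists (m' x); [exact: m'D|exact: q'm'].
- rewrite eqEsubset; split=> _ [x Ex <-].
    by rewrite q'm; [exists (m x) => //; exact: mE|exact: ED'].
  by exists (m' x); [exact: m'E|exact/q'm'/ED].
- move=> x y Dx Dy; rewrite !q'm //; split.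
    move=> /qG - /(_ (mD Dx) (mD Dy)) xy.
    apply: (rst_trans _ _ _ (m' (m x))); first exact/rst_sym/m'm.
    apply: (rst_trans _ _ _ (m' (m y))); last exact: m'm.
    exact: clos_rst_map xy.
  by move=> xy; apply/qG; [exact: mD|exact: mD|exact: clos_rst_map xy].
Qed.

End Transfer.

(** * Gluings described by words, and rotation of a word *)

Section Words.
Context {R : realType}.

(** The annulus between the boundary of an [N]-gon, at [y = 0], and the curve [C], at [y = 1], cut
    open along a segment. *)
Definition rect (N : nat) : set (plane R) :=
  [set p | 0 <= p.1 <= N%:R /\ 0 <= p.2 <= 1].

(** The gluing of [rect (size w)] along the word [w]: the left edge is glued to
    the right one, and the top edge [y = 0] is divided into the sides
    [[i, i + 1]], two sides with the same letter being glued with opposite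
    directions. *)
Definition glue (w : seq nat) (p p' : plane R) : Prop :=
  (exists2 y, 0 <= y <= 1 & p = (0, y) /\ p' = ((size w)%:R, y)) \/
  (exists i j t, [/\ (i < size w)%N, (j < size w)%N, i <> j,
    nth 0%N w i = nth 0%N w j & 0 <= t <= 1 /\
    (p = (i%:R + t, 0) /\ p' = (j%:R + (1 - t), 0))]).

Definition glued (w : seq nat) := clos_refl_sym_trans (plane R) (glue w).

Lemma glued_refl w p : glued w p p. Proof. exact: rst_refl. Qed.

Lemma glued_sym w p p' : glued w p p' -> glued w p' p.
Proof. exact: rst_sym. Qed.

Lemma glued_trans w p p' p'' : glued w p p' -> glued w p' p'' -> glued w p p''.
Proof. exact: rst_trans. Qed.

Lemma glued_edge w y : 0 <= y <= 1 -> glued w (0, y) ((size w)%:R, y).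
Proof. by move=> y01; apply: rst_step; left; exists y. Qed.

Lemma glued_side w i j t : (i < size w)%N -> (j < size w)%N -> i <> j ->
  nth 0%N w i = nth 0%N w j -> 0 <= t <= 1 ->
  glued w (i%:R + t, 0) (j%:R + (1 - t), 0).
Proof. by move=> *; apply: rst_step; right; exists i, j, t. Qed.

Lemma glued_side_map w (x y : plane R) i j t : (i < size w)%N ->
  (j < size w)%N ->
  i <> j -> nth 0%N w i = nth 0%N w j -> 0 <= t <= 1 ->
  glued w x (i%:R + t, 0) -> glued w y (j%:R + (1 - t), 0) -> glued w x y.
Proof.
move=> iw jw ij wij t01 xi yj; apply: glued_trans xi _.
by apply: glued_trans (glued_sym yj); exact: glued_side.
Qed.

Definition presents (F : topologicalType) (S C : set F) (w : seq nat)
    (q : plane R -> F) : Prop :=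
  [/\ continuous q, q @` rect (size w) = S,
    q @` (rect (size w) `&` [set p | p.2 = 1]) = C &
    forall p p', rect (size w) p -> rect (size w) p' ->
      (q p = q p' <-> glued w p p')].

Definition presentable (F : topologicalType) (S C : set F) (w : seq nat) :
  Prop :=
  exists q, presents S C w q.

(** The maps [m] and [m'] are inverse only up to the gluings and may jump where edges are glued;
    continuity is asked of the composite [q'] alone. *)
Lemma presents_transfer (F : topologicalType) (S C : set F) (w w' : seq nat)
    (q q' : plane R -> F) (m m' : plane R -> plane R) :
  presents S C w q -> continuous q' ->
  (forall p, rect (size w') p -> rect (size w) (m p)) ->
  (forall p, rect (size w) p -> rect (size w') (m' p)) ->
  (forall p, rect (size w') p -> p.2 = 1 -> (m p).2 = 1) ->
  (forall p, rect (size w) p -> p.2 = 1 -> (m' p).2 = 1) ->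
  (forall p, rect (size w') p -> q' p = q (m p)) ->
  (forall p p', glue w' p p' -> glued w (m p) (m p')) ->
  (forall p p', glue w p p' -> glued w' (m' p) (m' p')) ->
  (forall p, rect (size w') p -> glued w' (m' (m p)) p) ->
  (forall p, rect (size w) p -> glued w (m (m' p)) p) ->
  presents S C w' q'.
Proof.
move=> [cq qS qC qG] cq' mD m'D m1 m'1 q'm Gm Gm' m'm mm'.
have [||x [Dx x1]|x [Dx x1]|E1 E2 E3] := @quotient_transfer _ _ _
    (rect (size w)) (rect (size w) `&` [set p | p.2 = 1])
    (rect (size w')) (rect (size w') `&` [set p | p.2 = 1])
    _ _ q q' m m' _ _ mD m'D _ _ qG q'm Gm Gm' m'm mm'.
- by move=> x [].
- by move=> x [].
- by split; [exact: mD|exact: m1].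
- by split; [exact: m'D|exact: m'1].
by split=> //; rewrite ?E1 ?E2.
Qed.

Definition wrap (N x : R) : R := N * frac (x / N).

Section Wrap.
Variable N : R.
Hypothesis N0 : 0 < N.

Let Nn0 : N != 0. Proof. by rewrite gt_eqF. Qed.

Lemma wrap_ge0 x : 0 <= wrap N x.
Proof. by rewrite mulr_ge0 ?frac_ge0 // ltW. Qed.

Lemma wrap_lt x : wrap N x < N.
Proof. by rewrite /wrap gtr_pMr // frac_lt1. Qed.

Lemma wrapDz x (k : int) : wrap N (x + k%:~R * N) = wrap N x.
Proof. by rewrite /wrap mulrDl mulfK // fracDz. Qed.

Lemma wrap_id x : 0 <= x < N -> wrap N x = x.
Proof.
move=> /andP[x0 xN]; rewrite /wrap frac_id; first by rewrite mulrC divfK.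
by rewrite divr_ge0 // ?ltW //= ltr_pdivrMr // mul1r.
Qed.

Lemma wrapN : wrap N N = 0.
Proof. by rewrite -[X in wrap N X]add0r -{2}[N]mul1r (wrapDz 0 1) wrap_id //
  lexx. Qed.

Lemma wrap_wrap x y : wrap N (wrap N x + y) = wrap N (x + y).
Proof.
rewrite -[RHS](wrapDz _ (- Num.floor (x / N))); congr (wrap N _).
by rewrite /wrap /frac mulrNz; field.
Qed.

End Wrap.

Section Rotation.

Definition rotate (w : seq nat) (a : R) (p : plane R) : plane R :=
  (wrap (size w)%:R (p.1 + a), p.2).

Lemma glued_wrap (w : seq nat) x y : (0 < size w)%N ->
  0 <= x <= (size w)%:R -> 0 <= y <= 1 ->
    glued w (wrap (size w)%:R x, y) (x, y).
Proof.
move=> w0 xw y01; have w0' : 0 < (size w)%:R :> R by rewrite ltr0n.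
have [->|xn] := eqVneq x (size w)%:R.
  by rewrite wrapN //; exact: glued_edge.
rewrite wrap_id //; first exact: glued_refl.
by case/andP: xw => -> /= xw; rewrite lt_neqAle xn.
Qed.

Lemma rotate_rect (w : seq nat) a p : (0 < size w)%N ->
  rect (size w) p -> rect (size w) (rotate w a p).
Proof.
move=> w0 [_ p2]; have w0' : 0 < (size w)%:R :> R by rewrite ltr0n.
by split=> //=; rewrite wrap_ge0 // ltW // wrap_lt.
Qed.

Lemma rotateK (w : seq nat) a p : (0 < size w)%N ->
  rect (size w) p -> glued w (rotate w (- a) (rotate w a p)) p.
Proof.
move=> w0 [p1 p2]; have w0' : 0 < (size w)%:R :> R by rewrite ltr0n.
rewrite /rotate /= wrap_wrap // addrK {3}[p]surjective_pairing.
exact: glued_wrap.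
Qed.

End Rotation.

Lemma swap_inj (a b i j : nat) : (i < a + b)%N -> (j < a + b)%N -> i <> j ->
  (if (i < b)%N then (i + a)%N else (i - b)%N) <>
  (if (j < b)%N then (j + a)%N else (j - b)%N).
Proof. by move=> ia ja ij; case: (ltnP i b); case: (ltnP j b); lia. Qed.

(** Turning by the length of [w1] permutes the sides by the exchange [sg] of the two blocks. With
    [c = -1] and the words exchanged, the same statement gives the inverse rotation. *)
Lemma rotate_glue (w1 w2 : seq nat) (c : int) p p' : (0 < size (w1 ++ w2))%N ->
  glue (w2 ++ w1) p p' ->
  glued (w1 ++ w2)
    (rotate (w1 ++ w2) ((size w1)%:R + c%:~R * (size (w1 ++ w2))%:R) p)
    (rotate (w1 ++ w2) ((size w1)%:R + c%:~R * (size (w1 ++ w2))%:R) p').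
Proof.
move=> w0; set w := w1 ++ w2 in w0 *; set n1 := size w1; set n2 := size w2.
have w0' : 0 < (size w)%:R :> R by rewrite ltr0n.
have sE : size (w2 ++ w1) = size w by rewrite !size_cat addnC.
have wE : size w = (n1 + n2)%N by rewrite size_cat.
rewrite /rotate; case=> [[y y01 [-> ->]]|[i [j [t [iw jw ij wij [t01 [->
  ->]]]]]]] /=.
  rewrite sE add0r [(size w)%:R + _]addrC.
  have := wrapDz w0' (n1%:R + c%:~R * (size w)%:R) 1; rewrite mul1r => ->.
  exact: glued_refl.
have D x : wrap (size w)%:R (x + (n1%:R + c%:~R * (size w)%:R)) =
    wrap (size w)%:R (x + n1%:R) by rewrite addrA wrapDz.
rewrite !D.
pose sg k := if (k < n2)%N then (k + n1)%N else (k - n2)%N.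
have sgw k : (k < size w)%N -> (sg k < size w)%N by rewrite wE /sg; case: ifP;
  lia.
have sgn k : (k < size w)%N -> nth 0%N w (sg k) = nth 0%N (w2 ++ w1) k.
  move=> kw; rewrite /w /sg !nth_cat -/n1 -/n2; case: (ltnP k n2) => kn.
    by rewrite ltnNge leq_addl addnK.
  by rewrite (_ : (k - n2 < n1)%N) //; lia.
have sgE k (u : R) : (k < size w)%N -> 0 <= u <= 1 ->
    glued w (wrap (size w)%:R (k%:R + u + n1%:R), 0) ((sg k)%:R + u, 0).
  move=> kw u01; have -> : wrap (size w)%:R (k%:R + u + n1%:R) =
      wrap (size w)%:R ((sg k)%:R + u).
    rewrite /sg; case: ltnP => kn; first by rewrite natrD; congr wrap; ring.
    rewrite -[RHS](wrapDz w0' _ 1); congr wrap.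
    by rewrite wE natrB // natrD; ring.
  apply: glued_wrap => //; last by rewrite lexx ler01.
  have : (sg k)%:R + 1 <= (size w)%:R :> R by rewrite natr1 ler_nat sgw.
  by have : 0 <= (sg k)%:R :> R by []; lra.
rewrite sE in iw jw.
apply: (@glued_side_map _ _ _ (sg i) (sg j) t) => //.
- exact: sgw.
- exact: sgw.
- by rewrite wE in iw jw; exact: swap_inj.
- by rewrite !sgn.
- exact: sgE.
- by apply: sgE => //; rewrite subr_ge0 lerBlDr lerDl andbC.
Qed.

Lemma presentable_rot (F : topologicalType) (S C : set F) (w1 w2 : seq nat) :
  presentable S C (w1 ++ w2) -> presentable S C (w2 ++ w1).
Proof.
have [w0|] := posnP (size (w1 ++ w2)).
  by have : w1 = [::] /\ w2 = [::];
    [case: w1 w2 w0 => [|? ?] [|? ?] | case=> -> ->].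
set w := w1 ++ w2 => w0 [q qP]; have [cq _ _ qG] := qP.
have w0' : 0 < (size w)%:R :> R by rewrite ltr0n.
have sE : size (w2 ++ w1) = size w by rewrite !size_cat addnC.
pose a : R := (size w1)%:R.
exists (fun p => q (wrap (size w)%:R (p.1 + a), clamp p.2)).
have y01 (y : R) : 0 <= clamp y <= 1 by rewrite clamp_ge0 clamp_le1.
apply: (presents_transfer (m := rotate w a) (m' := rotate w (- a)) qP);
  rewrite ?sE.
- have cc : continuous (fun p : plane R => clamp p.2).
    by apply: continuous_comp1 clamp_continuous; continuity.
  pose g (p : plane R) := q ((size w)%:R * p.1, clamp p.2).
  have cg : continuous g by rewrite /g; continuity.
  have g01 y : g (0, y) = g (1, y).
    rewrite /g /= mulr0 mulr1; apply/qG; last exact: glued_edge.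
      by split; rewrite //= lexx ltW.
    by split; rewrite //= lexx ltW.
  apply: (@continuous_comp1 _ _ _ (fun p => g (frac p.1, p.2))
    (fun p : plane R => ((p.1 + a) / (size w)%:R, p.2))); first by continuity.
  exact: periodic_continuous.
- by move=> p; exact: rotate_rect.
- by move=> p; exact: rotate_rect.
- by [].
- by [].
- by move=> p [_ p2]; rewrite clamp_id.
- move=> p p' /(rotate_glue 0 w0) ; rewrite mul0r addr0; exact.
- move=> p p' pp; have := @rotate_glue w2 w1 (-1) p p'.
  rewrite sE => /(_ w0 pp).
  have -> : (size w2)%:R + (-1)%:~R * (size w)%:R = - a.
    by rewrite /a /w size_cat natrD; ring.
  by rewrite /rotate sE.
- move=> p pr; have := @rotateK (w2 ++ w1) a p.
  by rewrite /rotate sE; exact.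
- move=> p pr; have := @rotateK w (- a) p w0 pr.
  by rewrite opprK.
Qed.

End Words.

(** * The slide move, which exchanges two blocks between paired sides *)

Section Slide.
Context {R : realType}.

Section Sector.
Variable l : R.
Hypothesis l0 : 0 < l.

(** Coordinates [(phi, rho)] on the neighbourhood [rho <= 1] of the sides
    [[1, 1 + 2 l]] of the top edge: [rho = 0] is these sides, while [phi = 0]
    and [phi = 1] are the neighbouring sides [[0, 1]] and
    [[1 + 2 l, 2 + 2 l]]. *)
Definition sector_rho (p : plane R) : R :=
  Num.max (Num.max 0 p.2) (p.2 + `|p.1 - 1 - l| - l).

Definition sector_phi (p : plane R) : R :=
  (1 + (p.1 - 1 - l) / (l + sector_rho p)) / 2.

(** The inverse of these coordinates. The line of level [rho] is the top of a trapezoid: at height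
    [rho] above [[1, 1 + 2 * l]], then down with slope 1 to the points at distance [rho] from that
    interval on the edge; [phi] is the abscissa rescaled to [[0, 1]]. *)
Definition sector (phi rho : R) : plane R :=
  (1 + l + (2 * phi - 1) * (l + rho),
   Num.min rho ((l + rho) * (1 - `|2 * phi - 1|))).

(** Gluing the sides [phi = 0] and [phi = 1] turns [rho] into the radius of an
    annulus, whose circles [slide] turns, from the angle [k] at [rho = 0] to no
    angle at [rho = 1]. *)
Definition slide (k : R) (p : plane R) : plane R :=
  if sector_rho p < 1
  then sector (frac (sector_phi p + k * (1 - sector_rho p))) (sector_rho p)
  else p.

Lemma sector_rho_ge0 p : 0 <= sector_rho p.
Proof. by rewrite /sector_rho !le_max lexx. Qed.

Let lr p : 0 < l + sector_rho p.
Proof. by rewrite ltr_wpDr // sector_rho_ge0. Qed.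

Lemma sectorK (phi rho : R) : 0 <= phi <= 1 -> 0 <= rho ->
  sector_rho (sector phi rho) = rho /\ sector_phi (sector phi rho) = phi.
Proof.
move=> phi01 rho0; have lr0 : 0 < l + rho by move: l0; lra.
have rhoE : sector_rho (sector phi rho) = rho.
  rewrite /sector_rho /sector /=.
  have -> : 1 + l + (2 * phi - 1) * (l + rho) - 1 - l = (2 * phi - 1) * (l +
    rho).
    by ring.
  have b1 : `|2 * phi - 1| <= 1 by rewrite ler_norml; apply/andP; split; lra.
  rewrite normrM (gtr0_norm lr0); move: b1 (normr_ge0 (2 * phi - 1)).
  move: `|2 * phi - 1| => b b1 b0.
  have [c c01 cE] : exists2 c, 0 <= c <= l + rho & b * (l + rho) = c.
    by exists (b * (l + rho)) => //; rewrite mulr_ge0 ?(ltW lr0) //= ger_pMl.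
  have -> : (l + rho) * (1 - b) = l + rho - c by rewrite -cE; ring.
  rewrite cE.
  rewrite minEle; case: (leP rho (l + rho - c)) => h.
    rewrite (max_r rho0) max_l //; lra.
  by rewrite (@max_r _ _ 0) ?max_r; lra.
split=> //; rewrite /sector_phi rhoE /=; field.
by rewrite gt_eqF.
Qed.

Lemma sectorE p : 0 <= p.2 ->
  sector (sector_phi p) (sector_rho p) = p /\ 0 <= sector_phi p <= 1.
Proof.
have l0' := l0; case: p => x y /= y0; set r := sector_rho _.
have r_lt : 0 < l + r := lr (x, y).
pose d := x - 1 - l; have rE : r = Num.max y (y + `|d| - l).
  by rewrite /r /sector_rho /= (max_r y0).
have dr : `|d| <= l + r.
  have : y + `|d| - l <= r by rewrite rE le_max lexx orbT.
  by lra.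
have E : 2 * sector_phi (x, y) - 1 = d / (l + r).
  by rewrite /sector_phi /= -/r -/d; field; rewrite gt_eqF.
split; last first.
  have : -1 <= d / (l + r) <= 1.
    by rewrite ler_pdivlMr // ler_pdivrMr // mulN1r mul1r -ler_norml.
  by rewrite -E; lra.
rewrite /sector E normf_div (gtr0_norm r_lt); congr pair.
  by rewrite divfK ?gt_eqF // /d; ring.
have -> : (l + r) * (1 - `|d| / (l + r)) = l + r - `|d|.
  by field; rewrite gt_eqF.
by rewrite rE; case: (leP y (y + `|d| - l)) => h;
  [rewrite min_r|rewrite min_l]; lra.
Qed.

Lemma sector_bounds (phi rho : R) : 0 <= phi <= 1 -> 0 <= rho <= 1 ->
  0 <= (sector phi rho).1 <= 2 + 2 * l /\ 0 <= (sector phi rho).2 <= 1.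
Proof.
have l0' := l0; move=> phi01 rho01; rewrite /sector /=.
have b01 : `|2 * phi - 1| <= 1 by rewrite ler_norml; lra.
split; first by apply/andP; split; nra.
have [rho0 rho1] := andP rho01; rewrite le_min ge_min rho0 rho1 /= andbT.
by rewrite mulr_ge0 ?subr_ge0 //; lra.
Qed.

Lemma sector_bottom (phi : R) : 0 <= phi <= 1 ->
  sector phi 0 = (1 + 2 * l * phi, 0).
Proof.
have l0' := l0; move=> phi01; rewrite /sector addr0; congr pair; first by ring.
rewrite min_l // mulr_ge0 ?subr_ge0 ?ler_norml ?(ltW l0) //; lra.
Qed.

Lemma sector_left (rho : R) : 0 <= rho -> sector 0 rho = (1 - rho, 0).
Proof.
move=> rho0; rewrite /sector mulr0 add0r normrN normr1 subrr mulr0 min_r //.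
by congr pair; ring.
Qed.

Lemma sector_right (rho : R) : 0 <= rho -> sector 1 rho = (1 + 2 * l + rho, 0).
Proof.
move=> rho0; rewrite /sector (_ : 2 * 1 - 1 = 1 :> R); last by ring.
by rewrite normr1 subrr mulr0 min_r //; congr pair; ring.
Qed.

Lemma slide_out k (x y : R) : 2 + 2 * l <= x \/ x = 0 -> 0 <= y ->
  slide k (x, y) = (x, y).
Proof.
have l0' := l0; move=> hx y0; rewrite /slide ifF //; apply/negbTE;
  rewrite -leNgt.
rewrite /sector_rho /= le_max; apply/orP; right.
by case: hx => [?|->]; [rewrite ger0_norm|rewrite ltr0_norm]; lra.
Qed.

Lemma slide_sector k (phi rho : R) : 0 <= phi <= 1 -> 0 <= rho < 1 ->
  slide k (sector phi rho) = sector (frac (phi + k * (1 - rho))) rho.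
Proof.
move=> phi01 /andP[rho0 rho1]; have [h1 h2] := sectorK phi01 rho0.
by rewrite /slide h1 h2 rho1.
Qed.

End Sector.

Section Swap.
Variables (u : nat) (V Z W : seq nat).

Definition block_word := u :: V ++ Z ++ u :: W.

Local Notation n := (size V + size Z)%N.

Lemma size_block_word : size block_word = (2 + n + size W)%N.
Proof. by rewrite /= !size_cat /=; lia. Qed.

Lemma nth_block_word i : nth 0%N block_word i =
  if i == 0%N then u else if (i <= size V)%N then nth 0%N V i.-1
  else if (i <= n)%N then nth 0%N Z (i.-1 - size V)%N
  else if i == n.+1 then u else nth 0%N W (i - n.+2)%N.
Proof.
case: i => [|i] //=; rewrite !nth_cat.
case: (ltnP i (size V)) => iV //.
case: (ltnP (i - size V) (size Z)) => iZ.
  by rewrite ifT //; lia.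
rewrite ifF; last by lia.
case: eqP => iE; first by rewrite (_ : i - size V - size Z = 0)%N //; lia.
by rewrite (_ : i - size V - size Z = (i.+1 - (size V + size Z).+2).+1)%N //;
  lia.
Qed.

Hypotheses (uV : u \notin V) (uZ : u \notin Z) (uW : u \notin W).

Lemma nth_block_word_u i : (i < size block_word)%N ->
  (nth 0%N block_word i == u) = (i == 0%N) || (i == n.+1).
Proof.
rewrite size_block_word => iw; rewrite nth_block_word.
case: (i =P 0%N) => [_|i0] /=; first by rewrite eqxx.
have notin (s : seq nat) j : u \notin s -> (j < size s)%N ->
  nth 0%N s j == u = false.
  by move=> us js; apply: contraNF us => /eqP <-; exact: mem_nth.
case: (leqP i (size V)) => iV /=.
  rewrite notin //; last by lia.
  by apply/esym/eqP => E; move: iV; rewrite E; lia.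
case: (leqP i n) => iZ /=.
  rewrite notin //; first by apply/esym/eqP; lia.
  by lia.
case: (i =P n.+1) => iE; first by rewrite eqxx.
by rewrite notin //; lia.
Qed.

End Swap.

Section SwapBlocks.
Variables (u : nat) (V Z W : seq nat).
Hypotheses (uV : u \notin V) (uZ : u \notin Z) (uW : u \notin W).

Let n := (size V + size Z)%N.
Hypothesis n0 : (0 < n)%N.
Let l : R := n%:R / 2.
Let w := block_word u V Z W.

Let nR0 : 0 < n%:R :> R. Proof. by rewrite ltr0n. Qed.
Let l0 : 0 < l. Proof. by rewrite divr_gt0. Qed.
Let l2 : 2 * l = n%:R. Proof. by rewrite /l; field. Qed.
Let sw : size w = (2 + n + size W)%N. Proof. exact: size_block_word. Qed.

Let swR : (size w)%:R = 2 + n%:R + (size W)%:R :> R.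
Proof. by rewrite sw (natrD _ (2 + n)) (natrD _ 2 n). Qed.

Let w0 : (0 < size w)%N. Proof. by rewrite sw. Qed.
Let wn : (n.+1 < size w)%N. Proof. by rewrite sw; lia. Qed.

Let glued_u (t : R) : 0 <= t <= 1 -> glued w (t, 0) (n%:R + 2 - t, 0).
Proof.
move=> t01; have := @glued_side R w 0 n.+1 t w0 wn.
have -> : nth 0%N w 0 = u by apply/eqP; rewrite nth_block_word_u.
have -> : nth 0%N w n.+1 = u by apply/eqP;
  rewrite nth_block_word_u // eqxx orbT.
have -> : n.+1%:R + (1 - t) = n%:R + 2 - t by rewrite -natr1; ring.
by rewrite add0r; exact.
Qed.

Lemma sector_seam (rho : R) : 0 <= rho <= 1 ->
  glued w (sector l 0 rho) (sector l 1 rho).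
Proof.
move=> rho01; have /andP[rho0 _] := rho01.
rewrite sector_left // sector_right // l2.
have -> : 1 + n%:R + rho = n%:R + 2 - (1 - rho) by ring.
by apply: glued_u; lra.
Qed.

Lemma sector_glued (x : R) : 0 <= x <= n%:R ->
  glued w (sector l (frac (x / n%:R)) 0) (1 + x, 0).
Proof.
move=> x01; have f01 : 0 <= frac (x / n%:R) <= 1.
  by rewrite frac_ge0 ltW ?frac_lt1.
rewrite sector_bottom // l2; change (glued w (1 + wrap n%:R x, 0) (1 + x, 0)).
have [->|xn] := eqVneq x n%:R.
  rewrite wrapN // addr0.
  have -> : 1 + n%:R = n%:R + 2 - 1 :> R by ring.
  by apply: glued_u; rewrite ler01 lexx.
rewrite (wrap_id nR0); first exact: glued_refl.
by have /andP[x0 x1] := x01; apply/andP; split=> //; rewrite lt_neqAle xn.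
Qed.

Lemma slideK (k : R) p : rect (size w) p ->
  glued w (slide l (- k) (slide l k p)) p.
Proof.
move=> [_ /andP[p0 _]]; have [pE p01] := sectorE l0 p0.
have [r1|r1] := ltP (sector_rho l p) 1; last first.
  have sp k' : slide l k' p = p by rewrite /slide ltNge r1.
  by rewrite !sp; exact: glued_refl.
have r01 : 0 <= sector_rho l p < 1 by rewrite sector_rho_ge0.
move: (sector_phi l p) (sector_rho l p) pE p01 r01 => phi r <- phi01 r01 {r1}.
have f01 (s : R) : 0 <= frac s <= 1 by rewrite frac_ge0 ltW ?frac_lt1.
rewrite !slide_sector //.
have -> : frac (frac (phi + k * (1 - r)) + - k * (1 - r)) = frac phi.
  rewrite {2}/frac -mulrNz -[RHS](fracDz _ (- Num.floor (phi + k * (1 - r)))).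
  by congr frac; ring.
have [->|phin] := eqVneq phi 1.
  have -> : frac 1 = 0 :> R
    by rewrite (@frac_unique _ _ 0 1) ?lexx ?ltr01 ?add0r.
  by apply: sector_seam; have /andP[-> /ltW] := r01.
rewrite frac_id; first exact: glued_refl.
by have /andP[h0 h1] := phi01; apply/andP; split=> //; rewrite lt_neqAle phin.
Qed.

Lemma slide_rect (k : R) p : rect (size w) p -> rect (size w) (slide l k p).
Proof.
move=> pr; have [_ /andP[p0 _]] := pr.
rewrite /slide; case: ifP => // r1.
have f01 (s : R) : 0 <= frac s <= 1 by rewrite frac_ge0 ltW ?frac_lt1.
have r01 : 0 <= sector_rho l p <= 1 by rewrite sector_rho_ge0 ltW.
have [h1 h2] := sector_bounds l0 (f01 (sector_phi l p + k * (1 - sector_rho l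
  p))) r01.
split=> //; rewrite swR -l2; case/andP: h1 => -> /= /le_trans; apply.
by rewrite lerDl.
Qed.

Lemma slide_bottom (k : R) p : rect (size w) p -> p.2 = 1 ->
  (slide l k p).2 = 1.
Proof.
move=> _ p1; rewrite /slide ifF //; apply/negbTE; rewrite -leNgt.
by rewrite /sector_rho p1 !le_max lexx orbT.
Qed.

(** Paired points of the sides [u] are the ends [phi = 0] and [phi = 1] of one circle, and are
    turned to the same point. On [rho = 0] a turn by [size V / n] shifts the sides cyclically by
    [size V], which exchanges [Z] and [V], as in [sg]. The sides [W] do not move. *)
Lemma slide_glue (c : int) p p' : glue (block_word u Z V W) p p' ->
  glued w (slide l ((size V)%:R / n%:R + c%:~R) p)
          (slide l ((size V)%:R / n%:R + c%:~R) p').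
Proof.
set k := _ / _ + _; have nC : (size Z + size V)%N = n by rewrite addnC.
have sw' : size (block_word u Z V W) = size w.
  by rewrite sw /= !size_cat /= /n; lia.
have out (x y : R) : n%:R + 2 <= x \/ x = 0 -> 0 <= y ->
    slide l k (x, y) = (x, y).
  move=> hx y0'; apply: slide_out => //; rewrite l2 addrC.
  by case: hx => [->|->]; [left|right].
have u_case (t : R) : 0 <= t <= 1 ->
    glued w (slide l k (t, 0)) (slide l k (n%:R + 2 - t, 0)).
  move=> t01; have [->|tn] := eqVneq t 0.
    rewrite !out ?lexx //; [|by left; rewrite subr0|by right].
    by apply: glued_u; rewrite lexx ler01.
  have t0 : 0 < t by rewrite lt_neqAle eq_sym tn; case/andP: t01.
  have r01 : 0 <= 1 - t < 1 by apply/andP; split; lra.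
  have rr : 0 <= 1 - t by case/andP: r01.
  have -> : (t, 0) = sector l 0 (1 - t)
    by rewrite sector_left // opprB addrC subrK.
  have -> : (n%:R + 2 - t, 0) = sector l 1 (1 - t).
    by rewrite sector_right // l2; congr pair; ring.
  rewrite !slide_sector ?lexx ?ler01 //.
  have -> : frac (1 + k * (1 - (1 - t))) = frac (0 + k * (1 - (1 - t))).
    by rewrite -[RHS](fracDz _ 1); congr frac; ring.
  exact: glued_refl.
case=> [[y y01 [-> ->]]|[i [j [t [iw jw ij wij [t01 [-> ->]]]]]]].
  rewrite sw' !out; try by case/andP: y01.
  - exact: glued_edge.
  - by left; rewrite swR; have : 0 <= (size W)%:R :> R by []; lra.
  - by right.
have uw' a : (a < size w)%N ->
    (nth 0%N (block_word u Z V W) a == u) = (a == 0%N) || (a == n.+1).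
  by move=> aw; rewrite nth_block_word_u ?sw' // nC.
rewrite sw' in iw jw.
have [iu|iu] := boolP (nth 0%N (block_word u Z V W) i == u).
  have ju : nth 0%N (block_word u Z V W) j == u by rewrite -wij.
  rewrite !uw' // in iu ju.
  case/orP: iu => /eqP iE; case/orP: ju => /eqP jE; subst i j => //.
    have -> : n.+1%:R + (1 - t) = n%:R + 2 - t by rewrite -natr1; ring.
    by rewrite add0r; exact: u_case.
  have -> : n.+1%:R + t = n%:R + 2 - (1 - t) by rewrite -natr1; ring.
  rewrite add0r; apply/glued_sym/u_case; lra.
have ju : nth 0%N (block_word u Z V W) j != u by rewrite -wij.
rewrite !uw' // in iu ju.
pose sg a := if (a <= n)%N then
  (if (a.-1 < size Z)%N then a.-1 + size V else a.-1 - size Z)%N.+1 else a.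
have sg_w a : (a < size w)%N -> (sg a < size w)%N.
  by rewrite sw /sg /n; case: ifP => // ?; case: ifP; lia.
have sg_nth a : (a < size w)%N -> ~~ ((a == 0%N) || (a == n.+1)) ->
    nth 0%N w (sg a) = nth 0%N (block_word u Z V W) a.
  move=> aw; rewrite negb_or => /andP[a0 an]; rewrite !nth_block_word nC -/n.
  rewrite (negbTE a0) (negbTE an) /sg; case: (leqP a n) => an'; last first.
    have -> : (a <= size V)%N = false by move: an'; rewrite /n; lia.
    have -> : (a <= size Z)%N = false by move: an'; rewrite /n; lia.
    by rewrite (negbTE a0) leqNgt an' /= (negbTE an).
  case: ltnP => aZ /=.
    have -> : (a <= size Z)%N by lia.
    have -> : (a.-1 + size V < size V)%N = false by lia.
    by rewrite ifT ?addnK // /n; lia.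
  have -> : (a <= size Z)%N = false by lia.
  by rewrite ifT //; move: an'; rewrite /n; lia.
have sgE a (t' : R) : (a < size w)%N -> ~~ ((a == 0%N) || (a == n.+1)) ->
    0 <= t' <= 1 -> glued w (slide l k (a%:R + t', 0)) ((sg a)%:R + t', 0).
  move=> aw; rewrite negb_or => /andP[a0 an] t'01.
  rewrite /sg; case: (leqP a n) => an'; last first.
    rewrite out ?lexx //; first exact: glued_refl.
    left; have : n.+2%:R <= a%:R :> R by rewrite ler_nat; lia.
    by rewrite -addn2 natrD; lra.
  case: a a0 an an' {aw} => // a _ _ an' /=.
  have th01 (b : nat) : (b < n)%N -> 0 <= b%:R + t' <= n%:R.
    move=> bn; have : b%:R + 1 <= n%:R :> R by rewrite natr1 ler_nat.
    by have : 0 <= b%:R :> R by []; lra.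
  have thn (b : nat) : (b < n)%N -> 0 <= (b%:R + t') / n%:R <= 1.
    move=> /th01/andP[h0 h1]; rewrite divr_ge0 //= ?(ltW nR0) //.
    by rewrite ler_pdivrMr // mul1r.
  have -> : (a.+1%:R + t', 0) = sector l ((a%:R + t') / n%:R) 0.
    rewrite (sector_bottom l0 (thn a an')) l2.
    by congr pair; rewrite -natr1; field; rewrite gt_eqF.
  rewrite (slide_sector l0 _ (thn a an')) ?lexx ?ltr01 //.
  rewrite subr0 mulr1 /k addrA fracDz -mulrDl.
  set b := (if _ then _ else _)%N.
  have bn : (b < n)%N by move: an'; rewrite /b /n; case: ifP; lia.
  have -> : frac ((a%:R + t' + (size V)%:R) / n%:R) = frac ((b%:R + t') / n%:R).
    rewrite /b; case: ltnP => aZ.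
      by rewrite natrD; congr frac; ring.
    rewrite -[RHS](fracDz _ 1); congr frac.
    rewrite natrB // /n natrD; field.
    by rewrite -natrD gt_eqF.
  have -> : b.+1%:R + t' = 1 + (b%:R + t') by rewrite -natr1; ring.
  exact/sector_glued/th01.
apply: (@glued_side_map _ _ _ _ (sg i) (sg j) t) => //.
- exact: sg_w.
- exact: sg_w.
- move: iu ju iw jw; rewrite /sg !negb_or => /andP[i0 _] /andP[j0 _] _ _.
  case: (leqP i n) => i1; case: (leqP j n) => j1 //.
  + by move=> -[]; apply: swap_inj; rewrite -/n; lia.
  + by move=> E; move: j1; rewrite -E /n; case: ifP; move: i1; rewrite /n; lia.
  + by move=> E; move: i1; rewrite E /n; case: ifP; move: j1; rewrite /n; lia.
- by rewrite !sg_nth.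
- exact: sgE.
- by apply: sgE => //; lra.
Qed.

End SwapBlocks.

End Slide.

Section Moves.
Context {R : realType}.

Definition clamp_rect (N : nat) (p : plane R) : plane R :=
  (Num.max 0 (Num.min N%:R p.1), clamp p.2).

Lemma clamp_rect_continuous N : continuous (clamp_rect N).
Proof.
have cc : continuous (fun p : plane R => clamp p.2).
  by apply: continuous_comp1 clamp_continuous; continuity.
by rewrite /clamp_rect; continuity.
Qed.

Lemma clamp_rectP N p : rect N (clamp_rect N p).
Proof.
split; last by rewrite /= clamp_ge0 clamp_le1.
by rewrite /= le_max lexx /= ge_max ler0n ge_min lexx.
Qed.

Lemma clamp_rect_id N p : rect N p -> clamp_rect N p = p.
Proof.
case: p => x y [/= /andP[x0 xN] y01].
by rewrite /clamp_rect /= min_r // max_r // clamp_id.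
Qed.

Lemma sector_rho_continuous (l : R) : continuous (sector_rho l).
Proof. by rewrite /sector_rho; continuity. Qed.

Lemma sector_phi_continuous (l : R) : 0 < l -> continuous (sector_phi l).
Proof.
move=> l0; have cr := @sector_rho_continuous l.
rewrite /sector_phi; continuity.
apply: continuous_invr; first by continuity.
by move=> p; rewrite gt_eqF // ltr_wpDr // sector_rho_ge0.
Qed.

Lemma sector_continuous (l : R) : continuous (fun p : R * R =>
  sector l p.1 p.2).
Proof. by rewrite /sector; continuity. Qed.

(** Although [slide] jumps, [q'] is continuous: the jump of [frac] is absorbed by the gluing of
    [phi = 0] with [phi = 1], and at [rho = 1] the turn is zero, so the two formulas agree. *)
Lemma presentable_slide (F : topologicalType) (S C : set F) (u : nat)
    (V Z W : seq nat) :
  u \notin V -> u \notin Z -> u \notin W ->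
  presentable (R := R) S C (u :: V ++ Z ++ u :: W) ->
  presentable (R := R) S C (u :: Z ++ V ++ u :: W).
Proof.
move=> uV uZ uW; have [/eqP|n0] := posnP (size V + size Z)%N.
  by rewrite addn_eq0 => /andP[/nilP -> /nilP ->].
have n0' : (0 < size Z + size V)%N by rewrite addnC.
set w := u :: V ++ _; set w' := u :: Z ++ _; case=> q qP.
have [cq _ _ qG] := qP.
pose n : R := (size V + size Z)%:R; pose l := n / 2.
have nE : (size Z + size V)%:R = n by rewrite addnC.
have np : 0 < n by rewrite ltr0n.
have l0 : 0 < l by rewrite divr_gt0.
have sw : size w = (2 + (size V + size Z) + size W)%N by exact: size_block_word.
have sE : size w' = size w by rewrite sw /= !size_cat /=; lia.
pose k : R := (size V)%:R / n.
pose g (p : R * R) := q (sector l p.1 (clamp p.2)).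
have c01 (y : R) : 0 <= clamp y <= 1 by rewrite clamp_ge0 clamp_le1.
have cg : continuous g.
  have cc : continuous (fun p : plane R => clamp p.2).
    by apply: continuous_comp1 clamp_continuous; continuity.
  apply: (@continuous_comp1 _ _ _ q) => //.
  apply: (@continuous_comp1 _ _ _ (fun p : R * R => sector l p.1 p.2)
    (fun p => (p.1, clamp p.2))); last exact: sector_continuous.
  by continuity.
have sw2 : 2 + 2 * l <= (size w)%:R.
  rewrite (_ : 2 * l = n); last by rewrite /l; field.
  by rewrite sw (natrD _ (2 + _)) (natrD _ 2) lerDl.
have sr phi rho : 0 <= phi <= 1 -> 0 <= rho <= 1 ->
  rect (size w) (sector l phi rho).
  move=> phi01 rho01; have [h1 h2] := sector_bounds l0 phi01 rho01.
  by split=> //; case/andP: h1 => h1 h3; rewrite h1 (le_trans h3).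
have glued01 rho : 0 <= rho <= 1 -> glued w (sector l 0 rho) (sector l 1 rho).
  by move=> rho01; exact: (sector_seam uV uZ uW n0 rho01).
have g01 rho : g (0, rho) = g (1, rho).
  by apply/qG; [apply: sr|apply: sr|apply: glued01]; rewrite ?lexx ?ler01.
pose q' p := let c := clamp_rect (size w) p in
  if 1 - sector_rho l c <= 0 then q c
  else g (frac (sector_phi l c + k * (1 - sector_rho l c)), sector_rho l c).
have cq' : continuous q'.
  have cc := @clamp_rect_continuous (size w).
  have cr : continuous (fun p => sector_rho l (clamp_rect (size w) p)).
    exact: continuous_comp1 (@sector_rho_continuous l).
  have cp : continuous (fun p => sector_phi l (clamp_rect (size w) p)).
    exact: continuous_comp1 (sector_phi_continuous l0).
  apply: continuous_if.
  - by continuity.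
  - exact: continuous_comp1.
  - apply: (@continuous_comp1 _ _ _ (fun p : R * R =>
    g (frac p.1, p.2)) (fun p =>
      (sector_phi l (clamp_rect (size w) p) +
       k * (1 - sector_rho l (clamp_rect (size w) p)),
       sector_rho l (clamp_rect (size w) p)))); first by continuity.
    exact: periodic_continuous.
  - move=> p; have pr := clamp_rectP (size w) p.
    move: (clamp_rect _ p) pr => {}p pr E; have [_ /andP[p0 _]] := pr.
    have [pE p01] := sectorE l0 p0.
    have rE : sector_rho l p = 1 by lra.
    rewrite rE subrr mulr0 addr0 /g /= clamp_id ?ler01 ?lexx //.
    rewrite -{1}pE rE; have [->|pn] := eqVneq (sector_phi l p) 1.
      have -> : frac 1 = 0 :> R.
        by rewrite (@frac_unique _ _ 0 1) ?lexx ?ltr01 ?add0r.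
      by apply/esym/qG; [apply: sr|apply: sr|apply: glued01];
        rewrite ?lexx ?ler01.
    rewrite frac_id //; have /andP[h0 h1] := p01; apply/andP; split=> //.
    by rewrite lt_neqAle pn.
exists q'; apply: (presents_transfer (m := slide l k) (m' := slide l (- k))
  qP) => //;
  rewrite ?sE.
- by move=> p; exact: slide_rect.
- move=> p; rewrite -sE; have := @slide_rect R u Z V W n0' (- k) p.
  by rewrite nE; exact.
- by move=> p; exact: slide_bottom.
- move=> p; rewrite -sE; have := @slide_bottom R u Z V W (- k) p.
  by rewrite nE; exact.
- move=> p pr; rewrite /q' clamp_rect_id // /slide /g /=.
  have [r1|r1] := ltP (sector_rho l p) 1; last by rewrite subr_le0 r1.
  by rewrite subr_le0 leNgt r1 /= clamp_id // sector_rho_ge0 ltW.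
- move=> p p' pp; have := slide_glue uV uZ uW n0 0 pp.
  by rewrite addr0.
(* Since [- k = size Z / n - 1], the inverse is the slide for the exchanged word, up to a full
   turn. *)
- move=> p p' pp; have := slide_glue uZ uV uW n0' (-1) pp.
  rewrite nE; have -> : (size Z)%:R / n + (-1)%:~R = - k.
    by rewrite /k /n natrD; field; rewrite -natrD gt_eqF.
  exact.
- move=> p; rewrite -sE; have := slideK uZ uV uW n0' k (p := p).
  by rewrite nE; exact.
- move=> p pr; have := slideK uV uZ uW n0 (- k) pr.
  by rewrite opprK; exact.
Qed.

End Moves.

(** * Cutting a pair of sides in two *)

Section Subdivision.
Context {R : realType}.

(** It shrinks [[0, 2]] and [[3, 5]] to unit length, so the sides [a c] and [c a] of [w'] become the
    two sides [a] of [w]. The order is reversed in the second because gluing reverses directions. *)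
Let phi (s : R) : R := s - Num.min s 2 / 2 - Num.min (Num.max (s - 3) 0) 2 / 2.

Let phi1 s : s <= 2 -> phi s = s / 2.
Proof. by move=> s2; rewrite /phi min_l // (@max_r _ _ _ 0) ?min_l; lra. Qed.

Let phi2 s : 2 <= s <= 3 -> phi s = s - 1.
Proof. by move=> s2; rewrite /phi min_r ?(@max_r _ _ _ 0) ?min_l; lra. Qed.

Let phi3 s : 3 <= s <= 5 -> phi s = (s + 1) / 2.
Proof. by move=> s2; rewrite /phi min_r ?(@max_l _ _ _ 0) ?min_l; lra. Qed.

Let phi4 s : 5 <= s -> phi s = s - 2.
Proof. by move=> s2; rewrite /phi min_r ?(@max_l _ _ _ 0) ?min_r; lra. Qed.

Let psi (s : R) : R :=
  if s <= 1 then 2 * s else if s <= 2 then s + 1 else if s <= 3 then 2 * s - 1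
  else s + 2.

Let psi1 s : s <= 1 -> psi s = 2 * s.
Proof. by rewrite /psi => ->. Qed.

Let psi2 s : 1 <= s <= 2 -> psi s = s + 1.
Proof.
move=> s12; rewrite /psi; case: (leP s 1) => h1; first by lra.
by case: (leP s 2) => h2; lra.
Qed.

Let psi3 s : 2 <= s <= 3 -> psi s = 2 * s - 1.
Proof.
move=> s12; rewrite /psi; case: (leP s 1) => h1; first by lra.
by case: (leP s 2) => h2; [lra|case: (leP s 3) => h3; lra].
Qed.

Let psi4 s : 3 <= s -> psi s = s + 2.
Proof.
move=> s12; rewrite /psi; case: (leP s 1) => h1; first by lra.
by case: (leP s 2) => h2; [lra|case: (leP s 3) => h3; lra].
Qed.

Let phiK s : psi (phi s) = s.
Proof.
have [h1|h1] := leP s 2; first by rewrite phi1 // psi1; lra.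
have [h2|h2] := leP s 3; first by rewrite phi2 ?psi2; lra.
have [h3|h3] := leP s 5; first by rewrite phi3 ?psi3; lra.
by rewrite phi4 ?psi4; lra.
Qed.

Let psiK s : phi (psi s) = s.
Proof.
have [h1|h1] := leP s 1; first by rewrite psi1 // phi1; lra.
have [h2|h2] := leP s 2; first by rewrite psi2 ?phi2; lra.
have [h3|h3] := leP s 3; first by rewrite psi3 ?phi3; lra.
by rewrite psi4 ?phi4; lra.
Qed.

Variables (a b c : nat) (U : seq nat).
Hypotheses (ab : a <> b) (ac : a <> c) (bc : b <> c).
Hypotheses (aU : a \notin U) (bU : b \notin U) (cU : c \notin U).

Let w := [:: a, b, a, b & U].
Let w' := [:: a, c, b, c, a, b & U].

Let n4 k : k.+4%:R = k%:R + 4 :> R.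
Proof. by rewrite -addn4 natrD. Qed.

Let n6 k : k.+4.+2%:R = k%:R + 6 :> R.
Proof. by rewrite -addn2 natrD n4; ring. Qed.

Let notin (x : nat) i : x \notin U -> (i < size U)%N -> nth 0%N U i <> x.
Proof. by move=> xU iU E; move: xU; rewrite -E mem_nth. Qed.

Let sides_w i j : (i < size w)%N -> (j < size w)%N -> i <> j ->
  nth 0%N w i = nth 0%N w j ->
  (i, j) \in [:: (0, 2); (2, 0); (1, 3); (3, 1)]%N \/
  exists i' j', [/\ i = i'.+4, j = j'.+4 & [/\ (i' < size U)%N, (j' < size U)%N,
    i' <> j' & nth 0%N U i' = nth 0%N U j']].
Proof.
case: i => [|[|[|[|i]]]]; case: j => [|[|[|[|j]]]] //= iw jw ij; try by left.
all: try by move=> E; exfalso; congruence.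
all: try by move=> /esym E; exfalso; move: E; apply: notin.
all: try by move=> E; exfalso; move: E; apply: notin.
by move=> E; right; exists i, j; split=> //; split=> //; congruence.
Qed.

Let sides_w' i j : (i < size w')%N -> (j < size w')%N -> i <> j ->
  nth 0%N w' i = nth 0%N w' j ->
  (i, j) \in [:: (0, 4); (4, 0); (1, 3); (3, 1); (2, 5); (5, 2)]%N \/
  exists i' j', [/\ i = i'.+4.+2, j = j'.+4.+2 & [/\ (i' < size U)%N,
    (j' < size U)%N, i' <> j' & nth 0%N U i' = nth 0%N U j']].
Proof.
case: i => [|[|[|[|[|[|i]]]]]]; case: j => [|[|[|[|[|[|j]]]]]] //= iw jw ij;
  try by left.
all: try by move=> E; exfalso; congruence.
all: try by move=> /esym E; exfalso; move: E; apply: notin.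
all: try by move=> E; exfalso; move: E; apply: notin.
by move=> E; right; exists i, j; split=> //; split=> //; congruence.
Qed.

Let glued_w (i j : nat) (x y : R) : (i < size w)%N -> (j < size w)%N ->
  i <> j ->
  nth 0%N w i = nth 0%N w j -> i%:R <= x <= i%:R + 1 ->
    x + y = i%:R + j%:R + 1 ->
  glued w (x, 0) (y, 0).
Proof.
move=> iw jw ij wij xi xy.
have -> : x = i%:R + (x - i%:R) by ring.
have -> : y = j%:R + (1 - (x - i%:R)) by lra.
by apply: glued_side => //; apply/andP; split; lra.
Qed.

Let glued_w' (i j : nat) (x y : R) : (i < size w')%N -> (j < size w')%N ->
  i <> j -> nth 0%N w' i = nth 0%N w' j -> i%:R <= x <= i%:R + 1 ->
  x + y = i%:R + j%:R + 1 -> glued w' (x, 0) (y, 0).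
Proof.
move=> iw jw ij wij xi xy.
have -> : x = i%:R + (x - i%:R) by ring.
have -> : y = j%:R + (1 - (x - i%:R)) by lra.
by apply: glued_side => //; apply/andP; split; lra.
Qed.

Let phi_glue p p' : glue w' p p' -> glued w (phi p.1, p.2) (phi p'.1, p'.2).
Proof.
case=> [[y y01 [-> ->]] /=|[i [j [t [iw jw ij wij [t01 [-> ->]]]]]] /=].
  have -> : phi 0 = 0 by rewrite phi1 ?mul0r.
  have -> : phi (size U).+4.+2%:R = (size w)%:R.
    rewrite phi4 ?ler_nat // -[(size U).+4.+2]addn2 natrD addrK //.
  exact: glued_edge.
have [|[i' [j' [-> -> [iU jU ij' Uij]]]]] := sides_w' iw jw ij wij.
  have t0 : 0 <= t by case/andP: t01.
  have t1 : t <= 1 by case/andP: t01.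
  rewrite !inE => /orP[|/orP[|/orP[|/orP[|/orP[|]]]]] /eqP[-> ->].
  - rewrite phi1 ?phi3; [|lra|lra].
    by apply: (@glued_w 0 2) => //; lra.
  - rewrite phi3 ?phi1; [|lra|lra].
    by apply: (@glued_w 2 0) => //; lra.
  - rewrite phi1 ?phi3; [|lra|lra].
    by apply: (@glued_w 0 2) => //; lra.
  - rewrite phi3 ?phi1; [|lra|lra].
    by apply: (@glued_w 2 0) => //; lra.
  - rewrite phi2 ?phi4; [|lra|lra].
    by apply: (@glued_w 1 3) => //; lra.
  - rewrite phi4 ?phi2; [|lra|lra].
    by apply: (@glued_w 3 1) => //; lra.
have i0 : 0 <= i'%:R :> R by [].
have j0 : 0 <= j'%:R :> R by [].
have t0 : 0 <= t by case/andP: t01.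
have t1 : t <= 1 by case/andP: t01.
rewrite (n6 i') (n6 j') phi4 ?phi4; [|lra|lra].
apply: (@glued_w i'.+4 j'.+4); rewrite ?(n4 i') ?(n4 j');
  [exact: iU|exact: jU|congruence|exact: Uij| |lra].
by apply/andP; split; lra.
Qed.

Let psi_glue p p' : glue w p p' -> glued w' (psi p.1, p.2) (psi p'.1, p'.2).
Proof.
case=> [[y y01 [-> ->]] /=|[i [j [t [iw jw ij wij [t01 [-> ->]]]]]] /=].
  have -> : psi 0 = 0 by rewrite psi1 ?mulr0.
  have -> : psi (size U).+4%:R = (size w')%:R.
    by rewrite psi4 ?ler_nat // /= (n6 (size U)) (n4 (size U)); ring.
  exact: glued_edge.
have t0 : 0 <= t by case/andP: t01.
have t1 : t <= 1 by case/andP: t01.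
have [|[i' [j' [-> -> [iU jU ij' Uij]]]]] := sides_w iw jw ij wij.
  rewrite !inE => /orP[|/orP[|/orP[|]]] /eqP[-> ->].
  - have [h|h] := leP t 2^-1.
      rewrite psi1 ?psi3; [|lra|lra].
      by apply: (@glued_w' 0 4) => //; lra.
    rewrite psi1 ?psi3; [|lra|lra].
    by apply: (@glued_w' 1 3) => //; lra.
  - have [h|h] := leP t 2^-1.
      rewrite psi3 ?psi1; [|lra|lra].
      by apply: (@glued_w' 3 1) => //; lra.
    rewrite psi3 ?psi1; [|lra|lra].
    by apply: (@glued_w' 4 0) => //; lra.
  - rewrite psi2 ?psi4; [|lra|lra].
    by apply: (@glued_w' 2 5) => //; lra.
  - rewrite psi4 ?psi2; [|lra|lra].
    by apply: (@glued_w' 5 2) => //; lra.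
have i0 : 0 <= i'%:R :> R by [].
have j0 : 0 <= j'%:R :> R by [].
rewrite (n4 i') (n4 j') psi4 ?psi4; [|lra|lra].
apply: (@glued_w' i'.+4.+2 j'.+4.+2); rewrite ?(n6 i') ?(n6 j');
  [exact: iU|exact: jU|congruence|exact: Uij| |lra].
by apply/andP; split; lra.
Qed.

Lemma presentable_subdivide (F : topologicalType) (S C : set F) :
  presentable (R := R) S C w -> presentable (R := R) S C w'.
Proof.
case=> q qP; have [cq _ _ _] := qP.
exists (fun p => q (phi p.1, p.2)).
have U0 : 0 <= (size U)%:R :> R by [].
apply: (presents_transfer (m := fun p => (phi p.1, p.2))
  (m' := fun p => (psi p.1, p.2)) qP) => //.
- by rewrite /phi; continuity.
- move=> [x y] [/= /andP[x0 x1] y01]; split=> //=; move: x1;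
  rewrite (n6 (size U)) (n4 (size U)) => x1.
  have [h1|h1] := leP x 2; first by rewrite phi1 //; lra.
  have [h2|h2] := leP x 3; first by rewrite phi2; lra.
  have [h3|h3] := leP x 5; first by rewrite phi3; lra.
  by rewrite phi4; lra.
- move=> [x y] [/= /andP[x0 x1] y01]; split=> //=; move: x1;
  rewrite (n6 (size U)) (n4 (size U)) => x1.
  have [h1|h1] := leP x 1; first by rewrite psi1 //; lra.
  have [h2|h2] := leP x 2; first by rewrite psi2; lra.
  have [h3|h3] := leP x 3; first by rewrite psi3; lra.
  by rewrite psi4; lra.
- by move=> [x y] _ /=; rewrite phiK; exact: glued_refl.
- by move=> [x y] _ /=; rewrite psiK; exact: glued_refl.
Qed.

End Subdivision.

(** * Gluing opposite sides *)

Section Handles.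

(** A product of [g] commutators, a letter standing for a side and for its inverse alike. Starting
    from [b = 1] leaves the letter 0 free for a subdivision. *)
Fixpoint handles (b g : nat) : seq nat :=
  if g is g'.+1 then [:: b, b.+1, b, b.+1 & handles b.+2 g'] else [::].

Lemma size_handles b g : size (handles b g) = (4 * g)%N.
Proof. by elim: g b => [|g IHg] b //=; rewrite IHg mulnS. Qed.

Lemma mem_handles x b g : x \in handles b g -> (b <= x)%N.
Proof.
elim: g b => [|g IHg] b //=; rewrite !inE.
by do 4!(case/orP=> [/eqP ->|]; first by lia); move=> /IHg; lia.
Qed.

Lemma nth_handles b g i r : (i < g)%N -> (r < 4)%N ->
  nth 0%N (handles b g) (4 * i + r) = (b + 2 * i + odd r)%N.
Proof.
elim: g b i => [|g IHg] b [|i] //.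
  by case: r {IHg} => [|[|[|[|]]]] // _ _ /=; lia.
rewrite ltnS => ig r4; rewrite (_ : 4 * i.+1 + r = (4 * i + r).+4)%N;
  last by lia.
by rewrite /= IHg //; lia.
Qed.

Variable P : seq nat -> Prop.
Hypothesis Prot : forall w1 w2, P (w1 ++ w2) -> P (w2 ++ w1).
Hypothesis Pslide : forall u V Z W, u \notin V -> u \notin Z -> u \notin W ->
  P (u :: V ++ Z ++ u :: W) -> P (u :: Z ++ V ++ u :: W).
Hypothesis Psub : forall a b c U, a <> b -> a <> c -> b <> c ->
  a \notin U -> b \notin U -> c \notin U ->
  P [:: a, b, a, b & U] -> P [:: a, c, b, c, a, b & U].

Section OneHandle.
Variables (a b : nat) (X Y : seq nat).
Hypotheses (ab : a != b) (aX : a \notin X) (aY : a \notin Y).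
Hypotheses (bX : b \notin X) (bY : b \notin Y).

Let aba : a \notin [:: b]. Proof. by rewrite inE. Qed.
Let bab : b \notin [:: a]. Proof. by rewrite inE eq_sym. Qed.
Let abY : a \notin b :: Y. Proof. by rewrite inE negb_or ab. Qed.
Let bYa : b \notin Y ++ [:: a]. Proof. by rewrite mem_cat negb_or bY. Qed.

(** Two slides, along [b] and then along [a]: up to rotation, [a b X a b Y] becomes [b a X b Y a],
    then [a b Y X a b]. *)
Lemma handle_gather :
  P ([:: a, b & X] ++ [:: a, b & Y]) -> P ([:: a, b, a, b & Y] ++ X).
Proof.
move=> P0; have P1 : P (b :: X ++ [:: a] ++ b :: Y ++ [:: a]).
  by have := @Prot [:: a] (b :: X ++ [:: a, b & Y]) P0; rewrite /= -catA.
have P2 : P (a :: X ++ (b :: Y) ++ a :: [:: b]).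
  have := @Prot [:: b] ([:: a] ++ X ++ b :: Y ++ [:: a]) (Pslide bX bab bYa P1).
  by rewrite /= -!catA /= -catA.
have := @Prot (a :: (b :: Y) ++ X) [:: a; b].
by rewrite /= -catA; apply; exact: (Pslide aX abY aba P2).
Qed.

Lemma handle_spread :
  P ([:: a, b, a, b & Y] ++ X) -> P ([:: a, b & X] ++ [:: a, b & Y]).
Proof.
move=> P0; have P1 : P (a :: (b :: Y) ++ X ++ a :: [:: b]).
  by have := @Prot [:: a; b] ([:: a, b & Y] ++ X) P0; rewrite /= -catA.
have P2 : P (b :: [:: a] ++ X ++ b :: (Y ++ [:: a])).
  have := @Prot (a :: X ++ (b :: Y) ++ [:: a]) [:: b].
  rewrite /= -!catA /= -catA; apply.
  exact: (Pslide abY aX aba P1).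
have := @Prot (b :: X ++ [:: a, b & Y]) [:: a].
by rewrite /= -catA; apply; exact: (Pslide bab bX bYa P2).
Qed.

End OneHandle.

(** A commutator can be moved past a block: once spread as [a b U a b V], the word is symmetric in
    [U] and [V] up to rotation. *)
Lemma handle_swap a b V U : a != b -> a \notin V -> a \notin U ->
  b \notin V -> b \notin U ->
  P ([:: a, b, a, b & V] ++ U) -> P ([:: a, b, a, b & U] ++ V).
Proof.
move=> ab aV aU bV bU /(handle_spread ab aU aV bU bV).
by move=> /Prot /(handle_gather ab aV aU bV bU).
Qed.

(** The doubled block absorbs one handle at a time: with [a], [b] the letters of the handle,
    [X X a b a b U] is rotated and swapped into [a b a b X U X], then spread into
    [(a b X) (a b X) U]. *)
Lemma handles_opposite g b X : uniq X -> (forall x, x \in X -> (x < b)%N) ->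
  P (X ++ X ++ handles b g) ->
  exists s, [/\ uniq s, size s = (size X + 2 * g)%N & P (s ++ s)].
Proof.
elim: g b X => [|g IHg] b X uX Xb /= PX.
  by exists X; split=> //; [rewrite addn0|rewrite cats0 in PX].
set U := handles b.+2 g in PX.
have bU : b \notin U by apply/negP => /mem_handles; lia.
have b1U : b.+1 \notin U by apply/negP => /mem_handles; lia.
have bX : b \notin X by apply/negP => /Xb; lia.
have b1X : b.+1 \notin X by apply/negP => /Xb; lia.
have bb1 : b != b.+1 by lia.
have [|||s [us ss Ps]] := IHg b.+2 [:: b, b.+1 & X].
- by rewrite /= inE negb_or bb1 bX b1X.
- by move=> x; rewrite !inE => /orP[/eqP->|/orP[/eqP->|/Xb]]; lia.
- move: PX; rewrite catA => /Prot /=.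
  rewrite catA => /(@handle_swap b b.+1 (U ++ X) X bb1).
  rewrite !mem_cat !negb_or bU bX b1U b1X => /(_ isT isT isT isT).
  rewrite /= catA => /(@handle_spread b b.+1 X (X ++ U) bb1).
  by rewrite !mem_cat !negb_or bU bX b1U b1X => /(_ isT isT isT isT).
- by exists s; split=> //; rewrite ss /=; lia.
Qed.

Lemma handles_even g : P (handles 1 g) ->
  exists s, [/\ uniq s, size s = (2 * g)%N & P (s ++ s)].
Proof. by move=> Pg; exact: (@handles_opposite g 1 [::]). Qed.

Lemma handles_odd g : (0 < g)%N -> P (handles 1 g) ->
  exists s, [/\ uniq s, size s = (2 * g + 1)%N & P (s ++ s)].
Proof.
case: g => // g _ Pg; rewrite addnC.
apply: (@handles_opposite g.+1 1 [:: 0%N]) => //; first by move=> x;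
  rewrite inE => /eqP ->.
move: Pg => /=; set U := handles 3 g.
have nU x : (x < 3)%N -> x \notin U by move=> x3; apply/negP => /mem_handles;
  lia.
(* The extra letter 0 comes from cutting the side 1: [1 0 2 0 1 2 U] slides to [1 2 0 0 1 2 U], and
   gathering the handle leaves the doubled block [0 0] from which the induction starts. *)
move=> /(@Psub 1 2 0 U); rewrite !nU // => PU.
have {}PU : P ([:: 1, 2 & [:: 0; 0]] ++ [:: 1, 2 & U])%N.
  apply: (@Pslide 1 [:: 0] [:: 2; 0] (2 :: U))%N => //=.
    by rewrite inE negb_or nU.
  by apply: PU.
have /Prot := @handle_gather 1 2 [:: 0;
  0]%N U isT isT (nU 1%N isT) isT (nU 2%N isT) PU.
by [].
Qed.

End Handles.

(** * Rotational symmetry of a polygon with opposite sides glued *)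

Section OppositeSides.
Context {R : realType} (F : closed_oriented_surface R).
Variables (S C : set F) (s : seq nat).
Hypotheses (us : uniq s) (s0 : (0 < size s)%N).

Local Notation n := (size s).
Local Notation N := (n + n)%N.
Let w := s ++ s.

Let sw : size w = N. Proof. exact: size_cat. Qed.
Let N0 : 0 < N%:R :> R. Proof. by rewrite ltr0n addn_gt0 s0. Qed.
Let Nn0 : N%:R != 0 :> R. Proof. by rewrite gt_eqF. Qed.

Let nth_w i : (i < N)%N -> nth 0%N w i = nth 0%N s (i %% n).
Proof.
move=> iN; rewrite nth_cat; case: ltnP => ni; first by rewrite modn_small.
by rewrite -{2}(subnK ni) modnDr modn_small //; lia.
Qed.

Let nth_wE i j : (i < N)%N -> (j < N)%N ->
  (nth 0%N w i == nth 0%N w j) = (i == j %[mod n]).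
Proof. by move=> iN jN; rewrite !nth_w // nth_uniq // ltn_mod. Qed.

(** Gluing preserves [y], and above the polygon boundary it only closes the rectangle into an
    annulus; this gives the injectivity asked of a spinnable piece. *)
Let glued_inv (p p' : plane R) : glued w p p' ->
  p.2 = p'.2 /\ (0 < p.2 -> exists c : int, p.1 - p'.1 = c%:~R * N%:R).
Proof.
elim=> {p p'} [p p' [[y _ [-> ->]]|]|p|p p' _ [E h]|p p' p'' _ [E h] _ [E' h']].
- split=> //= _; exists (-1); rewrite sw; ring.
- move=> [i [j [t [_ _ _ _ [_ [-> ->]]]]]]; split=> //=.
  by rewrite ltxx.
- by split=> // _; exists 0; rewrite subrr mul0r.
- split=> // ; rewrite -E => /h[c cE]; exists (- c).
  by rewrite mulrNz mulNr -cE opprB.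
- split; first by rewrite E.
  move=> p0; have [c cE] := h p0;
    have [c' cE'] : exists c, p'.1 - p''.1 = c%:~R * N%:R.
    by apply: h'; rewrite -E.
  by exists (c + c'); rewrite intrD mulrDl -cE -cE'; ring.
Qed.

(** As [s] has no repetition, two sides have the same letter exactly when their indices agree modulo
    [n], a relation which shifts preserve. The map [Q] is [q] with abscissas divided by [N]; it
    covers [S], so nothing is left to adhere. *)
Lemma opposite_spinnable : presentable (R := R) S C w ->
  exists2 Q, spinnable S N Q & [set Q (t, 1) | t in setT] = C.
Proof.
case=> q [cq qS qC qG]; rewrite sw in qS qC qG.
pose g (p : plane R) := q (N%:R * p.1, clamp p.2).
have c01 (y : R) : 0 <= clamp y <= 1 by rewrite clamp_ge0 clamp_le1.
have cg : continuous g.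
  have cc : continuous (fun p : plane R => clamp p.2).
    by apply: continuous_comp1 clamp_continuous; continuity.
  by rewrite /g; continuity.
have edge (y : R) : 0 <= y <= 1 -> q (0, y) = q (N%:R, y).
  move=> y01; apply/qG; [by rewrite /rect /= lexx ltW|by rewrite /rect /= lexx
    ltW|].
  by rewrite -sw; exact: glued_edge.
have g01 y : g (0, y) = g (1, y) by rewrite /g /= mulr0 mulr1; exact: edge.
pose Q (p : plane R) := g (frac p.1, p.2).
have cQ : continuous Q by exact: periodic_continuous.
have Qz (t y : R) (c : int) : Q (t + c%:~R, y) = Q (t, y)
  by rewrite /Q /= fracDz.
have frect (t y : R) : 0 <= y <= 1 -> rect N (N%:R * frac t, y).
  move=> y01; split=> //=; apply/andP; split.
    by rewrite mulr_ge0 ?frac_ge0 // ltW.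
  by rewrite ler_piMr ?(ltW (frac_lt1 _)) // ltW.
have QE (x y : R) : rect N (x, y) -> Q (x / N%:R, y) = q (x, y).
  move=> [/= x0 y01]; rewrite /Q /g /= clamp_id //.
  have [->|xN] := eqVneq x N%:R.
    by rewrite divff // -edge // (@frac_unique _ _ 0 1) ?lexx ?ltr01 ?add0r
      ?mulr0.
  rewrite frac_id; first by rewrite mulrC divfK.
  have /andP[x1 x2] := x0; rewrite divr_ge0 //= ?ltW //.
  by rewrite ltr_pdivrMr // mul1r lt_neqAle xN.
have QS (t y : R) : 0 <= y <= 1 -> S (Q (t, y)).
  move=> y01; rewrite -qS /Q /g /= clamp_id //; exists (N%:R * frac t, y) => //.
  exact: frect.
have Qband : S `\` Q @` band = set0.
  rewrite -subset0 => x [Sx]; apply; move: Sx; rewrite -qS => -[[x' y] xr <-].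
  by exists (x' / N%:R, y); [case: xr|exact: QE].
have Qglued (t t' y y' : R) : 0 <= y <= 1 -> 0 <= y' <= 1 ->
  Q (t, y) = Q (t', y') ->
    glued w (N%:R * frac t, y) (N%:R * frac t', y').
  move=> y01 y01'; rewrite /Q /g /= !clamp_id //.
  by move=> /qG - /(_ (frect _ _ y01) (frect _ _ y01')).
have rot (p p' : plane R) : glued w p p' -> p.2 = 0 -> forall k : nat,
    Q ((p.1 + k%:R) / N%:R, 0) = Q ((p'.1 + k%:R) / N%:R, 0).
  elim=> {p p'} [p p' [[y _ [-> ->]]|[i [j [t [iw jw ij wij [t01 [-> ->]]]]]]]
    |p|p p' pp h|p p' p'' pp h _ h'] p0 k //=.
  - rewrite sw add0r [N%:R + _]addrC mulrDl divff //.
    by rewrite (Qz _ _ 1).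
  - rewrite sw in iw jw.
    have bnd (a : nat) (x : R) : 0 <= x <= 1 ->
      rect N (((a + k) %% N)%:R + x, 0).
      move=> /andP[x0 x1]; split=> /=; last by rewrite lexx ler01.
      have : ((a + k) %% N)%:R + 1 <= N%:R :> R.
        by rewrite natr1 ler_nat ltn_mod addn_gt0 s0.
      rewrite addr_ge0 //= => /(le_trans _); apply; by rewrite lerD2l.
    have QM (a : nat) (x : R) : 0 <= x <= 1 ->
        Q ((a%:R + x + k%:R) / N%:R, 0) = q (((a + k) %% N)%:R + x, 0).
      move=> x01; have aE : a%:R + k%:R =
          ((a + k) %/ N)%:R * N%:R + ((a + k) %% N)%:R :> R.
        by rewrite -natrM -!natrD -divn_eq.
      have -> : (a%:R + x + k%:R) / N%:R =
          (((a + k) %% N)%:R + x) / N%:R + ((a + k) %/ N)%:Z%:~R.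
        have -> : a%:R + x + k%:R = a%:R + k%:R + x by ring.
        rewrite aE [_%:~R](_ : _ = ((a + k) %/ N)%:R) //.
        by field; rewrite -natrD.
      by rewrite Qz QE //; exact: bnd.
    have t01' : 0 <= 1 - t <= 1 by rewrite subr_ge0 lerBlDr lerDl andbC.
    rewrite !QM //; apply/qG.
    + exact: bnd.
    + exact: bnd.
    apply: glued_side => //; rewrite ?sw ?ltn_mod ?addn_gt0 ?s0 //.
      move=> /eqP; rewrite eqn_modDr !modn_small // => /eqP; exact: ij.
    apply/eqP; rewrite nth_wE ?ltn_mod ?addn_gt0 ?s0 //.
    have nN : (n %| N)%N by rewrite dvdn_addr.
    by rewrite !modn_dvdm // eqn_modDr -nth_wE //; apply/eqP.
  - by apply/esym/h; have [-> _] := glued_inv pp.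
  - by rewrite h // h' //; have [<- _] := glued_inv pp.
(* By periodicity, a shift by any integer number of sides reduces to its remainder modulo [N], a
   natural number. *)
have rotz p p' (k : int) : glued w p p' -> p.2 = 0 ->
    Q (p.1 / N%:R + k%:~R / N%:R, 0) = Q (p'.1 / N%:R + k%:~R / N%:R, 0).
  move=> pp p0; pose m := `|(k %% N)%Z|%N.
  have kE : k = (k %/ N)%Z * N + m.
    by rewrite {1}(divz_eq k N) gez0_abs // modz_ge0 // eqz_nat -lt0n addn_gt0
      s0.
  have E (x : R) : x / N%:R + k%:~R / N%:R = (x + m%:R) / N%:R + (k %/ N)%Z%:~R.
    rewrite {1}kE intrD intrM [N%:Z%:~R](_ : _ = N%:R) // [m%:Z%:~R](_ :
      _ = m%:R) //.
    by field; rewrite -natrD.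
  by rewrite !E !Qz; exact: rot.
exists Q.
- split=> //.
  + by rewrite addn_gt0 s0.
  + rewrite -qS; apply: (compact_closed (surface_hausdorff (c := F))).
    apply: continuous_compact; first exact: continuous_subspaceT.
    rewrite (_ : rect N = `[0, N%:R]%classic `*` `[0, 1]%classic).
      by apply: compact_setX; exact: segment_compact.
    by rewrite eqEsubset; split=> -[x y]; rewrite /rect /= !in_itv /=.
  + by move=> t y; exact: (Qz t y 1).
  + move=> t t' y y' y01 y01' /(Qglued _ _ _ _ y01 y01') /glued_inv /= [yy h].
    split=> // /h[c cE].
    have {}cE : frac t - frac t' = c%:~R.
      by apply: (mulIf Nn0); rewrite -cE; ring.
    have -> : t - t' = c%:~R + (Num.floor t - Num.floor t')%:~R.
      by rewrite -cE intrB /frac; ring.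
    by rewrite rpredD ?intr_int.
  + move=> t t' k; have z01 : 0 <= (0 : R) <= 1 by rewrite lexx ler01.
    move=> /(Qglued _ _ _ _ z01 z01) /rotz - /(_ k erefl) /=.
    have E (x : R) : Q (x + k%:~R / N%:R, 0) =
        Q (N%:R * frac x / N%:R + k%:~R / N%:R, 0).
      rewrite -[RHS](Qz _ _ (Num.floor x)); congr (Q (_, _)).
      by rewrite /frac; field; rewrite -natrD.
    by rewrite (E t) (E t').
  + by move=> t y k _; rewrite Qband closure0.
- rewrite -qC eqEsubset; split.
  + move=> _ [t _ <-]; exists (N%:R * frac t, 1);
    last by rewrite /Q /g /= clamp_id ?ler01 ?lexx.
    by split=> //; apply: frect; rewrite lexx ler01.
  + move=> _ [[x y] [xr /= y1] <-]; exists (x / N%:R) => //.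
    by rewrite -QE // y1.
Qed.

End OppositeSides.

(** * The standard polygon *)

Section RoundPolygon.
Context {R : realType}.

Lemma cos_eq1 (d : R) : `|d| <= 2 * pi -> cos d = 1 -> d = 0 \/ `|d| = 2 * pi.
Proof.
have p0 := pi_gt0 R; rewrite -[cos d]cos_norm => d2 d1.
have in0 : 0 \in `[0, pi : R] by rewrite in_itv /= lexx ltW.
have n0 := normr_ge0 d; have [dpi|dpi] := leP `|d| pi.
  left; apply/normr0_eq0/cos_inj; rewrite ?cos0 //.
  by rewrite in_itv /= n0.
right; have E : 2 * pi - `|d| = 0; last by lra.
apply: cos_inj; rewrite ?cos0 //; first by rewrite in_itv /=; lra.
have -> : 2 * pi - `|d| = - `|d| + pi *+ 2 by rewrite mulr2n; ring.
by rewrite cosD2pi cosN.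
Qed.

Lemma unit_circle_angle (a b : R) : a ^+ 2 + b ^+ 2 = 1 ->
  exists2 t, 0 <= t <= 2 * pi & cos t = a /\ sin t = b.
Proof.
move=> ab; have p0 := pi_gt0 R.
have a1 : -1 <= a <= 1.
  have b2 := sqr_ge0 b; rewrite !expr2 in ab b2.
  by apply/andP; split; nra.
have ca : cos (acos a) = a by rewrite acosK.
have sa : sin (acos a) = `|b|.
  by rewrite sin_acos // -ab addrC addKr sqrtr_sqr.
have [t0 tpi] := (acos_ge0 a1, acos_lepi a1).
have [b0|b0] := leP 0 b.
  exists (acos a); first by apply/andP; split; lra.
  by rewrite sa ger0_norm.
exists (- acos a + pi *+ 2); first by rewrite mulr2n; apply/andP; split; lra.
by rewrite cosD2pi sinD2pi cosN sinN sa ltr0_norm // opprK.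
Qed.

Variable N : nat.
Hypothesis N0 : (0 < N)%N.

Let NR0 : 0 < N%:R :> R. Proof. by rewrite ltr0n. Qed.

(** The radius decreases from 1 at [y = 0], the sides of the polygon, to [1 / 2] at [y = 1], the
    boundary of the removed disk. *)
Definition polar (p : plane R) : plane R :=
  ((1 - p.2 / 2) * cos (2 * pi * p.1 / N%:R),
   (1 - p.2 / 2) * sin (2 * pi * p.1 / N%:R)).

Lemma polar_continuous : continuous polar.
Proof. by rewrite /polar; continuity. Qed.

Lemma polar_sqr p : (polar p).1 ^+ 2 + (polar p).2 ^+ 2 = (1 - p.2 / 2) ^+ 2.
Proof. by rewrite !exprMn -mulrDr cos2Dsin2 mulr1. Qed.

Lemma polar_annulus p : rect N p -> annulus 2^-1 (polar p).
Proof.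
move=> [_ p2]; rewrite /annulus /= polar_sqr; apply/andP; split; nra.
Qed.

Lemma polar_surj p : annulus 2^-1 p -> exists2 u, rect N u & polar u = p.
Proof.
case: p => x y; rewrite /annulus /= => /andP[xy1 xy2].
pose r := Num.sqrt (x ^+ 2 + y ^+ 2).
have r0 : 0 <= r by exact: sqrtr_ge0.
have rE : r ^+ 2 = x ^+ 2 + y ^+ 2
  by rewrite sqr_sqrtr // (le_trans _ xy1) // sqr_ge0.
have rlo : 2^-1 <= r by rewrite -(@ler_pXn2r _ 2) ?nnegrE // ?rE // invr_ge0.
have rhi : r <= 1 by rewrite -(@ler_pXn2r _ 2) ?nnegrE // rE expr1n.
have rn0 : r != 0 by rewrite gt_eqF //; lra.
have [t t01 [ct st]] : exists2 t, 0 <= t <= 2 * pi & cos t = x / r /\ sin t =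
  y / r.
  by apply: unit_circle_angle;
    rewrite !exprMn -mulrDl -rE -exprMn divff // expr1n.
have p0 := pi_gt0 R; have pn0 : pi != 0 :> R by rewrite gt_eqF.
have Nn0 : N%:R != 0 :> R by rewrite gt_eqF.
exists (t * N%:R / (2 * pi), 2 * (1 - r)).
  split=> /=; last by apply/andP; split; lra.
  case/andP: t01 => t0 t1; rewrite divr_ge0 ?mulr_ge0 ?(ltW p0) //=.
  by rewrite ler_pdivrMr ?mulr_gt0 // mulrC ler_pM2l.
rewrite /polar /=.
have -> : 2 * pi * (t * N%:R / (2 * pi)) / N%:R = t.
  have E (a b : R) : a != 0 -> b != 0 -> 2 * a * (t * b / (2 * a)) / b = t.
    by move=> a0 b0; field; rewrite a0 b0.
  exact: E.
have -> : 1 - 2 * (1 - r) / 2 = r by field.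
by rewrite ct st; congr pair; field.
Qed.

Lemma polar_inj p p' : rect N p -> rect N p' -> polar p = polar p' ->
  p.2 = p'.2 /\ (p.1 = p'.1 \/ `|p.1 - p'.1| = N%:R).
Proof.
move=> [p1 p2] [p1' p2'] E.
have r0 : 0 < 1 - p.2 / 2 by case/andP: p2; lra.
have r0' : 0 < 1 - p'.2 / 2 by case/andP: p2'; lra.
have E2 : p.2 = p'.2.
  have : (1 - p.2 / 2) ^+ 2 = (1 - p'.2 / 2) ^+ 2 by rewrite -!polar_sqr E.
  by move=> /eqP; rewrite eqrXn2 ?ltW // => /eqP; lra.
split=> //; have p0 := pi_gt0 R.
have : cos (2 * pi * p.1 / N%:R - 2 * pi * p'.1 / N%:R) = 1.
  by move: E => [Ec Es]; exact: (polar_cos r0 r0' Ec Es).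
have -> : 2 * pi * p.1 / N%:R - 2 * pi * p'.1 / N%:R =
    2 * pi / N%:R * (p.1 - p'.1).
  have E' (a b c d : R) : a * c / b - a * d / b = a / b * (c - d) by ring.
  exact: E'.
have c0 : 0 < 2 * pi / N%:R :> R by rewrite divr_gt0 ?mulr_gt0.
have dN : `|p.1 - p'.1| <= N%:R.
  by rewrite ler_norml; case/andP: p1 => ? ?; case/andP: p1' => ? ?;
    apply/andP; split; lra.
have cN : 2 * pi / N%:R * N%:R = 2 * pi :> R by rewrite divfK ?gt_eqF.
have nE : `|2 * pi / N%:R * (p.1 - p'.1)| = 2 * pi / N%:R * `|p.1 - p'.1|.
  by rewrite normrM (gtr0_norm c0).
have le2pi : `|2 * pi / N%:R * (p.1 - p'.1)| <= 2 * pi.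
  by rewrite nE -[leRHS]cN ler_pM2l.
move=> /(cos_eq1 le2pi)[/eqP|].
  by rewrite mulf_eq0 (gt_eqF c0) subr_eq0 /= => /eqP; left.
by rewrite nE -[RHS]cN => /(mulfI (lt0r_neq0 c0)); right.
Qed.

Lemma polar_glued (w : seq nat) p p' : size w = N -> rect N p -> rect N p' ->
  polar p = polar p' -> glued w p p'.
Proof.
move=> wN pr pr' /(polar_inj pr pr').
case: p pr => x y; case: p' pr' => x' y' [/= x'N y'1] [/= xN y1] [<- [->|h]].
  exact: glued_refl.
have [E|E] : x = 0 /\ x' = N%:R \/ x = N%:R /\ x' = 0.
- case/andP: xN => x0 x1; case/andP: x'N => x'0 x'1.
  move: h; case: (leP 0 (x - x')) => d.
    by rewrite ger0_norm // => h; right; split; lra.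
  by rewrite ltr0_norm // => h; left; split; lra.
- by case: E => -> ->; rewrite -wN; exact: glued_edge.
- by case: E => -> ->; rewrite -wN; apply/glued_sym; exact: glued_edge.
Qed.

End RoundPolygon.

Section Subsurface.
Context {R : realType} (F : closed_oriented_surface R).

Lemma side_pairing_glued (g : nat) (x y : plane R) : side_pairing g x y ->
  exists u v : R, [/\ 0 <= u <= (4 * g)%:R, 0 <= v <= (4 * g)%:R,
    x = boundary_point g u, y = boundary_point g v
    & glued (handles 1 g) (u, 0) (v, 0)].
Proof.
move=> [i [s [ig s01 H]]]; have [s0 s1] := andP s01.
have i4 : (4 * i)%:R + 4 <= (4 * g)%:R :> R by rewrite -natrD ler_nat; lia.
have i0 : 0 <= (4 * i)%:R :> R by [].
have side (r r' : nat) : (r < 4)%N -> (r' < 4)%N -> odd r = odd r' -> r <> r' ->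
    glued (handles 1 g) ((4 * i + r)%:R + s, 0) ((4 * i + r')%:R + (1 - s), 0).
  move=> r4 r'4 rr rn.
  apply: glued_side; rewrite ?size_handles //; [lia|lia|lia|].
  by rewrite !nth_handles // rr.
case: H => -[xE yE]; [exists ((4 * i)%:R + s), ((4 * i)%:R + 3 - s)
                     |exists ((4 * i)%:R + 1 + s), ((4 * i)%:R + 4 - s)];
  split=> //; try (apply/andP; split; lra).
- have := side 0%N 2%N isT isT erefl (fun e => ltac:(done));
  rewrite addn0 (natrD _ (4 * i) 2).
  by rewrite (_ : _ + (1 - s) = (4 * i)%:R + 3 - s) //; ring.
- have := side 1%N 3%N isT isT erefl (fun e => ltac:(done)).
  rewrite (natrD _ (4 * i) 1) (natrD _ (4 * i) 3).
  by rewrite (_ : _ + (1 - s) = (4 * i)%:R + 4 - s) //; ring.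
Qed.

Lemma glue_handles (g : nat) p p' : (0 < g)%N -> glue (handles 1 g) p p' ->
  clos_refl_sym_trans _ (@side_pairing R g) (polar (4 * g) p) (polar (4 * g)
    p').
Proof.
move=> g0; have N0 : (4 * g)%:R != 0 :> R
  by rewrite pnatr_eq0 muln_eq0 -lt0n g0.
have bp u : polar (4 * g) (u, 0) = boundary_point g u.
  by rewrite /polar /boundary_point /= mul0r subr0 !mul1r.
case=> [[y y01 [-> ->]]|[i [j [t [ii jj ij Eij [t01 [-> ->]]]]]]].
  rewrite size_handles (_ : polar _ _ = polar (4 * g) ((4 * g)%:R, y)).
    exact: rst_refl.
  rewrite /polar /= mulr0 mul0r mulfK // (_ : 2 * pi = 0 + pi *+ 2).
    by rewrite cosD2pi sinD2pi.
  by rewrite add0r mulr2n; ring.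
rewrite size_handles in ii jj; rewrite !bp.
(* Written as [4 a + r], a side has a letter determined by [a] and the parity of [r], so distinct
   sides with the same letter are the sides 0 and 2, or 1 and 3, of one handle. *)
have [ri rj] : (i %% 4 < 4)%N /\ (j %% 4 < 4)%N by rewrite !ltn_mod.
have [ig jg] : (i %/ 4 < g)%N /\ (j %/ 4 < g)%N
  by rewrite !ltn_divLR // ![(g * 4)%N]mulnC.
have iE := divn_eq i 4; have jE := divn_eq j 4.
rewrite mulnC in iE; rewrite mulnC in jE.
move: (i %/ 4)%N (i %% 4)%N iE ri ig => a r iE r4 ag.
move: (j %/ 4)%N (j %% 4)%N jE rj jg => b r' jE r'4 bg.
subst i j; rewrite !nth_handles // in Eij.
have ab : a = b by move: Eij; case: (odd r); case: (odd r'); lia.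
subst b.
have rr : odd r = odd r' by move: Eij; case: (odd r); case: (odd r'); lia.
have {}ij : r <> r' by move=> E; apply: ij; rewrite E.
have [t0 t1] := andP t01.
have t01' : 0 <= 1 - t <= 1 by apply/andP; split; lra.
have P1 s : 0 <= s <= 1 -> side_pairing g (boundary_point g ((4 * a)%:R + s))
    (boundary_point g ((4 * a)%:R + 3 - s)).
  by move=> s01; exists a, s; split=> //; left.
have P2 s : 0 <= s <= 1 -> side_pairing g (boundary_point g ((4 * a)%:R + 1 +
  s))
    (boundary_point g ((4 * a)%:R + 4 - s)).
  by move=> s01; exists a, s; split=> //; right.
case: r rr ij r4 {ii Eij} => [|[|[|[|r]]]] //;
  case: r' r'4 {jj} => [|[|[|[|r']]]] // _ _ _ _;
  rewrite ?addn0 ?(natrD _ (4 * a) 1) ?(natrD _ (4 * a) 2) ?(natrD _ (4 * a) 3).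
- have -> : (4 * a)%:R + 2 + (1 - t) = (4 * a)%:R + 3 - t by ring.
  exact/rst_step/P1.
- have -> : (4 * a)%:R + 3 + (1 - t) = (4 * a)%:R + 4 - t by ring.
  exact/rst_step/P2.
- have -> : (4 * a)%:R + 2 + t = (4 * a)%:R + 3 - (1 - t) by ring.
  exact/rst_sym/rst_step/P1.
- have -> : (4 * a)%:R + 3 + t = (4 * a)%:R + 4 - (1 - t) by ring.
  exact/rst_sym/rst_step/P2.
Qed.

(** Polar coordinates cut the annulus along a radius. The inverse [m'] chooses a preimage, and the
    choice between the left and right edges does not matter since these are glued. *)
Lemma subsurface_presentable (g : nat) (S C : set F) :
  subsurface_of_genus g S C -> presentable (R := R) S C (handles 1 g).
Proof.
move=> [g0 [q [cq qS qG] qC]]; set w := handles 1 g.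
have wN : size w = (4 * g)%N by exact: size_handles.
have N0 : (0 < 4 * g)%N by rewrite muln_gt0.
pose m := polar (R := R) (4 * g).
pose m' (p : plane R) : plane R :=
  if pselect (annulus 2^-1 p) is left h
  then s2val (cid2 (polar_surj N0 h)) else (0, 0).
have m'P p : annulus 2^-1 p -> rect (4 * g) (m' p) /\ m (m' p) = p.
  by rewrite /m'; case: pselect => // h _; case: cid2.
have mA p : rect (4 * g) p -> annulus 2^-1 (m p) by exact: polar_annulus.
have bA (u : R) : annulus 2^-1 (boundary_point g u).
  rewrite /annulus /boundary_point /= cos2Dsin2 lexx andbT.
  by rewrite expr2; lra.
have bp u : m (u, 0) = boundary_point g u.
  by rewrite /m /polar /boundary_point /= mul0r subr0 !mul1r.
have half (z : R) : 1 - z / 2 = 2^-1 -> z = 1 by lra.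
have half0 (z : R) : z <= 1 -> 0 <= 1 - z / 2 by lra.
pose q' p := q (m (clamp_rect (4 * g) p)).
have cq' : continuous q'.
  apply: (@continuous_within_comp _ _ _ (annulus 2^-1) q
    (fun p => m (clamp_rect (4 * g) p))) => //.
    exact: continuous_comp1 (@clamp_rect_continuous R _) (@polar_continuous R
      _).
  by move=> p; exact/mA/clamp_rectP.
have [||||||||||E1 E2 E3] := @quotient_transfer _ _ _
    (annulus 2^-1) (circle 2^-1) (rect (4 * g)) (rect (4 * g) `&` [set p | p.2
      = 1])
    (side_pairing g) (glue w) q q' m m' _ _ mA _ _ _ qG _ _ _ _ _.
- by move=> p; rewrite /circle /annulus /= => ->; rewrite lexx expr2; lra.
- by move=> p [].
- by move=> p /m'P[].
- by move=> p [_ /= p1]; rewrite /circle /= polar_sqr p1; congr (_ ^+ 2); field.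
- move=> p; rewrite /circle /= => pc.
  have [|[r1 r2] mE] := m'P p; first by rewrite /annulus /= pc lexx expr2; lra.
  split=> //=; have := polar_sqr (4 * g) (m' p).
  rewrite -/m mE pc => /esym/eqP; rewrite eqrXn2 //.
  + by move/eqP; exact: half.
  + by case/andP: r2 => _; exact: half0.
- by move=> p pr; rewrite /q' clamp_rect_id.
- by move=> p p'; exact: glue_handles.
- move=> p p' /side_pairing_glued [u [v [u01 v01 -> -> uv]]].
  have z01 : 0 <= (0 : R) <= 1 by rewrite lexx ler01.
  have [h1 h2] := m'P _ (bA u); have [h3 h4] := m'P _ (bA v).
  apply: (@glued_trans _ _ _ (u, 0)).
    by apply: (polar_glued N0) => //; rewrite -/m h2 bp.
  apply: glued_trans uv _.
  by apply: (polar_glued N0) => //; rewrite -/m h4 bp.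
- move=> p pr; have [h1 h2] := m'P _ (mA p pr).
  by apply: (polar_glued N0).
- by move=> p pA; have [_ ->] := m'P p pA; exact: rst_refl.
by exists q'; split=> //; rewrite wN ?E1 ?E2.
Qed.

End Subsurface.

Section Roots.
Context {R : realType} (F : closed_oriented_surface R).

(** The calculus of words is applied to the property of presenting [S]; a word [s ++ s] with [s] of
    length [2 g] or [2 g + 1] gives the two values of [n]. *)
Lemma subsurface_spinnable (g : nat) (S C : set F) :
  subsurface_of_genus g S C -> forall n, n \in [:: (4 * g)%N; (4 * g + 2)%N] ->
  exists2 Q, spinnable S n Q & [set Q (t, 1) | t in setT] = C.
Proof.
move=> Sg n nE; have [g0 _] := Sg; have Pg := subsurface_presentable Sg.
pose P := presentable (R := R) S C.
have Prot w1 w2 : P (w1 ++ w2) -> P (w2 ++ w1) by exact: presentable_rot.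
have Pslide u V Z W : u \notin V -> u \notin Z -> u \notin W ->
  P (u :: V ++ Z ++ u :: W) -> P (u :: Z ++ V ++ u :: W).
  exact: presentable_slide.
have Psub a b c U : a <> b -> a <> c -> b <> c -> a \notin U -> b \notin U ->
    c \notin U -> P [:: a, b, a, b & U] -> P [:: a, c, b, c, a, b & U].
  by move=> ab ac bc aU bU cU; exact: presentable_subdivide.
have [s [us sn Ps]] : exists s, [/\ uniq s, (size s + size s)%N = n & P (s ++
  s)].
  move: nE; rewrite !inE => /orP[] /eqP ->.
    have [s [us ss Ps]] := handles_even Prot Pslide Pg.
    by exists s; split=> //; rewrite ss; lia.
  have [s [us ss Ps]] := handles_odd Prot Pslide Psub g0 Pg.
  by exists s; split=> //; rewrite ss; lia.
rewrite -sn; apply: opposite_spinnable => //.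
have : (0 < n)%N by move: nE; rewrite !inE => /orP[] /eqP ->; lia.
by rewrite -sn addn_gt0 orbb.
Qed.

End Roots.

Theorem corollary5p3 (R : realType) (F : closed_oriented_surface R)
    (g1 g2 : nat) (C : set F) (tC : Mod F) :
  (1 <= g2)%N -> (g2 <= g1)%N ->
  closed_surface_of_genus F (g1 + g2) ->
  separates C g1 g2 ->
  is_dehn_twist C tC ->
  exists h : Mod F, (h ^+ lcmn (4 * g1) (4 * g2 + 2))%g = tC.
Proof.
move=> _ _ _ [_ [S1 [S2 [cover seam S1g S2g]]]] [f [a [aP fE f_out]] ->].
have [Q1 P1 C1] := subsurface_spinnable S1g (mem_head _ _).
have [|Q2 P2 C2] := @subsurface_spinnable _ _ _ _ _ S2g (4 * g2 + 2).
  by rewrite !inE eqxx orbT.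
exact: (left_twist_root aP fE f_out P1 P2 cover seam C1 C2).
Qed.
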